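(* Consider $Y=X\mu_0+\xi$ with $X=Z\Sigma^{1/2}$, where $Z\in\mathbb R^{m\times n}$ has independent, mean-zero, unit-variance, uniformly sub-gaussian entries, $\Sigma\in\mathbb R^{n\times n}$ is an invertible covariance matrix, and $\xi=\sigma_\xi\xi_0$, where $\xi_0$ has i.i.d. mean-zero, unit-variance, uniformly sub-gaussian entries. Suppose $\|\Sigma^{-1}\|_{\mathrm{op}}\vee\|\Sigma\|_{\mathrm{op}}\le K$ for some $K>0$. Fix a small enough $\vartheta\in(0,1/50)$ (below a suitable absolute constant). The following hold for all $\#\in\{\mathsf{pred},\mathsf{est},\mathsf{in}\}$. (1) (Noisy case) Suppose $1/K\le\phi^{-1}\le K$ and $1/K\le\sigma_\xi^2\le K$. Fix $\delta\in(0,1/2]$ and $L\ge K/\delta^2$. There exist a constant $C=C(K,L,\delta,\vartheta)>0$ and a measurable set $\mathcal U_{\delta,\vartheta}\subset B_n(1)\setminus B_n(\delta)$ with $\mathrm{vol}(\mathcal U_{\delta,\vartheta})/\mathrm{vol}(B_n(1)\setminus B_n(\delta))\ge1-Ce^{-n^\vartheta/C}$, such that $$\sup_{\mu_0\in\mathcal U_{\delta,\vartheta}}\mathbb P\bigg(\inf_{\eta'\in\Xi_L:|\eta'-\mathsf{SNR}_{\mu_0}^{-1}|\ge\delta}\Big|R^{\#}_{(\Sigma,\mu_0)}(\eta')-\min_{\eta\in\Xi_L}R^{\#}_{(\Sigma,\mu_0)}(\eta)\Big|<\frac1C\bigg)\le Cn^{-1/7}.$$ (2) (Noiseless case) Suppose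 $1+1/K\le\phi^{-1}\le K$ and $\sigma_\xi^2=0$. There exist a constant $C=C(K,\vartheta)>0$ and a measurable set $\mathcal U_\vartheta\subset B_n(1)$ with $\mathrm{vol}(\mathcal U_\vartheta)/\mathrm{vol}(B_n(1))\ge1-Ce^{-n^\vartheta/C}$, such that $$\sup_{\mu_0\in\mathcal U_\vartheta}\mathbb P\Big(R^{\#}_{(\Sigma,\mu_0)}(0)\ge\min_{\eta\in[0,K]}R^{\#}_{(\Sigma,\mu_0)}(\eta)+n^{-\vartheta}\Big)\le Cn^{-1/7}.$$
   Context: $m,n\in\mathbb N$, $\phi=m/n$, $\|\cdot\|$ is the Euclidean norm, $B_n(R)$ the closed Euclidean ball, $\mathrm{vol}$ Lebesgue measure, $a\vee b=\max\{a,b\}$, $\mathsf{SNR}_{\mu_0}=\|\mu_0\|^2/\sigma_\xi^2$. $\Xi_L\equiv[\mathbf 1_{\phi^{-1}<1+1/L}L^{-1},L]$. Uniformly sub-gaussian: all entries have $\psi_2$ Orlicz norm bounded by a fixed universal constant. $Z$ and $\xi$ are independent. The infimum over an empty set is $+\infty$. Ridge(less) estimator: for $\eta>0$, $\hat\mu_\eta=\frac1n\big(\frac1nX^\top X+\eta I_n\big)^{-1}X^\top Y$; and $\hat\mu_0=(X^\top X)^-X^\top Y$ (Moore–Penrose pseudo-inverse), used when $\phi^{-1}>1$. Risks: $R^{\mathsf{pred}}_{(\Sigma,\mu_0)}(\eta)=\|\Sigma^{1/2}(\hat\mu_\eta-\mu_0)\|^2$, $R^{\mathsf{est}}_{(\Sigma,\mu_0)}(\eta)=\|\hat\mu_\eta-\mu_0\|^2$,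 $R^{\mathsf{in}}_{(\Sigma,\mu_0)}(\eta)=n^{-1}\|X(\hat\mu_\eta-\mu_0)\|^2$. *)

(* Defs.v *)
From HB Require Import structures.
From mathcomp Require Import all_boot all_order all_algebra.
From mathcomp Require Import all_classical all_reals all_analysis.

Set Implicit Arguments.
Unset Strict Implicit.
Unset Printing Implicit Defensive.

Import Order.TTheory GRing.Theory Num.Theory.
Import numFieldNormedType.Exports.

Local Open Scope classical_set_scope.
Local Open Scope ring_scope.

Section linear_algebra.
Context {R : realType}.

(* The library norm on matrices is the sup norm, hence this definition. *)
Definition enorm n (v : 'cV[R]_n) : R := Num.sqrt (\sum_(i < n) v i 0 ^+ 2).

Definition opnorm m n (A : 'M[R]_(m, n)) : R :=
  sup [set enorm (A *m v) | v in [set v : 'cV[R]_n | enorm v <= 1]].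

Definition psdmx n (A : 'M[R]_n) : Prop :=
  A^T = A /\ forall v : 'cV[R]_n, 0 <= (v^T *m A *m v) 0 0.

(* The square root of a positive semidefinite matrix exists and is unique; the
   default value 0 is only reached outside of that case. *)
Definition sqrtmx n (A : 'M[R]_n) : 'M[R]_n :=
  xget 0 [set S | psdmx S /\ S *m S = A].

(* The Moore-Penrose pseudo-inverse, by the four Penrose equations, which have
   exactly one solution. MathComp's pinvmx does not satisfy the last two. *)
Definition penrose m n (A : 'M[R]_(m, n)) : 'M[R]_(n, m) :=
  xget 0 [set G | [/\ A *m G *m A = A, G *m A *m G = G,
                      (A *m G)^T = A *m G & (G *m A)^T = G *m A]].

Definition eball n (r : R) : set 'cV[R]_n := [set v | enorm v <= r].

End linear_algebra.
Arguments eball {R} n r.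

Section volume.
Context {R : realType}.

(* n-dimensional Lebesgue measure, as the iterated integral of the measures of
   the slices (Tonelli). *)
Fixpoint lebesgue_tuple n : set (n.-tuple (measurableTypeR R)) -> \bar R :=
  match n with
  | 0 => fun A => \d_([tuple] : 0.-tuple (measurableTypeR R)) A
  | n'.+1 => fun A =>
      (\int[@lebesgue_measure R]_x
         @lebesgue_tuple n' [set t | A (cons_tuple x t)])%E
  end.

Definition col_of_tuple n (t : n.-tuple (measurableTypeR R)) : 'cV[R]_n :=
  \col_i tnth t i.

(* The library has no sigma-algebra on matrices: that of n.-tuple R, which is
   generated by the coordinates, is transported. *)
Definition borel_cV n (U : set 'cV[R]_n) : Prop :=
  measurable (@col_of_tuple n @^-1` U).

Definition vol n (U : set 'cV[R]_n) : R :=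
  fine (lebesgue_tuple (@col_of_tuple n @^-1` U)).

End volume.

Section random_families.
Context {d} {T : measurableType d} {R : realType} (P : probability T R).

(* The psi_2 Orlicz norm; +oo when no t is admissible. *)
Definition psi2_norm (X : T -> R) : \bar R :=
  ereal_inf [set t%:E | t in [set t : R |
    0 < t /\ ('E_P[fun w => expR (X w ^+ 2 / t ^+ 2)] <= 2%:E)%E]].

Definition mutually_independent (I : finType) (X : I -> T -> R) : Prop :=
  forall (J : {set I}) (A : I -> set (measurableTypeR R)),
    (forall i, measurable (A i)) ->
    P (\bigcap_(i in [set` J]) (X i @^-1` A i)) =
    (\prod_(i in J) P (X i @^-1` A i))%E.

Definition sigma_of (I : Type) (X : I -> T -> R) : set (set T) :=
  <<s \bigcup_(i in [set: I])
        preimage_set_system setT (X i : T -> measurableTypeR R) measurable >>.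

Definition independent_families (I J : Type) (X : I -> T -> R)
    (Y : J -> T -> R) : Prop :=
  forall E F, sigma_of X E -> sigma_of Y F -> P (E `&` F) = (P E * P F)%E.

Definition same_distribution (X Y : {RV P >-> R}) : Prop :=
  forall A, measurable A -> distribution P X A = distribution P Y A.

Definition standard_subgaussian (B : R) (X : {RV P >-> R}) : Prop :=
  [/\ ('E_P[X] = 0)%E, ('V_P[X] = 1)%E & (psi2_norm X <= B%:E)%E].

End random_families.

Section ridge.
Context {R : realType}.

Definition aspect_ratio (m n : nat) : R := m%:R / n%:R.

Definition ridge_estimator m n (X : 'M[R]_(m, n)) (Y : 'cV[R]_m) (eta : R) :
    'cV[R]_n :=
  if eta == 0 then penrose (X^T *m X) *m X^T *m Y
  else n%:R^-1 *: (invmx (n%:R^-1 *: (X^T *m X) + eta%:M) *m X^T *m Y).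

Inductive risk_kind := Pred | Est | In.

(* The risk at eta of the model with covariance Sigma, signal mu0, realized
   whitened design Z and realized noise xi. *)
Definition ridge_risk (k : risk_kind) m n (Sigma : 'M[R]_n) (mu0 : 'cV[R]_n)
    (Z : 'M[R]_(m, n)) (xi : 'cV[R]_m) (eta : R) : R :=
  let X := Z *m sqrtmx Sigma in
  let Y := X *m mu0 + xi in
  let err := ridge_estimator X Y eta - mu0 in
  match k with
  | Pred => enorm (sqrtmx Sigma *m err) ^+ 2
  | Est => enorm err ^+ 2
  | In => n%:R^-1 * enorm (X *m err) ^+ 2
  end.

(* The risk is nonnegative and continuous in eta >= 0, hence for compact
   nonempty A in [0, +oo[ this infimum is a minimum. *)
Definition min_over (A : set R) (f : R -> R) : R := inf (f @` A).

Definition Xi (m n : nat) (L : R) : set R :=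
  `[(if (aspect_ratio m n)^-1 < 1 + 1 / L then L^-1 else 0), L].

Definition SNR n (sigma : R) (mu0 : 'cV[R]_n) : R := enorm mu0 ^+ 2 / sigma ^+ 2.

Context {d} {T : measurableType d} (P : probability T R).

Definition random_matrix m n (Z : 'I_m -> 'I_n -> {RV P >-> R}) (w : T) :
    'M[R]_(m, n) := \matrix_(i, j) Z i j w.

Definition noise m (sigma : R) (xi0 : 'I_m -> {RV P >-> R}) (w : T) :
    'cV[R]_m := \col_i (sigma * xi0 i w).

Record ridge_model (B K : R) m n (Sigma : 'M[R]_n) (sigma : R)
    (Z : 'I_m -> 'I_n -> {RV P >-> R}) (xi0 : 'I_m -> {RV P >-> R}) : Prop := {
  rm_m_gt0 : (0 < m)%N ;
  rm_n_gt0 : (0 < n)%N ;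
  rm_Sigma_psd : psdmx Sigma ;
  rm_Sigma_unit : Sigma \in unitmx ;
  rm_Sigma_bound : Num.max (opnorm (invmx Sigma)) (opnorm Sigma) <= K ;
  rm_Z_indep :
    mutually_independent P (fun p : 'I_m * 'I_n => Z p.1 p.2 : T -> R) ;
  rm_Z_subgaussian : forall i j, standard_subgaussian B (Z i j) ;
  rm_xi0_indep : mutually_independent P (fun i => xi0 i : T -> R) ;
  rm_xi0_ident : forall i j, same_distribution (xi0 i) (xi0 j) ;
  rm_xi0_subgaussian : forall i, standard_subgaussian B (xi0 i) ;
  rm_Z_xi_indep :
    independent_families P (fun p : 'I_m * 'I_n => Z p.1 p.2 : T -> R)
      (fun i w => noise sigma xi0 w i 0) }.

End ridge.

(* Main.v *)
Require Import Defs.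
From HB Require Import structures.
From mathcomp Require Import all_boot all_order all_algebra.
From mathcomp Require Import all_classical all_reals all_analysis.
From mathcomp Require Import ring lra.
From mathcomp Require Import complex.

Set Implicit Arguments.
Unset Strict Implicit.
Unset Printing Implicit Defensive.

Import Order.TTheory GRing.Theory Num.Theory.
Import numFieldNormedType.Exports measurable_realfun.

Local Open Scope classical_set_scope.
Local Open Scope ring_scope.

(** The theorem compares the risks at two regularizations for one and the same
    realization of the data, hence only needs laws of large numbers for finitely
    many quadratic forms, and no deterministic equivalent of the risk.

    Write [x] for the normalized design, [S] for its Gram matrix, [a] for the
    normalized noise, [r e = (S + e)^-1] and [h = r z (S mu + x^T a)]. By the
    resolvent identity the errors at [e] and [z] differ by [(z - e) r e h], so that
    the risk at [e] minus the risk at [z] is a quadratic term, the gain, plus a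
    cross term. The gain is bounded below by the pure noise part of [|r z h| ^ 2]
    ([gain_lower], [gain_res]), which is of order one because the trace of [S r z]
    is of order [n] ([gain_trace], [trace_resolvent_low]). The cross term is a
    quadratic polynomial in the noise and in the signal ([cross_term_expand]). Its
    mean given the design, for a signal uniform on a sphere, is
    [sigma ^ 2 - z |mu| ^ 2] times a trace, for the three risks alike: it vanishes
    when [z] is the inverse of the signal-to-noise ratio ([cross_term_small]).
    Hence this [z] beats every [e] at distance [delta] by a constant ([risk_gap]).

    Quadratic forms of the noise given the design, and of a row of the design given
    the other rows, concentrate by [quadratic_form_chebyshev]; the second case
    gives the traces of resolvents through the Sherman-Morrison formula. Quadratic
    forms of the signal concentrate exponentially for the uniform measure on the
    ball ([ball_quadratic_form]), by exponential tilting and a bound for Gaussian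
    integrals. Fubini's theorem ([typical_signals]) turns this into a set of signals
    of nearly full volume such that each of them behaves well for most designs: the
    set depends on the law of the data but not on the data.

    Down to [e = 0], when the design has a null space, the resolvents are not
    bounded. The cross term is then only kept behind the spectral cut-off
    [cutoff x b], at the price of a penalty ([form_lower_coercive], [penalty_small])
    which is small with [b], because on the row space few eigenvalues are below [b]
    ([range_trace_high]); no invertibility of a random matrix is needed.

    Without noise the error at [e] is the error at [0], which is in the null space
    of the design, plus a vector of its row space. For the estimation and in-sample
    risks this gives the minimum at [0] at once; for the prediction risk the
    interaction of the two vectors through the covariance is a quadratic form of
    the signal of trace zero ([null_cross_trace]), and the same concentration and
    cut-off apply, at scales decreasing with [n] ([noiseless_gap]). *)

(** * Euclidean norm, operator bounds and Frobenius norm *)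

Section euclidean.
Context {R : realType}.

Definition dot n (u v : 'cV[R]_n) : R := (u^T *m v) 0 0.

Lemma dotE n (u v : 'cV[R]_n) : dot u v = \sum_i u i 0 * v i 0.
Proof. by rewrite /dot mxE; apply: eq_bigr => i _; rewrite mxE. Qed.

Lemma dotC n (u v : 'cV[R]_n) : dot u v = dot v u.
Proof. by rewrite !dotE; apply: eq_bigr => i _; rewrite mulrC. Qed.

Lemma dotDr n (u v w : 'cV[R]_n) : dot u (v + w) = dot u v + dot u w.
Proof. by rewrite /dot mulmxDr mxE. Qed.

Lemma dotDl n (u v w : 'cV[R]_n) : dot (u + v) w = dot u w + dot v w.
Proof. by rewrite dotC dotDr !(dotC w). Qed.

Lemma dotNr n (u v : 'cV[R]_n) : dot u (- v) = - dot u v.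
Proof. by rewrite /dot mulmxN mxE. Qed.

Lemma dotNl n (u v : 'cV[R]_n) : dot (- u) v = - dot u v.
Proof. by rewrite dotC dotNr dotC. Qed.

Lemma dotBr n (u v w : 'cV[R]_n) : dot u (v - w) = dot u v - dot u w.
Proof. by rewrite dotDr dotNr. Qed.

Lemma dotBl n (u v w : 'cV[R]_n) : dot (u - v) w = dot u w - dot v w.
Proof. by rewrite dotDl dotNl. Qed.

Lemma dotZr n a (u v : 'cV[R]_n) : dot u (a *: v) = a * dot u v.
Proof. by rewrite /dot -scalemxAr mxE. Qed.

Lemma dotZl n a (u v : 'cV[R]_n) : dot (a *: u) v = a * dot u v.
Proof. by rewrite dotC dotZr dotC. Qed.

Lemma dot0r n (u : 'cV[R]_n) : dot u 0 = 0.
Proof. by rewrite /dot mulmx0 mxE. Qed.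

Lemma dot_mulr m n (A : 'M[R]_(m, n)) u v :
  dot u (A *m v) = dot (A^T *m u) v.
Proof. by rewrite /dot trmx_mul trmxK mulmxA. Qed.

Lemma dot_mull m n (A : 'M[R]_(m, n)) u v :
  dot (A *m u) v = dot u (A^T *m v).
Proof. by rewrite dotC dot_mulr dotC. Qed.

Lemma dot_ge0 n (u : 'cV[R]_n) : 0 <= dot u u.
Proof. by rewrite dotE; apply: sumr_ge0 => i _; rewrite -expr2 sqr_ge0. Qed.

Lemma dot_eq0 n (u : 'cV[R]_n) : dot u u = 0 -> u = 0.
Proof.
move/eqP; rewrite dotE psumr_eq0; last by move=> i _; rewrite -expr2 sqr_ge0.
move=> /allP u0; apply/matrixP => i j; rewrite ord1 mxE.
have := u0 i (mem_index_enum i).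
by rewrite -expr2 sqrf_eq0 => /eqP.
Qed.

Lemma enormE n (u : 'cV[R]_n) : enorm u = Num.sqrt (dot u u).
Proof. by rewrite /enorm dotE. Qed.

Lemma enorm_ge0 n (u : 'cV[R]_n) : 0 <= enorm u.
Proof. exact: sqrtr_ge0. Qed.

Lemma enorm_sqr n (u : 'cV[R]_n) : enorm u ^+ 2 = dot u u.
Proof. by rewrite enormE sqr_sqrtr // dot_ge0. Qed.

Lemma enormN n (u : 'cV[R]_n) : enorm (- u) = enorm u.
Proof. by rewrite !enormE dotNl dotNr opprK. Qed.

Lemma enormZ n a (u : 'cV[R]_n) : enorm (a *: u) = `|a| * enorm u.
Proof.
by rewrite !enormE dotZl dotZr mulrA -expr2 sqrtrM ?sqr_ge0 // sqrtr_sqr.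
Qed.

Lemma enorm0 n : enorm (0 : 'cV[R]_n) = 0.
Proof. by rewrite enormE dot0r sqrtr0. Qed.

Lemma dot_CS n (u v : 'cV[R]_n) : `|dot u v| <= enorm u * enorm v.
Proof.
have [u0|u0] := eqVneq (dot u u) 0.
  have -> := dot_eq0 u0; rewrite dotC dot0r normr0.
  by rewrite mulr_ge0 ?enorm_ge0.
have ugt : 0 < dot u u by rewrite lt_neqAle eq_sym u0 dot_ge0.
rewrite -(@ler_pXn2r _ 2) // ?nnegrE ?mulr_ge0 ?enorm_ge0 ?normr_ge0 //.
rewrite exprMn !enorm_sqr real_normK ?num_real //.
have := dot_ge0 (v - (dot u v / dot u u) *: u).
rewrite !dotBr !dotBl !dotZr !dotZl (dotC v u).
set a := dot u u in ugt *; set b := dot u v; set c := dot v v => H.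
have : 0 <= a * (c - b / a * b - (b / a * b - b / a * (b / a * a))).
  by rewrite mulr_ge0 // ltW.
suff -> : a * (c - b / a * b - (b / a * b - b / a * (b / a * a))) =
   a * c - b ^+ 2 by rewrite subr_ge0.
by field; rewrite gt_eqF.
Qed.

Lemma enormD n (u v : 'cV[R]_n) : enorm (u + v) <= enorm u + enorm v.
Proof.
rewrite -(@ler_pXn2r _ 2) // ?nnegrE ?addr_ge0 ?enorm_ge0 //.
rewrite enorm_sqr dotDr !dotDl (dotC v u) sqrrD !enorm_sqr.
have := le_trans (ler_norm _) (dot_CS u v); rewrite mulr2n; lra.
Qed.

Lemma enormB n (u v : 'cV[R]_n) : enorm (u - v) <= enorm u + enorm v.
Proof. by rewrite -(enormN v); exact: enormD. Qed.

Definition bnd m n (A : 'M[R]_(m, n)) (c : R) : Prop :=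
  forall v, enorm (A *m v) <= c * enorm v.

Lemma bnd_le m n (A : 'M[R]_(m, n)) c c' : bnd A c -> c <= c' -> bnd A c'.
Proof.
by move=> Ac cc' v; apply: le_trans (Ac v) _; rewrite ler_wpM2r ?enorm_ge0.
Qed.

Lemma bnd_mul m n p (A : 'M[R]_(m, n)) (B : 'M[R]_(n, p)) a b : 0 <= a ->
  bnd A a -> bnd B b -> bnd (A *m B) (a * b).
Proof.
move=> a0 Aa Bb v; rewrite -mulmxA; apply: le_trans (Aa _) _.
by rewrite -mulrA ler_wpM2l.
Qed.

Lemma bnd_add m n (A B : 'M[R]_(m, n)) a b :
  bnd A a -> bnd B b -> bnd (A + B) (a + b).
Proof.
move=> Aa Bb v; rewrite mulmxDl; apply: le_trans (enormD _ _) _.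
by rewrite mulrDl lerD.
Qed.

Lemma bnd_opp m n (A : 'M[R]_(m, n)) a : bnd A a -> bnd (- A) a.
Proof. by move=> Aa v; rewrite mulNmx enormN. Qed.

Lemma bnd_scale m n (A : 'M[R]_(m, n)) k a :
  bnd A a -> bnd (k *: A) (`|k| * a).
Proof.
by move=> Aa v; rewrite -scalemxAl enormZ -mulrA ler_wpM2l.
Qed.

Lemma bnd1 n : bnd (1%:M : 'M[R]_n) 1.
Proof. by move=> v; rewrite mul1mx mul1r. Qed.

Lemma bnd_tr m n (A : 'M[R]_(m, n)) a : 0 <= a -> bnd A a -> bnd A^T a.
Proof.
move=> a0 Aa v.
have [z|z] := eqVneq (enorm (A^T *m v)) 0; first by rewrite z mulr_ge0 ?enorm_ge0.
have zgt : 0 < enorm (A^T *m v) by rewrite lt_neqAle eq_sym z enorm_ge0.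
rewrite -(ler_pM2r zgt) -expr2 enorm_sqr dot_mull trmxK.
apply: le_trans (ler_norm _) _; apply: le_trans (dot_CS _ _) _.
by rewrite mulrAC mulrC ler_wpM2r // ?enorm_ge0.
Qed.

Lemma bnd_dot m n (A : 'M[R]_(m, n)) a u v : bnd A a ->
  `|dot u (A *m v)| <= a * (enorm u * enorm v).
Proof.
move=> Aa; apply: le_trans (dot_CS _ _) _.
by rewrite mulrCA ler_wpM2l ?enorm_ge0.
Qed.

Definition fro m n (A : 'M[R]_(m, n)) : R := \sum_i \sum_j A i j ^+ 2.

Lemma fro_ge0 m n (A : 'M[R]_(m, n)) : 0 <= fro A.
Proof. by apply: sumr_ge0 => i _; apply: sumr_ge0 => j _; exact: sqr_ge0. Qed.

Lemma mxtrace_trmul m n (A B : 'M[R]_(m, n)) :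
  \tr (A^T *m B) = \sum_i \sum_j A i j * B i j.
Proof.
rewrite exchange_big; apply: eq_bigr => j _; rewrite mxE.
by apply: eq_bigr => i _; rewrite mxE.
Qed.

Lemma fro_trace m n (A : 'M[R]_(m, n)) : fro A = \tr (A^T *m A).
Proof. by rewrite mxtrace_trmul. Qed.

Lemma fro_tr m n (A : 'M[R]_(m, n)) : fro A^T = fro A.
Proof. by rewrite !fro_trace trmxK mxtrace_mulC. Qed.

Lemma fro_col m n (A : 'M[R]_(m, n)) : fro A = \sum_j dot (col j A) (col j A).
Proof.
rewrite /fro exchange_big; apply: eq_bigr => j _; rewrite dotE.
by apply: eq_bigr => i _; rewrite !mxE expr2.
Qed.

Lemma fro_mull m n p (A : 'M[R]_(m, n)) (B : 'M[R]_(n, p)) a : 0 <= a ->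
  bnd A a -> fro (A *m B) <= a ^+ 2 * fro B.
Proof.
move=> a0 Aa; rewrite !fro_col mulr_sumr; apply: ler_sum => j _.
have -> : col j (A *m B) = A *m col j B by rewrite !colE mulmxA.
by rewrite -!enorm_sqr -exprMn ler_pXn2r ?nnegrE ?mulr_ge0 ?enorm_ge0.
Qed.

Lemma fro_mulr m n p (A : 'M[R]_(m, n)) (B : 'M[R]_(n, p)) b : 0 <= b ->
  bnd B b -> fro (A *m B) <= b ^+ 2 * fro A.
Proof.
move=> b0 Bb; rewrite -fro_tr trmx_mul -(fro_tr A); apply: fro_mull => //.
exact: bnd_tr.
Qed.

Lemma fro1 n : fro (1%:M : 'M[R]_n) = n%:R.
Proof. by rewrite fro_trace trmx1 mul1mx mxtrace1. Qed.

Lemma fro_bnd m n (A : 'M[R]_(m, n)) a : 0 <= a -> bnd A a ->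
  fro A <= a ^+ 2 * n%:R.
Proof. by move=> a0 Aa; rewrite -fro1 -{1}(mulmx1 A); exact: fro_mull. Qed.

Lemma trace_CS m n (A B : 'M[R]_(m, n)) :
  \tr (A^T *m B) ^+ 2 <= fro A * fro B.
Proof.
have toV (C : 'M[R]_(m, n)) : fro C = dot (mxvec C)^T (mxvec C)^T.
  rewrite /fro pair_big /= dotE.
  rewrite (reindex (uncurry (@mxvec_index m n))) /=; last first.
    by case: (curry_mxvec_bij m n) => g g1 g2; exists g.
  by apply: eq_bigr => -[i j] _ /=; rewrite !mxE mxvecE expr2.
have -> : \tr (A^T *m B) = dot (mxvec A)^T (mxvec B)^T.
  rewrite mxtrace_trmul pair_big /= dotE.
  rewrite [RHS](reindex (uncurry (@mxvec_index m n))) /=; last first.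
    by case: (curry_mxvec_bij m n) => g g1 g2; exists g.
  by apply: eq_bigr => -[i j] _ /=; rewrite !mxE !mxvecE.
rewrite !toV -!enorm_sqr -exprMn -real_normK ?num_real //.
by rewrite ler_pXn2r ?nnegrE ?mulr_ge0 ?enorm_ge0 ?normr_ge0 // dot_CS.
Qed.

Lemma trace_bnd n (A : 'M[R]_n) a : 0 <= a -> bnd A a -> `|\tr A| <= a * n%:R.
Proof.
move=> a0 Aa.
rewrite -(@ler_pXn2r _ 2) // ?nnegrE ?mulr_ge0 //.
rewrite real_normK ?num_real //.
have := trace_CS 1%:M A; rewrite trmx1 mul1mx fro1 => /le_trans; apply.
have -> : (a * n%:R) ^+ 2 = n%:R * (a ^+ 2 * n%:R) by ring.
by rewrite ler_wpM2l // fro_bnd.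
Qed.

Lemma bnd_fro m n (A : 'M[R]_(m, n)) : bnd A (Num.sqrt (fro A)).
Proof.
move=> u; rewrite -(@ler_pXn2r _ 2) // ?nnegrE ?mulr_ge0 ?enorm_ge0 ?sqrtr_ge0 //.
rewrite exprMn (sqr_sqrtr (fro_ge0 A)) !enorm_sqr.
rewrite dotE /fro mulr_suml; apply: ler_sum => i _.
have -> : (A *m u) i 0 = dot (row i A)^T u.
  by rewrite dotE mxE; apply: eq_bigr => j _; rewrite !mxE.
have -> : \sum_j A i j ^+ 2 = dot (row i A)^T (row i A)^T.
  by rewrite dotE; apply: eq_bigr => j _; rewrite !mxE expr2.
rewrite -expr2 -!enorm_sqr -exprMn -real_normK ?num_real //.
by rewrite ler_pXn2r ?nnegrE ?mulr_ge0 ?enorm_ge0 ?normr_ge0 // dot_CS.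
Qed.

Lemma mxentry_bnd m n (A : 'M[R]_(m, n)) c i j : bnd A c -> `|A i j| <= c.
Proof.
move=> Ac; have := Ac (delta_mx j 0); rewrite -colE.
have -> : enorm (delta_mx j 0 : 'cV[R]_n) = 1.
  rewrite enormE dotE (bigD1 j) //= big1 => [|k kj]; rewrite !mxE ?(negbTE kj) ?mul0r //.
  by rewrite !eqxx mulr1 addr0 sqrtr1.
rewrite mulr1; apply: le_trans; rewrite -sqrtr_sqr enormE ler_wsqrtr // dotE (bigD1 i) //= !mxE -expr2.
by rewrite lerDl; apply: sumr_ge0 => k _; rewrite -expr2 sqr_ge0.
Qed.

(** The supremum defining the operator norm is over a bounded set, because the
    Frobenius norm is a bound. *)
Lemma opnorm_bnd m n (A : 'M[R]_(m, n)) K : opnorm A <= K -> bnd A K.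
Proof.
move=> AK v.
have froB := bnd_fro A.
have sub (u : 'cV[R]_n) : enorm u <= 1 -> enorm (A *m u) <= K.
  move=> u1; apply: le_trans AK; apply: ub_le_sup; last by exists u.
  exists (Num.sqrt (fro A)) => _ [w /= w1 <-].
  by apply: le_trans (froB w) _; rewrite ler_piMr ?sqrtr_ge0.
have [v0|v0] := eqVneq (enorm v) 0.
  have := froB v; rewrite v0 !mulr0 => h.
  exact: h.
have vgt : 0 < enorm v by rewrite lt_neqAle eq_sym v0 enorm_ge0.
have := sub ((enorm v)^-1 *: v).
rewrite enormZ ger0_norm ?invr_ge0 ?enorm_ge0 // mulVf // => /(_ (lexx _)).
by rewrite -scalemxAr enormZ ger0_norm ?invr_ge0 ?enorm_ge0 // ler_pdivrMl // mulrC.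
Qed.

End euclidean.

(** * Functions of a symmetric matrix *)

Section functional_calculus.
Context {R : realType}.

Lemma interpolation_ex (s : seq R) (f : R -> R) :
  exists p : {poly R}, forall x, x \in s -> p.[x] = f x.
Proof.
elim: s => [|x s [p ps]]; first by exists 0.
have [xs|xs] := boolP (x \in s).
  by exists p => y; rewrite inE => /orP[/eqP->|]; exact: ps.
pose q := \prod_(y <- s) ('X - y%:P).
have qx : q.[x] != 0.
  by rewrite -/(root q x) root_prod_XsubC.
exists (p + ((f x - p.[x]) / q.[x]) *: q) => y.
rewrite inE hornerD hornerZ => /orP[/eqP->|ys].
  by rewrite divfK // addrC subrK.
have /eqP -> : root q y by rewrite root_prod_XsubC.
by rewrite mulr0 addr0 ps.
Qed.

(** Over the complexification the matrix is unitarily diagonalizable, with real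
    eigenvalues: a real polynomial vanishing at these kills the matrix. *)
Lemma symmetric_annihilated n (A : 'M[R]_n.+1) : A^T = A ->
  exists s : seq R, forall p : {poly R},
    (forall x, x \in s -> p.[x] = 0) -> horner_mx A p = 0.
Proof.
move=> Asym.
pose f : {rmorphism R -> R[i]} := real_complex R.
have f_inj : injective f by exact: complex.complexI.
have f_real x : f x \is Num.real by apply/Creal_ImP; rewrite -complexIm.
pose B := map_mx f A.
have Bherm : B \is hermsymmx.
  apply: realsym_hermsym.
    by apply/is_hermitianmxP; rewrite expr0 scale1r map_mx_id // map_trmx Asym.
  by apply/mxOverP => i j; rewrite mxE.
have /hermitian_normalmx /orthomx_spectralP BE := Bherm.
set P := spectralmx B in BE; set D := spectral_diag B in BE.
have Dreal j : D 0 j = f (complex.Re (D 0 j)).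
  have /mxOverP /(_ 0 j) := hermitian_spectral_diag_real Bherm.
  by move=> Dr; rewrite -[LHS]RRe_real.
exists [seq complex.Re (D 0 j) | j <- enum 'I_n.+1] => p p0.
have : map_mx f (horner_mx A p) = 0.
  rewrite map_horner_mx.
  have -> : (A ^ f)%sesqui = invmx P *m diag_mx D *m P by exact: BE.
  have Pu : P \is a GRing.unit by exact: spectral_unit.
  rewrite (horner_mx_uconjC _ _ Pu) horner_mx_diag.
  have -> : map_mx (horner (map_poly f p)) D = 0.
    apply/matrixP => i j; rewrite ord1 !mxE Dreal horner_map p0 ?rmorph0 //.
    by apply/mapP; exists j => //; rewrite mem_enum.
  by rewrite linear0 mulmx0 mul0mx.
by move/matrixP => h; apply/matrixP => i j; have := h i j; rewrite !mxE => /eqP;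
  rewrite -(rmorph0 f) => /eqP /f_inj.
Qed.

Lemma horner_mx_tr n (A : 'M[R]_n.+1) p : A^T = A ->
  (horner_mx A p)^T = horner_mx A p.
Proof.
move=> Asym; elim/poly_ind: p => [|p c IH]; first by rewrite rmorph0 trmx0.
rewrite rmorphD rmorphM /= horner_mx_X horner_mx_C linearD /= tr_scalar_mx.
congr (_ + _); rewrite -[LHS]/((horner_mx A p *m A)^T) trmx_mul Asym IH.
exact/esym/(comm_horner_mx p (comm_mx_refl A)).
Qed.

Lemma functional_calculus n (A : 'M[R]_n) : A^T = A ->
  exists phi : (R -> R) -> 'M[R]_n,
    [/\ phi id = A, forall f, (phi f)^T = phi f,
        forall f g, phi f *m phi g = phi (fun x => f x * g x) &
        forall f g, phi (fun x => f x - g x) = phi f - phi g].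
Proof.
case: n A => [|n] A Asym.
  by exists (fun=> A); split=> *; apply/matrixP => -[].
have [s sP] := symmetric_annihilated Asym.
have [pol polP] := choice (interpolation_ex s).
have eqH (p q : {poly R}) : (forall x, x \in s -> p.[x] = q.[x]) ->
    horner_mx A p = horner_mx A q.
  move=> pq; apply/eqP; rewrite -subr_eq0 -rmorphB; apply/eqP/sP => x xs.
  by rewrite hornerD hornerN pq ?subrr.
exists (fun f => horner_mx A (pol f)); split.
- by rewrite (eqH _ 'X) ?horner_mx_X // => x xs; rewrite polP // hornerX.
- by move=> f; exact: horner_mx_tr.
- move=> f g; rewrite -[LHS]/(horner_mx A (pol f) * horner_mx A (pol g)) -rmorphM.
  by apply: eqH => x xs; rewrite hornerM !polP.
- move=> f g; rewrite -rmorphB.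
  by apply: eqH => x xs; rewrite hornerD hornerN !polP.
Qed.

Definition form n (A : 'M[R]_n) (v : 'cV[R]_n) : R := dot v (A *m v).

Lemma psdmx_form n (A : 'M[R]_n) v : psdmx A -> 0 <= form A v.
Proof. by case=> _ /(_ v); rewrite /form /dot mulmxA. Qed.

(** The positive and negative parts [p ^ 2] and [q ^ 2] of the matrix satisfy
    [p q = 0], so that on the range of [q] the form is minus a square: the
    negative part vanishes. *)
Lemma psd_sqrt_ex n (A : 'M[R]_n) : psdmx A ->
  exists S, psdmx S /\ S *m S = A.
Proof.
move=> Apsd; have [phi [phi1 phiT phiM phiB]] := functional_calculus Apsd.1.
pose p x : R := Num.sqrt (Num.max x 0); pose q x : R := Num.sqrt (Num.max (- x) 0).
pose r x : R := Num.sqrt (p x).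
have pp x : p x * p x - q x * q x = x.
  rewrite /p /q -!expr2 !sqr_sqrtr ?le_max ?lexx ?orbT //.
  by case: (leP 0 x) => x0; case: (leP 0 (- x)) => x1; lra.
have pq x : p x * q x = 0.
  rewrite /p /q; have [x0|x0] := leP 0 x; last first.
    by rewrite sqrtr0 mul0r.
  have [x1|x1] := leP 0 (- x); last by rewrite sqrtr0 mulr0.
  by have -> : x = 0 by [lra]; rewrite oppr0 sqrtr0 mulr0.
have AE : A = phi p *m phi p - phi q *m phi q.
  by rewrite !phiM -phiB -{1}phi1; congr phi; apply/funext => x; rewrite pp.
have phi0 : phi (fun=> 0) = 0.
  rewrite -[RHS](subrr (phi (fun=> 0))) -phiB; congr phi.
  by apply/funext => x; rewrite subr0.
have pq0 : phi p *m phi q = 0.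
  by rewrite phiM -phi0; congr phi; apply/funext => x; rewrite pq.
have q0 : phi q *m phi q = 0.
  apply/trmx_inj/row_matrixP => i.
  have key (v : 'cV[R]_n) : phi q *m phi q *m v = 0.
    apply: dot_eq0; apply/eqP; rewrite eq_le dot_ge0 andbT.
    have := psdmx_form (phi q *m v) Apsd.
    rewrite /form AE mulmxBl dotBr -!mulmxA (mulmxA (phi p) (phi q)) pq0 mul0mx.
    rewrite mulmx0 dot0r sub0r oppr_ge0 => h; apply: le_trans h.
    by rewrite [leRHS]dot_mulr phiT.
  by rewrite -tr_col linear0 colE key trmx0 row0.
have pr : phi p = phi r *m phi r.
  by rewrite phiM; congr phi; apply/funext => x; rewrite -expr2 sqr_sqrtr ?sqrtr_ge0.
exists (phi p); split; last by rewrite [RHS]AE q0 subr0.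
split=> [|v]; first exact: phiT.
rewrite -mulmxA pr -mulmxA -[X in 0 <= X]/(dot v (phi r *m (phi r *m v))).
by rewrite dot_mulr phiT dot_ge0.
Qed.

Lemma sqrtmxP n (A : 'M[R]_n) : psdmx A ->
  psdmx (sqrtmx A) /\ sqrtmx A *m sqrtmx A = A.
Proof. by move=> /psd_sqrt_ex; rewrite /sqrtmx => h; case: xgetP => // /(_ _); case: h => S hS /(_ S). Qed.

Lemma penroseP n (A : 'M[R]_n) : A^T = A ->
  [/\ A *m penrose A *m A = A, penrose A *m A *m penrose A = penrose A,
      (A *m penrose A)^T = A *m penrose A & (penrose A *m A)^T = penrose A *m A].
Proof.
move=> Asym; rewrite /penrose; case: xgetP => [G _ //|/(_ _) none].
have [phi [phi1 phiT phiM _]] := functional_calculus Asym.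
exfalso; apply: (none (phi (fun x => x^-1))).
have VV (x : R) : x * x^-1 * x = x.
  have [->|x0] := eqVneq x 0; first by rewrite mulr0.
  by rewrite divff // mul1r.
rewrite -phi1 /= !phiM; split; rewrite ?phiT //.
  by congr phi; apply/funext => x /=; exact: VV.
by congr phi; apply/funext => x /=; rewrite -{2}(invrK x) VV.
Qed.

(** The Penrose equations determine the inverse, so that the inverse of a
    symmetric matrix is symmetric and commutes with it. *)
Lemma penrose_sym n (A : 'M[R]_n) : A^T = A ->
  (penrose A)^T = penrose A /\ A *m penrose A = penrose A *m A.
Proof.
move=> Asym; have [p1 p2 p3 p4] := penroseP Asym; set G := penrose A in p1 p2 p3 p4 *.
have AG : A *m G = G^T *m A by rewrite -p3 trmx_mul Asym.
have GA : G *m A = A *m G^T by rewrite -p4 trmx_mul Asym.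
have e1 : A *m G = A *m G^T.
  have p1' : A *m G^T *m A = A by rewrite -[RHS]Asym -[in RHS]p1 !trmx_mul Asym mulmxA.
  have h : (A *m G^T) *m (A *m G) = A *m G by rewrite mulmxA p1'.
  have := congr1 trmx h; rewrite trmx_mul p3 -GA p4 GA mulmxA p1.
  by move=> ->.
have comm : A *m G = G *m A by rewrite e1 GA.
split => //.
have h : G^T *m A *m G^T = G^T by rewrite -[X in _ = X^T]p2 !trmx_mul Asym mulmxA.
by rewrite -[RHS]p2 -mulmxA e1 mulmxA -comm AG h.
Qed.

End functional_calculus.

(** * Resolvents of a Gram matrix *)

Section resolvent.
Context {R : realType}.

Definition res n (S : 'M[R]_n) (e : R) : 'M[R]_n := invmx (S + e%:M).

Lemma unitmx_inj n (A : 'M[R]_n) : (forall v : 'cV[R]_n, A *m v = 0 -> v = 0) ->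
  A \in unitmx.
Proof.
move=> Ainj; rewrite -unitmx_tr -row_free_unit -kermx_eq0.
apply/eqP/row_matrixP => i; rewrite row0; apply: trmx_inj; rewrite trmx0.
apply: Ainj; apply: trmx_inj; rewrite trmx_mul trmxK trmx0 -row_mul.
by rewrite mulmx_ker row0.
Qed.

Section psd.
Context n (S : 'M[R]_n) (Spsd : psdmx S).

Lemma shift_ge e v : 0 <= e -> e * enorm v <= enorm ((S + e%:M) *m v).
Proof.
move=> e0; have [v0|v0] := eqVneq (enorm v) 0.
  by rewrite v0 mulr0 enorm_ge0.
have vgt : 0 < enorm v by rewrite lt_neqAle eq_sym v0 enorm_ge0.
rewrite -(ler_pM2r vgt); apply: le_trans (dot_CS _ _).
apply: le_trans (ler_norm _); rewrite -mulrA -expr2 enorm_sqr mulmxDl dotDl.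
rewrite mul_scalar_mx dotZl lerDr dotC.
exact: (psdmx_form v Spsd).
Qed.

Lemma shift_ge_psd e v : 0 <= e -> enorm (S *m v) <= enorm ((S + e%:M) *m v).
Proof.
move=> e0; rewrite -(@ler_pXn2r _ 2) // ?nnegrE ?enorm_ge0 //.
rewrite !enorm_sqr mulmxDl mul_scalar_mx !dotDl !dotDr !dotZl !dotZr.
have sv := psdmx_form v Spsd; rewrite /form (dotC v) in sv.
rewrite ?(dotC v (S *m v)).
have vv := dot_ge0 v.
rewrite -addrA lerDl !addr_ge0 ?mulr_ge0 //.
Qed.

Context (e : R) (e_gt0 : 0 < e).

Lemma shift_unit : S + e%:M \in unitmx.
Proof.
apply: unitmx_inj => v v0; apply: dot_eq0; rewrite -enorm_sqr.
have := shift_ge v (ltW e_gt0); rewrite v0 enorm0 pmulr_rle0 // => h.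
have -> : enorm v = 0 by apply/eqP; rewrite eq_le h enorm_ge0.
by rewrite expr0n.
Qed.

Lemma resKl : res S e *m (S + e%:M) = 1%:M.
Proof. by rewrite mulVmx ?shift_unit. Qed.

Lemma resKr : (S + e%:M) *m res S e = 1%:M.
Proof. by rewrite mulmxV ?shift_unit. Qed.

Lemma res_tr : (res S e)^T = res S e.
Proof. by rewrite /res trmx_inv linearD /= Spsd.1 tr_scalar_mx. Qed.

Lemma res_bnd : bnd (res S e) e^-1.
Proof.
move=> v; rewrite ler_pdivlMl //.
by apply: le_trans (shift_ge _ (ltW e_gt0)) _; rewrite mulmxA resKr mul1mx.
Qed.

Lemma mul_resE : S *m res S e = 1%:M - e *: res S e.
Proof.
by have := resKr; rewrite mulmxDl mul_scalar_mx => <-; rewrite addrK.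
Qed.

Lemma res_mulE : res S e *m S = 1%:M - e *: res S e.
Proof.
by have := resKl; rewrite mulmxDr mul_mx_scalar => <-; rewrite addrK.
Qed.

Lemma res_comm : res S e *m S = S *m res S e.
Proof. by rewrite mul_resE res_mulE. Qed.

Lemma mul_res_bnd : bnd (S *m res S e) 1.
Proof.
move=> v; rewrite mul1r -mulmxA; apply: le_trans (shift_ge_psd _ (ltW e_gt0)) _.
by rewrite mulmxA resKr mul1mx.
Qed.

Lemma scale_resE : e *: res S e = 1%:M - S *m res S e.
Proof. by rewrite mul_resE subKr. Qed.

End psd.

Lemma res_diff n (S : 'M[R]_n) e z : psdmx S -> 0 < e -> 0 < z ->
  res S e - res S z = (z - e) *: (res S e *m res S z).
Proof.
move=> Sp e0 z0.
have -> : res S e - res S z = res S e *m ((S + z%:M) - (S + e%:M)) *m res S z.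
  by rewrite mulmxBr mulmxBl resKl // mul1mx -mulmxA resKr // mulmx1.
rewrite opprD addrACA subrr add0r -raddfB /= mul_mx_scalar.
by rewrite -scalemxAl.
Qed.

Lemma res_resC n (S : 'M[R]_n) e z : psdmx S -> 0 < e -> 0 < z ->
  res S e *m res S z = res S z *m res S e.
Proof.
move=> Sp e0 z0; have [->//|ez] := eqVneq e z.
have h := res_diff Sp e0 z0; have h' := res_diff Sp z0 e0.
apply: (@scalerI _ _ (z - e)); first by rewrite subr_eq0 eq_sym.
by rewrite -h -opprB h' -scaleNr opprB.
Qed.

Section gram.
Context m n (x : 'M[R]_(m, n)).

Definition gram : 'M[R]_n := locked (x^T *m x).

Lemma gramE : gram = x^T *m x.
Proof. by rewrite /gram -lock. Qed.

Lemma gram_form v : form gram v = enorm (x *m v) ^+ 2.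
Proof. by rewrite enorm_sqr /form gramE -mulmxA dot_mulr trmxK. Qed.

Lemma gram_psd : psdmx gram.
Proof.
split; first by rewrite gramE trmx_mul trmxK.
move=> v; have := gram_form v; rewrite /form /dot mulmxA => ->.
exact: sqr_ge0.
Qed.

Lemma gram_trace : \tr gram = fro x.
Proof. by rewrite fro_trace gramE. Qed.

Lemma mul_gram_res_bnd e : 0 < e -> bnd (x *m res gram e) (Num.sqrt e^-1).
Proof.
move=> e0 v; rewrite -(@ler_pXn2r _ 2) // ?nnegrE ?mulr_ge0 ?enorm_ge0 ?sqrtr_ge0 //.
have e'0 : 0 <= e^-1 by rewrite invr_ge0 ltW.
rewrite exprMn (sqr_sqrtr e'0) -mulmxA -gram_form /form mulmxA.
apply: le_trans (ler_norm _) _; apply: le_trans (dot_CS _ _) _.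
rewrite expr2 mulrA ler_pM ?enorm_ge0 //; first exact: (res_bnd gram_psd).
by have := mul_res_bnd gram_psd e0 v; rewrite mul1r.
Qed.

Lemma res_gram_tr_bnd e : 0 < e -> bnd (res gram e *m x^T) (Num.sqrt e^-1).
Proof.
move=> e0; have := bnd_tr (sqrtr_ge0 _) (mul_gram_res_bnd e0).
by rewrite trmx_mul res_tr //; exact: gram_psd.
Qed.

(** The orthogonal projection onto the range of the Gram matrix. *)
Definition rangeproj : 'M[R]_n := gram *m penrose gram.

Lemma rangeproj_tr : rangeproj^T = rangeproj.
Proof. by have [_ _ ->] := penroseP gram_psd.1. Qed.

Lemma rangeprojC : rangeproj = penrose gram *m gram.
Proof. by have [_] := penrose_sym gram_psd.1. Qed.

Lemma rangeproj_gram : rangeproj *m gram = gram.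
Proof. by have [] := penroseP gram_psd.1. Qed.

Lemma gram_rangeproj : gram *m rangeproj = gram.
Proof. by rewrite rangeprojC mulmxA rangeproj_gram. Qed.

Lemma rangeproj_idem : rangeproj *m rangeproj = rangeproj.
Proof. by rewrite {2}/rangeproj mulmxA rangeproj_gram. Qed.

Lemma mul_rangeproj : x *m rangeproj = x.
Proof.
apply/eqP; rewrite eq_sym -subr_eq0 -{1}(mulmx1 x) -mulmxBr.
have h (v : 'cV[R]_n) : x *m (1%:M - rangeproj) *m v = 0.
  apply: dot_eq0; rewrite -enorm_sqr -mulmxA -gram_form /form mulmxA.
  by rewrite mulmxBr mulmx1 gram_rangeproj subrr mul0mx dot0r.
apply/eqP/trmx_inj/row_matrixP => i.
by rewrite -tr_col colE h !trmx0 row0.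
Qed.

Lemma idem_bnd (A : 'M[R]_n) : A^T = A -> A *m A = A -> bnd A 1.
Proof.
move=> At AA v; rewrite mul1r.
have [z|z] := eqVneq (enorm (A *m v)) 0; first by rewrite z enorm_ge0.
have zgt : 0 < enorm (A *m v) by rewrite lt_neqAle eq_sym z enorm_ge0.
rewrite -(ler_pM2r zgt) -expr2 enorm_sqr dot_mull At mulmxA AA.
by apply: le_trans (ler_norm _) _; exact: dot_CS.
Qed.

Lemma rangeproj_bnd : bnd rangeproj 1.
Proof. exact: idem_bnd rangeproj_tr rangeproj_idem. Qed.

Lemma rangeproj_trace : \tr rangeproj <= m%:R.
Proof.
rewrite rangeprojC gramE mulmxA mxtrace_mulC -gramE mulmxA.
set E := x *m penrose gram *m x^T.
have Et : E^T = E.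
  by rewrite /E !trmx_mul trmxK (penrose_sym gram_psd.1).1 mulmxA.
have EE : E *m E = E.
  rewrite /E -!mulmxA; congr (_ *m _); rewrite !mulmxA; congr (_ *m _).
  rewrite -(mulmxA (penrose gram)) -gramE.
  by have [] := penroseP gram_psd.1.
clearbody E.
have Eii i : E i i <= 1.
  have h : E i i ^+ 2 <= E i i.
    suff : E i i ^+ 2 <= (E *m E) i i by rewrite EE.
    rewrite mxE (bigD1 i) //= expr2 lerDl; apply: sumr_ge0 => j _.
    by rewrite -[X in E i j * X]/(E j i) -{1}Et mxE -expr2 sqr_ge0.
  rewrite leNgt; apply/negP => l1; move: h; rewrite expr2 leNgt ltr_pMl ?l1 //.
  exact: lt_trans l1.
by rewrite -[leRHS](@mxtrace1 R m); apply: ler_sum => i _; rewrite mxE eqxx.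
Qed.

Lemma res_rangeprojC e : 0 < e ->
  res gram e *m rangeproj = rangeproj *m res gram e.
Proof.
move=> e0; have c : (gram + e%:M) *m rangeproj = rangeproj *m (gram + e%:M).
  by rewrite mulmxDl mulmxDr gram_rangeproj rangeproj_gram mul_scalar_mx mul_mx_scalar.
rewrite -[RHS]mul1mx -(resKl gram_psd e0) -mulmxA (mulmxA (gram + _)) c.
by rewrite -[in RHS]mulmxA resKr ?mulmx1 //; exact: gram_psd.
Qed.

Lemma res_kernel e : 0 < e ->
  e *: (res gram e *m (1%:M - rangeproj)) = 1%:M - rangeproj.
Proof.
move=> e0; rewrite scalemxAl (scale_resE gram_psd e0) mulmxBl mul1mx.
rewrite -(res_comm gram_psd e0) -mulmxA mulmxBr mulmx1 gram_rangeproj subrr.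
by rewrite mulmx0 subr0.
Qed.

(** The regularized spectral cut-off to the eigenvalues above [b]; its
    complement is small on the range except near small eigenvalues. *)
Definition cutoff b : 'M[R]_n :=
  (gram *m res gram b) *m (gram *m res gram b).

Lemma cutoff_bnd b : 0 < b -> bnd (cutoff b) 1.
Proof.
move=> b0; have h := mul_res_bnd gram_psd b0.
by rewrite -[1](mulr1 1); apply: bnd_mul.
Qed.

Lemma cutoff_tr b : 0 < b -> (cutoff b)^T = cutoff b.
Proof.
move=> b0; rewrite /cutoff !trmx_mul res_tr //; last exact: gram_psd.
by rewrite gram_psd.1 (res_comm gram_psd b0).
Qed.

Lemma cutoffCE b : 0 < b ->
  1%:M - cutoff b = (1%:M + gram *m res gram b) *m (b *: res gram b).
Proof.
move=> b0; rewrite (scale_resE gram_psd b0) mulmxBr mulmx1 mulmxDl mul1mx.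
by rewrite opprD addrA addrK.
Qed.

Lemma cutoffC_bnd b : 0 < b -> bnd (1%:M - cutoff b) 2.
Proof.
move=> b0; rewrite -[2]/(1 + 1); apply: bnd_add; first exact: bnd1.
exact/bnd_opp/cutoff_bnd.
Qed.

Lemma gram_cutoffC_bnd b : 0 < b ->
  bnd (x *m (1%:M - cutoff b)) (2 * Num.sqrt b).
Proof.
move=> b0; rewrite (cutoffCE b0).
have c : gram *m res gram b = res gram b *m gram by rewrite (res_comm gram_psd).
have -> : (1%:M + gram *m res gram b) *m (b *: res gram b) =
   b *: (res gram b *m (1%:M + gram *m res gram b)).
  by rewrite -scalemxAr mulmxDl mulmxDr mul1mx mulmx1 c -mulmxA c.
rewrite -scalemxAr mulmxA.
apply: (@bnd_le _ _ _ _ (`|b| * (Num.sqrt b^-1 * 2))).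
  apply: bnd_scale; apply: bnd_mul (mul_gram_res_bnd b0) _; first exact: sqrtr_ge0.
  by rewrite -[2]/(1 + 1); apply: bnd_add; [exact: bnd1|exact: (mul_res_bnd gram_psd)].
rewrite gtr0_norm // sqrtrV; last exact: ltW.
rewrite -{1}(sqr_sqrtr (ltW b0)) expr2 mulrA -(mulrA (Num.sqrt b)) mulfV.
  by rewrite mulr1 mulrC.
by rewrite gt_eqF // sqrtr_gt0.
Qed.

Lemma cutoffC_fro b : 0 < b ->
  fro (rangeproj *m (1%:M - cutoff b)) <= 4 * (b * \tr (rangeproj *m res gram b)).
Proof.
move=> b0; rewrite (cutoffCE b0).
have c : rangeproj *m (1%:M + gram *m res gram b) =
    (1%:M + gram *m res gram b) *m rangeproj.
  rewrite mulmxDr mulmxDl mulmx1 mul1mx mulmxA rangeproj_gram; congr (_ + _).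
  by rewrite -mulmxA (res_rangeprojC b0) mulmxA gram_rangeproj.
rewrite mulmxA c -mulmxA; apply: (@le_trans _ _ (2 ^+ 2 * fro (rangeproj *m (b *: res gram b)))).
  apply: fro_mull => //; rewrite -[2]/(1 + 1).
  by apply: bnd_add; [exact: bnd1|exact: (mul_res_bnd gram_psd)].
have -> : 2 ^+ 2 = 4 :> R by rewrite expr2 -natrM.
rewrite ler_pM2l // -scalemxAr fro_trace.
rewrite [(b *: _)^T]linearZ /= -scalemxAl -scalemxAr !mxtraceZ ler_pM2l //.
rewrite trmx_mul rangeproj_tr (res_tr gram_psd) -mulmxA (mulmxA rangeproj) rangeproj_idem.
rewrite -subr_ge0 -mxtraceZ -raddfB /=.
have -> : rangeproj *m res gram b - b *: (res gram b *m (rangeproj *m res gram b))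
   = (x *m res gram b)^T *m (x *m res gram b).
  have -> : (x *m res gram b)^T *m (x *m res gram b) = res gram b *m gram *m res gram b.
    by rewrite trmx_mul (res_tr gram_psd) gramE !mulmxA.
  rewrite scalemxAl (scale_resE gram_psd b0) mulmxBl mul1mx subKr.
  by rewrite mulmxA -(res_comm gram_psd b0) -(mulmxA _ _ rangeproj) gram_rangeproj.
by rewrite -fro_trace fro_ge0.
Qed.

(** The mass of the resolvent on the range is read off the diagonal of the
    [m]-dimensional dual resolvent, whatever the null space of [x] is. *)
Lemma res_range_trace b : 0 < b ->
  b * \tr (rangeproj *m res gram b) <= m%:R - \tr (gram *m res gram b).
Proof.
move=> b0; rewrite -mxtraceZ scalemxAr (scale_resE gram_psd b0) mulmxBr mulmx1.
by rewrite mulmxA rangeproj_gram raddfB /= lerD2r rangeproj_trace.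
Qed.

(** The test function [F e = cutoff b * res e] is Lipschitz down to [e = 0]. *)
Lemma cutoff_resE b e : 0 < b -> 0 < e ->
  cutoff b *m res gram e = res gram b *m (gram *m res gram b) *m (gram *m res gram e).
Proof.
move=> b0 e0; rewrite /cutoff -(res_comm gram_psd b0) -!mulmxA; congr (_ *m _).
by rewrite !mulmxA (res_comm gram_psd b0) -!mulmxA.
Qed.

Lemma cutoff_res_bnd b e : 0 < b -> 0 < e -> bnd (cutoff b *m res gram e) b^-1.
Proof.
move=> b0 e0; rewrite cutoff_resE // -[b^-1]mulr1 -[X in X * 1]mulr1.
have b'0 : 0 <= b^-1 by rewrite invr_ge0 ltW.
apply: bnd_mul; first by rewrite mulr1.
  apply: bnd_mul => //; first exact: (res_bnd gram_psd).
  exact: (mul_res_bnd gram_psd).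
exact: (mul_res_bnd gram_psd).
Qed.

Lemma cutoff_res_diff_bnd b e z : 0 < b -> 0 < e -> 0 < z ->
  bnd (cutoff b *m res gram e - cutoff b *m res gram z) (`|e - z| * b ^- 2).
Proof.
move=> b0 e0 z0; rewrite -mulmxBr (res_diff gram_psd e0 z0) -scalemxAr distrC.
apply: bnd_scale; rewrite mulmxA (cutoff_resE b0 e0).
have cS := res_comm gram_psd b0.
have -> : res gram b *m (gram *m res gram b) *m (gram *m res gram e) *m res gram z
  = res gram b *m res gram b *m (gram *m res gram e) *m (gram *m res gram z).
  rewrite -!mulmxA; congr (_ *m _).
  rewrite [LHS]mulmxA -cS -!mulmxA; congr (_ *m _).
  rewrite (mulmxA (res gram e)) (res_comm gram_psd e0) -!mulmxA; congr (_ *m _).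
have b'0 : 0 <= b^-1 by rewrite invr_ge0 ltW.
rewrite -[b ^- 2]mulr1 -[X in X * 1]mulr1; apply: bnd_mul.
- by rewrite mulr1 invr_ge0 exprn_ge0 // ltW.
- apply: bnd_mul; [by rewrite invr_ge0 exprn_ge0 // ltW| |exact: (mul_res_bnd gram_psd)].
  rewrite -exprVn expr2; apply: bnd_mul => //; exact: (res_bnd gram_psd).
exact: (mul_res_bnd gram_psd).
Qed.

End gram.

(** ** Leaving out one row *)

Section leave_one_out.
Context m n (x : 'M[R]_(m, n)) (a : 'I_m).

Definition zero_row : 'M[R]_(m, n) := \matrix_(i, j) if i == a then 0 else x i j.

Lemma gram_zero_row : gram x = gram zero_row + (row a x)^T *m row a x.
Proof.
apply/matrixP => i j; rewrite !gramE !mxE (bigD1 a) //= [in RHS](bigD1 a) //= !mxE eqxx mul0r add0r.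
rewrite big_ord1 !mxE addrC; congr (_ + _); apply: eq_bigr => k ka.
by rewrite !mxE (negbTE ka).
Qed.

(** The Sherman-Morrison formula for the rank-one update by row [a]: the form of
    row [a] enters through the resolvent of the remaining rows. *)
Lemma leave_one_out e : 0 < e ->
  let t := (row a x *m res (gram zero_row) e *m (row a x)^T) 0 0 in
  0 <= t /\ (x *m res (gram x) e *m x^T) a a = 1 - (1 + t)^-1.
Proof.
move=> e0 t; set r := row a x in t *.
have t0 : 0 <= t.
  have := psdmx_form (res (gram zero_row) e *m r^T) (gram_psd zero_row).
  rewrite /form mulmxA => h1.
  have h2 := dot_ge0 (res (gram zero_row) e *m r^T).
  have : 0 <= dot (res (gram zero_row) e *m r^T)
              ((gram zero_row + e%:M) *m (res (gram zero_row) e *m r^T)).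
    by rewrite mulmxDl dotDr mul_scalar_mx dotZr addr_ge0 ?mulr_ge0 ?(ltW e0) // mulmxA.
  rewrite mulmxA resKr // ?mul1mx; last exact: gram_psd.
  by rewrite /dot trmx_mul res_tr ?trmxK //; exact: gram_psd.
split=> //; set G := res (gram x) e; set G' := res (gram zero_row) e in t t0 *.
have GG : G' - G = G' *m (r^T *m r) *m G.
  have -> : r^T *m r = (gram x + e%:M) - (gram zero_row + e%:M).
    by rewrite gram_zero_row opprD addrACA subrr addr0 addrAC subrr add0r.
  rewrite mulmxBr mulmxBl -mulmxA resKr ?mulmx1 //; last exact: gram_psd.
  by rewrite resKl ?mul1mx //; exact: gram_psd.
pose p := (r *m G *m r^T) 0 0.
have -> : (x *m G *m x^T) a a = p.
  rewrite /p /r -row_mul !mxE; apply: eq_bigr => j _; rewrite !mxE; congr (_ * _).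
have tp : t - p = t * p.
  have : (r *m (G' - G) *m r^T) 0 0 = t - p by rewrite mulmxBr mulmxBl [LHS]mxE [X in _ + X]mxE.
  rewrite GG => <-; rewrite !mulmxA -(mulmxA _ r G) -mulmxA mxE big_ord1.
  by rewrite -/t -/p.
have p1 : p * (1 + t) = t by rewrite mulrDr mulr1 mulrC -tp addrC subrK.
have t1 : 1 + t != 0 by rewrite gt_eqF // ltr_pwDl.
by apply: (mulIf t1); rewrite p1 mulrBl mulVf // mul1r addrAC subrr add0r.
Qed.

End leave_one_out.

End resolvent.

(** * Independence *)

Section independence.
Context {d} {T : measurableType d} {R : realType} (P : probability T R).

Definition indep_systems (G H : set (set T)) : Prop :=
  forall E F, G E -> H F -> P (E `&` F) = (P E * P F)%E.

Lemma indep_systemsC G H : indep_systems G H -> indep_systems H G.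
Proof. by move=> GH E F HE GF; rewrite setIC muleC; exact: GH. Qed.

Lemma sub_g_sigma_algebra (G : set (set T)) : G `<=` measurable ->
  <<s G >> `<=` measurable.
Proof.
move=> Gm; apply: smallest_sub => //; exact: sigma_algebra_measurable.
Qed.

Lemma indep_systems_gl (G H : set (set T)) : setI_closed G ->
  G `<=` measurable -> H `<=` measurable ->
  indep_systems G H -> indep_systems <<s G >> H.
Proof.
move=> GI Gm Hm GH E F GE HF.
have mF := Hm _ HF.
rewrite -setI_closed_g_dynkin_g_sigma_algebra // in GE.
pose D := [set A | measurable A /\ P (A `&` F) = (P A * P F)%E].
suff : D E by case.
move: E GE; apply: smallest_sub; last first.
  by move=> A GA; split; [exact: Gm|exact: GH].
split.
- by split=> //; rewrite setTI probability_setT mul1e.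
- move=> A [mA AF]; split; first exact: measurableC.
  have -> : ~` A `&` F = F `\` (A `&` F).
    by rewrite setDIr setDv setU0 setDE setIC.
  rewrite measureD //; [|exact: measurableI|by rewrite -ge0_fin_numE ?fin_num_measure].
  rewrite setICA setIid.
  transitivity (P F - (P A * P F))%E; first by congr (_ - _)%E; exact: AF.
  rewrite probability_setC //.
  rewrite -(@fineK _ (P A)) ?fin_num_measure // -(@fineK _ (P F)) ?fin_num_measure //.
  by rewrite -!EFinM -!EFinB mulrBl mul1r.
- move=> A tA DA; split; first by apply: bigcupT_measurable => i; case: (DA i).
  have PF : (0 <= fine (P F))%R by exact: fine_ge0.
  pose m1 : {measure set T -> \bar R} := mrestr P mF.
  pose m2 : {measure set T -> \bar R} := mscale (NngNum PF) P.
  have eqm B : D B -> m1 B = m2 B.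
    move=> [_ BF]; rewrite -[m1 B]/(P (B `&` F)) -[m2 B]/((fine (P F))%:E * P B)%E.
    by rewrite fineK ?fin_num_measure // muleC.
  have -> : P (\bigcup_n A n `&` F) = m1 (\bigcup_n A n) by [].
  have -> : (P (\bigcup_n A n) * P F)%E = m2 (\bigcup_n A n).
    rewrite -[RHS]/((fine (P F))%:E * P (\bigcup_n A n))%E.
    by rewrite fineK ?fin_num_measure // muleC.
  rewrite !measure_bigcup //; last 2 first.
    by move=> i _; case: (DA i).
    by move=> i _; case: (DA i).
  by apply: eq_eseriesr => i _; exact: eqm.
Qed.

Section families.
Context {I : finType} (X : I -> T -> R).
Hypothesis mX : forall i, measurable_fun setT (X i : T -> measurableTypeR R).

(** For the full index set these generate [sigma_of X]. *)
Definition subfam (J : {set I}) : set (set T) :=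
  \bigcup_(i in [set` J]) preimage_set_system setT (X i : T -> measurableTypeR R)
    measurable.

Lemma subfam_measurable J : subfam J `<=` measurable.
Proof. by move=> _ [i _ [A mA <-]]; exact: mX. Qed.

Definition cylinders (J : {set I}) : set (set T) :=
  [set E | exists2 A : I -> set (measurableTypeR R), (forall i, measurable (A i)) &
     E = \bigcap_(i in [set` J]) (X i @^-1` A i)].

Lemma cylinders_measurable J : cylinders J `<=` measurable.
Proof.
move=> _ [A mA ->]; apply: fin_bigcap_measurable => // i _.
by rewrite -[X in measurable X]setTI; exact: mX.
Qed.

Lemma cylindersI J : setI_closed (cylinders J).
Proof.
move=> _ _ [A mA ->] [B mB ->]; exists (fun i => A i `&` B i).
  by move=> i; exact: measurableI.
by rewrite -bigcapI; apply: eq_bigcapr => i _; rewrite preimage_setI.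
Qed.

Lemma subfam_cylinders J : <<s subfam J >> `<=` <<s cylinders J >>.
Proof.
apply: smallest_sub; first exact: smallest_sigma_algebra.
move=> _ [i Ji [A mA <-]]; apply: sub_sigma_algebra.
exists (fun j => if j == i then A else setT).
  by move=> j; case: ifP.
rewrite setTI; apply/seteqP; split=> w /=.
  by move=> Aw j _; case: ifP => // /eqP ->.
by move=> /(_ i Ji); rewrite eqxx.
Qed.

Lemma subfam_indep (J1 J2 : {set I}) : mutually_independent P X ->
  (forall i, i \in J1 -> i \notin J2) -> indep_systems <<s subfam J1 >> <<s subfam J2 >>.
Proof.
move=> Xind J12.
have base : indep_systems (cylinders J1) (cylinders J2).
  move=> _ _ [A mA ->] [B mB ->].
  pose C i := if i \in J1 then A i else B i.
  have mC i : measurable (C i) by rewrite /C; case: ifP.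
  have eqA : \bigcap_(i in [set` J1]) X i @^-1` A i = \bigcap_(i in [set` J1]) X i @^-1` C i.
    by apply: eq_bigcapr => i /= Ji; rewrite /C Ji.
  have eqB : \bigcap_(i in [set` J2]) X i @^-1` B i = \bigcap_(i in [set` J2]) X i @^-1` C i.
    by apply: eq_bigcapr => i /= Ji; rewrite /C; case: ifP => // /J12; rewrite Ji.
  rewrite eqA eqB -bigcap_setU.
  have -> : [set` J1] `|` [set` J2] = [set` J1 :|: J2].
    by apply/seteqP; split=> i /=; rewrite finset.in_setU => /orP.
  rewrite !Xind // (finset.big_setID J1) /=; congr (_ * _)%E.
    by apply: eq_bigl => i; rewrite !inE; case: (i \in J1); rewrite ?andbF.
  apply: eq_bigl => i; rewrite !inE; have := J12 i.
  by case: (i \in J1) => //= h; rewrite (negbTE (h isT)).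
have h1 := indep_systems_gl (@cylindersI J1) (@cylinders_measurable J1)
  (@cylinders_measurable J2) base.
have h2 := indep_systems_gl (@cylindersI J2) (@cylinders_measurable J2)
  (sub_g_sigma_algebra (@cylinders_measurable J1)) (indep_systemsC h1).
move=> E F GE GF; apply: (indep_systemsC h2); exact: subfam_cylinders.
Qed.

End families.

(** Two independent integrable variables have an integrable product, whose
    expectation factorizes: their joint law is the product of their laws. *)
Lemma indep_expectation (f g : T -> R) :
  measurable_fun setT f -> measurable_fun setT g ->
  (forall A B, measurable A -> measurable B ->
     P (f @^-1` A `&` g @^-1` B) = (P (f @^-1` A) * P (g @^-1` B))%E) ->
  P.-integrable setT (EFin \o f) -> P.-integrable setT (EFin \o g) ->
  P.-integrable setT (EFin \o (fun w => f w * g w : R)) /\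
  \int[P]_w (f w * g w : R) = (\int[P]_w (f w : R)) * (\int[P]_w (g w : R)).
Proof.
move=> mf mg fg intf intg.
pose h w := (f w, g w).
have mh : measurable_fun setT h by exact: measurable_fun_pair.
pose F : {mfun T >-> R} := HB.pack f (isMeasurableFun.Build _ _ _ _ _ mf).
pose G : {mfun T >-> R} := HB.pack g (isMeasurableFun.Build _ _ _ _ _ mg).
pose H : {mfun T >-> (R * R)%type} :=
  HB.pack h (isMeasurableFun.Build _ _ _ _ _ mh).
pose mF := distribution P F; pose mG := distribution P G; pose mH := distribution P H.
have law A : measurable A -> (mF \x mG)%E A = mH A.
  apply: product_measure_unique => {}A B mA mB.
  by rewrite /mF /mG /mH /distribution /pushforward /= -fg.
pose k (z : R * R) := ((z.1 : R) * (z.2 : R))%:E.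
have mk : measurable_fun [set: R * R] k.
  by apply/measurable_EFinP; apply: measurable_funM; [exact: measurable_fst|exact: measurable_snd].
have intabs (f' : T -> R) (F' : {mfun T >-> R}) : F' =1 f' ->
    P.-integrable setT (EFin \o f') ->
    (\int[distribution P F']_x `|x%:E| = \int[P]_w `|(f' w)%:E|)%E /\
    (\int[P]_w `|(f' w)%:E| < +oo)%E.
  move=> ff' /integrableP[_ fi]; split => //.
  rewrite (@ge0_integral_distribution _ _ _ _ _ P F' (fun x => `|x%:E|%E)) //.
    by apply: eq_integral => w _ /=; rewrite ff'.
  by apply: measurableT_comp => //; exact: measurableT_comp.
have [absF absFy] := intabs f F (fun=> erefl) intf.
have [absG absGy] := intabs g G (fun=> erefl) intg.
have intk : (mF \x mG)%E.-integrable [set: R * R] k.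
  apply/integrable12ltyP => //.
  under eq_integral => x _.
    under eq_integral => y _ do rewrite -[k _]/(x%:E * y%:E)%E abseM.
    rewrite ge0_integralZl //; last by
      apply: measurableT_comp => //; exact: measurableT_comp.
    over.
  rewrite ge0_integralZr //; [|by
      apply: measurableT_comp => //; exact: measurableT_comp|exact: integral_ge0].
  rewrite /mF /mG absF absG lte_mul_pinfty //; first exact: integral_ge0.
  by rewrite ge0_fin_numE //; exact: integral_ge0.
have eqH (k' : R * R -> \bar R) :
    (\int[mF \x mG]_z k' z = \int[mH]_z k' z)%E.
  by apply: eq_measure_integral => A mA _; exact: law.
have intP : P.-integrable setT (k \o h).
  apply/integrableP; split; first exact: measurableT_comp.
  have := @ge0_integral_distribution _ _ _ _ _ P H (fun z => `|k z|%E) _ (fun=> abse_ge0 _).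
  move=> <-; last exact: measurableT_comp.
  by rewrite -eqH; case/integrableP : intk.
split; first exact: intP.
have -> : \int[P]_w (f w * g w : R) = fine (\int[mF \x mG]_z k z)%E.
  by rewrite eqH (@integral_distribution _ _ _ _ _ P H).
rewrite -integral12_prod_meas1 // /fubini_F /=.
have fE (f' : T -> R) (F' : {mfun T >-> R}) : F' =1 f' ->
    P.-integrable setT (EFin \o f') ->
    (\int[distribution P F']_x x%:E = (\int[P]_w f' w)%:E)%E.
  move=> ff' fi; rewrite (@integral_distribution _ _ _ _ _ P F' EFin) //; last first.
    by apply: eq_integrable fi => // w _ /=; rewrite ff'.
  rewrite /Rintegral fineK //; last exact: integrable_fin_num.
  by apply: eq_integral => w _ /=; rewrite ff'.
have intF : mF.-integrable [set: R] EFin.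
  by apply/integrableP; split=> //; rewrite absF.
have intG : mG.-integrable [set: R] EFin.
  by apply/integrableP; split=> //; rewrite absG.
under eq_integral => x _.
  under eq_integral => y _ do rewrite -[k _]/(x%:E * y%:E)%E.
  rewrite integralZl // (fE g) //.
  over.
by rewrite integralZr // (fE f).
Qed.

End independence.

(** * Quadratic forms in independent variables *)

Section quadratic_forms.
Context {d} {T : measurableType d} {R : realType} (P : probability T R).

Local Notation Ex f := (Rintegral P setT f).
Definition intg (f : T -> R) := P.-integrable setT (EFin \o f).

Lemma intg_le (f g : T -> R) : measurable_fun setT f -> intg g ->
  (forall w, `|f w| <= g w) -> intg f.
Proof.
move=> mf ig fg; apply: le_integrable ig => //; first exact/measurable_EFinP.
by move=> w _ /=; rewrite lee_fin; apply: le_trans (fg w) _; exact: ler_norm.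
Qed.

Lemma intgD (f g : T -> R) : intg f -> intg g -> intg (fun w => f w + g w).
Proof. by move=> If Ig; exact: (integrableD _ If Ig). Qed.

Lemma intgZ k (f : T -> R) : intg f -> intg (fun w => k * f w).
Proof. by move=> If; exact: (integrableZl _ k If). Qed.

Lemma intg_cst k : intg (fun=> k).
Proof. exact: finite_measure_integrable_cst. Qed.

Lemma intg_sum (I : finType) (f : I -> T -> R) : (forall i, intg (f i)) ->
  intg (fun w => \sum_i f i w).
Proof.
move=> fi; rewrite /intg; have : P.-integrable setT (fun w => \sum_i (EFin \o f i) w)%E.
  by apply: integrable_sum => // i _; exact: fi.
by apply: eq_integrable => // w _ /=; rewrite sumEFin.
Qed.

Lemma Ex_sum (I : finType) (f : I -> T -> R) : (forall i, intg (f i)) ->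
  Ex (fun w => \sum_i f i w) = \sum_i Ex (f i).
Proof.
move=> fi.
suff h (r : seq I) : Ex (fun w => \sum_(i <- r) f i w) = \sum_(i <- r) Ex (f i) /\
    intg (fun w => \sum_(i <- r) f i w).
  by case: (h (index_enum I)).
elim: r => [|i r [IH1 IH2]].
  under eq_fun do rewrite big_nil; rewrite big_nil; split; last exact: intg_cst.
  by rewrite Rintegral_cst // mul0r.
under eq_fun do rewrite big_cons; rewrite big_cons; split; last exact: intgD.
by rewrite RintegralD // ?IH1 //; exact: fi.
Qed.

Lemma Ex_le (f g : T -> R) : intg f -> intg g -> (forall w, f w <= g w) ->
  Ex f <= Ex g.
Proof. by move=> If Ig fg; apply: le_Rintegral => // w _; exact: fg. Qed.

Lemma Ex_cst (k : R) : Ex (fun=> k) = k.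
Proof.
rewrite Rintegral_cst // [X in fine X](_ : _ = 1%E) ?mulr1 //.
exact: probability_setT.
Qed.

Lemma Ex_abs (f : T -> R) : intg f -> `|Ex f| <= Ex (fun w => `|f w|).
Proof. by move=> If; exact: le_normr_Rintegral. Qed.

Lemma measurable_set_le (f g : T -> R) : measurable_fun setT f ->
  measurable_fun setT g -> measurable [set w | f w <= g w].
Proof.
move=> mf mg; rewrite -[X in measurable X]setTI.
exact: (measurable_fun_ler mf mg measurableT (I : measurable [set true])).
Qed.

Lemma measurable_set_lt (f g : T -> R) : measurable_fun setT f ->
  measurable_fun setT g -> measurable [set w | f w < g w].
Proof.
move=> mf mg; rewrite -[X in measurable X]setTI.
exact: (measurable_fun_ltr mf mg measurableT (I : measurable [set true])).
Qed.

Lemma prob_le_Ex (A : set T) (f : T -> R) e : measurable A -> intg f ->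
  0 < e -> (forall w, 0 <= f w) -> (forall w, A w -> e <= f w) ->
  (P A <= (Ex f / e)%:E)%E.
Proof.
move=> mA If e0 f0 Af.
rewrite EFinM -(@fineK _ (P A)) ?fin_num_measure // -EFinM lee_fin ler_pdivlMr //.
have -> : fine (P A) * e = Ex (fun w => e * \1_A w).
  rewrite RintegralZl //; last exact: integrable_indic.
  rewrite mulrC; congr (_ * _); rewrite /Rintegral; congr fine.
  by rewrite integral_indic // setIT.
apply: Ex_le => //; first by apply: intgZ; exact: integrable_indic.
move=> w; rewrite indicE; have [wA|wA] := boolP (w \in A).
  by rewrite mulr1 Af // -in_setE.
by rewrite mulr0.
Qed.

Definition L4 (f : T -> R) := measurable_fun setT f /\ intg (fun w => f w ^+ 4).

Lemma L4_cst k : L4 (fun=> k).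
Proof. by split; [exact: measurable_cst|exact: intg_cst]. Qed.

Lemma amgm4 (a b c e : R) : `|a * b * c * e| <= a ^+ 4 + b ^+ 4 + c ^+ 4 + e ^+ 4.
Proof.
have sq (x y : R) : `|x * y| <= (x ^+ 2 + y ^+ 2) / 2.
  rewrite ler_norml; have := sqr_ge0 (x + y); have := sqr_ge0 (x - y).
  by rewrite !expr2; nra.
rewrite -mulrA normrM.
have h1 := sq a b; have h2 := sq c e.
apply: (@le_trans _ _ ((a ^+ 2 + b ^+ 2) / 2 * ((c ^+ 2 + e ^+ 2) / 2))).
  by apply: ler_pM.
have e4 (x : R) : x ^+ 4 = (x ^+ 2) ^+ 2 by rewrite -exprM.
rewrite !e4.
have := sqr_ge0 a; have := sqr_ge0 b; have := sqr_ge0 c; have := sqr_ge0 e.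
move: (a ^+ 2) (b ^+ 2) (c ^+ 2) (e ^+ 2) => x y z t t0 z0 y0 x0.
have := sqr_ge0 (x + y - z - t); have := sqr_ge0 (x - y); have := sqr_ge0 (z - t).
by rewrite !expr2; nra.
Qed.

Lemma L4_mul4 a b c e : L4 a -> L4 b -> L4 c -> L4 e ->
  intg (fun w => a w * b w * c w * e w).
Proof.
move=> [ma Ia] [mb Ib] [mc Ic] [me Ie].
apply: (@intg_le _ (fun w => a w ^+ 4 + b w ^+ 4 + c w ^+ 4 + e w ^+ 4)).
- by do !apply: measurable_funM.
- by do 3!apply: intgD => //.
- by move=> w; exact: amgm4.
Qed.

Lemma L4_intg a : L4 a -> intg a.
Proof.
move=> La; have := L4_mul4 La (L4_cst 1) (L4_cst 1) (L4_cst 1).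
by apply: eq_integrable => // w _ /=; rewrite !mulr1.
Qed.

Lemma L4_mul2 a b : L4 a -> L4 b -> intg (fun w => a w * b w).
Proof.
move=> La Lb; have := L4_mul4 La Lb (L4_cst 1) (L4_cst 1).
by apply: eq_integrable => // w _ /=; rewrite !mulr1.
Qed.

Lemma L4_mul3 a b c : L4 a -> L4 b -> L4 c -> intg (fun w => a w * b w * c w).
Proof.
move=> La Lb Lc; have := L4_mul4 La Lb Lc (L4_cst 1).
by apply: eq_integrable => // w _ /=; rewrite !mulr1.
Qed.

Lemma indep_systems_Ex (G H : set (set T)) (f g : T -> R) :
  G `<=` measurable -> H `<=` measurable -> indep_systems P <<s G >> <<s H >> ->
  measurable_fun [set: g_sigma_algebraType G] f ->
  measurable_fun [set: g_sigma_algebraType H] g ->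
  intg f -> intg g ->
  intg (fun w => f w * g w) /\ Ex (fun w => f w * g w) = Ex f * Ex g.
Proof.
move=> Gm Hm GH mf mg If Ig.
have pre (K : set (set T)) (k : T -> R) A : measurable_fun [set: g_sigma_algebraType K] k ->
    measurable A -> <<s K >> (k @^-1` A).
  by move=> mk mA; have := mk measurableT A mA; rewrite setTI.
apply: indep_expectation => //.
- move=> _ A mA; rewrite setTI; exact: (sub_g_sigma_algebra Gm (pre _ _ _ mf mA)).
- move=> _ A mA; rewrite setTI; exact: (sub_g_sigma_algebra Hm (pre _ _ _ mg mA)).
- by move=> A B mA mB; apply: GH; exact: pre.
Qed.

Section family.
Context {I : finType} (X : I -> T -> R) (v c4 : R).
Hypothesis X4 : forall i, L4 (X i).
Hypothesis Xind : mutually_independent P X.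
Hypothesis Xmean : forall i, Ex (X i) = 0.
Hypothesis Xvar : forall i, Ex (fun w => X i w * X i w) = v.
Hypothesis Xfourth : forall i, Ex (fun w => X i w ^+ 4) <= c4.
Hypothesis vc4 : v ^+ 2 <= c4.

Let mX i : measurable_fun setT (X i). Proof. by case: (X4 i). Qed.

Lemma subfam_fun (J : {set I}) i : i \in J ->
  measurable_fun [set: g_sigma_algebraType (subfam X J)] (X i).
Proof.
move=> iJ _ A mA; rewrite setTI; apply: sub_sigma_algebra.
by exists i => //; exists A => //; rewrite setTI.
Qed.

Lemma subfam_Ex (J1 J2 : {set I}) (f g : T -> R) :
  (forall i, i \in J1 -> i \notin J2) ->
  measurable_fun [set: g_sigma_algebraType (subfam X J1)] f ->
  measurable_fun [set: g_sigma_algebraType (subfam X J2)] g ->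
  intg f -> intg g ->
  Ex (fun w => f w * g w) = Ex f * Ex g.
Proof.
move=> J12 mf mg If Ig.
by case: (indep_systems_Ex (@subfam_measurable _ _ _ _ X mX J1)
  (@subfam_measurable _ _ _ _ X mX J2)
  (subfam_indep mX Xind J12) mf mg If Ig).
Qed.

Definition cen (p : I * I) w := X p.1 w * X p.2 w - v * (p.1 == p.2)%:R.
Local Notation swap p := (p.2, p.1).

Lemma subfam_cen (J : {set I}) p : p.1 \in J -> p.2 \in J ->
  measurable_fun [set: g_sigma_algebraType (subfam X J)] (cen p).
Proof.
move=> p1 p2; apply: measurable_funB; last exact: measurable_cst.
by apply: measurable_funM; exact: subfam_fun.
Qed.

Lemma intg_cen p : intg (cen p).
Proof.
apply: intgD; first exact: L4_mul2.
exact: intg_cst.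
Qed.

Lemma intg_cenX p i : intg (fun w => cen p w * X i w).
Proof.
have h : intg (fun w => X p.1 w * X p.2 w * X i w + (- (v * (p.1 == p.2)%:R)) * X i w).
  by apply: intgD; [exact: L4_mul3|apply: intgZ; exact: L4_intg].
by apply: eq_integrable h => // w _ /=; rewrite /cen mulrBl mulNr.
Qed.

Lemma mcen p : measurable_fun setT (cen p).
Proof.
by apply: measurable_funB; [exact: measurable_funM|exact: measurable_cst].
Qed.

Lemma cen_sqr_le p w : cen p w ^+ 2 <= X p.1 w ^+ 4 + X p.2 w ^+ 4 + 2 * v ^+ 2.
Proof.
rewrite /cen; set a := X _ w; set b := X _ w.
have -> : a ^+ 4 = (a ^+ 2) ^+ 2 by rewrite -exprM.
have -> : b ^+ 4 = (b ^+ 2) ^+ 2 by rewrite -exprM.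
have h1 := sqr_ge0 (a ^+ 2 - b ^+ 2).
have h2 := sqr_ge0 (a * b + v * (p.1 == p.2)%:R).
have h3 : (v * (p.1 == p.2)%:R) ^+ 2 <= v ^+ 2.
  by case: eqP; rewrite ?mulr1 // mulr0 expr0n sqr_ge0.
move: h1 h2 h3; move: (v * _) => u; rewrite !expr2; nra.
Qed.

Lemma intg_cen_sqr p : intg (fun w => cen p w ^+ 2).
Proof.
apply: (@intg_le _ (fun w => X p.1 w ^+ 4 + X p.2 w ^+ 4 + 2 * v ^+ 2)).
- by apply: measurable_funX; exact: mcen.
- apply: intgD; last exact: intg_cst.
  by apply: intgD; [case: (X4 p.1)|case: (X4 p.2)].
- by move=> w; rewrite ger0_norm ?sqr_ge0 // cen_sqr_le.
Qed.

Lemma Ex_cen_sqr p : Ex (fun w => cen p w ^+ 2) <= 4 * c4.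
Proof.
have I4 i : intg (fun w => X i w ^+ 4) by case: (X4 i).
apply: le_trans (Ex_le (intg_cen_sqr p) _ (cen_sqr_le p)) _.
  by apply: intgD; [apply: intgD|exact: intg_cst].
rewrite RintegralD //; [|exact: (intgD (I4 _) (I4 _))|exact: intg_cst].
rewrite RintegralD //; [|exact: I4|exact: I4].
rewrite Ex_cst.
have := Xfourth p.1; have := Xfourth p.2; move: vc4; lra.
Qed.

Lemma mul_le_sqr (a b : R) : `|a * b| <= a ^+ 2 / 2 + b ^+ 2 / 2.
Proof.
rewrite ler_norml; have := sqr_ge0 (a + b); have := sqr_ge0 (a - b).
by rewrite !expr2; nra.
Qed.

Lemma intg_cen2 p q : intg (fun w => cen p w * cen q w).
Proof.
apply: (@intg_le _ (fun w => cen p w ^+ 2 / 2 + cen q w ^+ 2 / 2)).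
- by apply: measurable_funM; exact: mcen.
- have h r : intg (fun w => cen r w ^+ 2 / 2).
    have := intgZ 2^-1 (intg_cen_sqr r).
    by apply: eq_integrable => // w _ /=; rewrite mulrC.
  exact: intgD.
- by move=> w; exact: mul_le_sqr.
Qed.

Lemma Ex_cen2 p q : `|Ex (fun w => cen p w * cen q w)| <= 4 * c4.
Proof.
apply: le_trans (Ex_abs (intg_cen2 p q)) _.
have h r : intg (fun w => 2^-1 * cen r w ^+ 2) by apply: intgZ; exact: intg_cen_sqr.
apply: le_trans (Ex_le (g := fun w => 2^-1 * cen p w ^+ 2 + 2^-1 * cen q w ^+ 2) _ _ _) _.
- by have /integrable_abse := intg_cen2 p q.
- exact: intgD.
- by move=> w; rewrite ![2^-1 * _]mulrC; exact: mul_le_sqr.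
rewrite RintegralD //; [|exact: h|exact: h].
rewrite !RintegralZl //; [|exact: intg_cen_sqr|exact: intg_cen_sqr].
have := Ex_cen_sqr p; have := Ex_cen_sqr q; lra.
Qed.

(** Some index occurs exactly once in the product, unless both pairs are
    diagonal, in which case the two centred factors are independent. *)
Lemma Ex_cen2_eq0 p q : q != p -> q != swap p ->
  Ex (fun w => cen p w * cen q w) = 0.
Proof.
have single p' q' s t : p' = (s, t) \/ p' = (t, s) -> s != t ->
    s != q'.1 -> s != q'.2 -> Ex (fun w => cen p' w * cen q' w) = 0.
  move=> p'E st s1 s2.
  have -> : (fun w => cen p' w * cen q' w) = (fun w => X s w * (cen q' w * X t w)).
    apply/funext => w; rewrite [cen p' w]/cen.
    by case: p'E => -> /=; rewrite 1?(eq_sym t) (negbTE st) mulr0 subr0; ring.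
  rewrite (@subfam_Ex [set s]%SET (~: [set s])%SET) ?Xmean ?mul0r //.
  - by move=> i; rewrite !inE => ->.
  - by apply: subfam_fun; rewrite inE.
  - apply: measurable_funM; first by apply: subfam_cen; rewrite !inE eq_sym.
    by apply: subfam_fun; rewrite !inE eq_sym.
  - exact: L4_intg.
  - exact: intg_cenX.
case: p => i j; case: q => k l /=; rewrite !xpair_eqE !negb_and => qp qsp.
have sym p' q' : Ex (fun w => cen p' w * cen q' w) = Ex (fun w => cen q' w * cen p' w).
  by congr (Rintegral _ _ _); apply/funext => w; rewrite mulrC.
have [ij|ij] := eqVneq i j; have [kl|kl] := eqVneq k l.
- subst j l; have ik : i != k by move: qp; rewrite orbb eq_sym.
  rewrite (@subfam_Ex [set i]%SET [set k]%SET).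
  + have -> : Ex (cen (i, i)) = 0 by
      rewrite RintegralD // ?Xvar /= ?Ex_cst ?eqxx ?mulr1 ?subrr //; [exact: L4_mul2|exact: intg_cst].
    by rewrite mul0r.
  + by move=> s; rewrite !inE => /eqP ->.
  + by apply: subfam_cen; rewrite inE.
  + by apply: subfam_cen; rewrite inE.
  + exact: intg_cen.
  + exact: intg_cen.
- subst j; rewrite sym; have [ki|ki] := eqVneq k i.
    by apply: (single _ _ l k); [right| rewrite eq_sym| rewrite -ki eq_sym| rewrite -ki eq_sym].
  by apply: (single _ _ k l); [left| | |].
- subst l; have [ik|ik] := eqVneq i k.
    by apply: (single _ _ j i); [right| rewrite eq_sym| rewrite -ik eq_sym| rewrite -ik eq_sym].
  by apply: (single _ _ i j); [left| | |].
- have [ik|ik] := eqVneq i k.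
    subst k; apply: (single _ _ j i); [by right|by rewrite eq_sym|by rewrite eq_sym|].
    by move: qp; rewrite eqxx /= eq_sym.
  have [il|il] := eqVneq i l.
    subst l; apply: (single _ _ j i); [by right|by rewrite eq_sym| |by rewrite eq_sym].
    by move: qsp; rewrite eqxx orbF eq_sym.
  by apply: (single _ _ i j); [left| | |].
Qed.

(** Chebyshev for a quadratic form whose random coefficients are independent of
    the variables: the centred products of distinct unordered pairs are
    uncorrelated. *)
Lemma quadratic_form_chebyshev (G : set (set T)) (Q : I -> I -> T -> R) (F e : R) :
  G `<=` measurable -> indep_systems P <<s G >> <<s subfam X [set: I] >> ->
  (forall i j, measurable_fun [set: g_sigma_algebraType G] (Q i j)) ->
  (forall w, \sum_i \sum_j Q i j w ^+ 2 <= F) -> 0 < e ->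
  let Z w := \sum_i \sum_j Q i j w * (X i w * X j w) - v * \sum_i Q i i w in
  measurable_fun setT Z /\ (P [set w | e <= `|Z w|]%R <= (8 * c4 * F / e ^+ 2)%:E)%E.
Proof.
move=> Gm GX mQ QF e0 Z.
pose q (p : I * I) w := Q p.1 p.2 w.
have ZE w : Z w = \sum_p q p w * cen p w.
  rewrite /Z mulr_sumr -[in RHS](pair_bigA _ (fun i j => q (i, j) w * cen (i, j) w)) /=.
  rewrite -sumrB; apply: eq_bigr => i _.
  rewrite [in RHS](bigD1 i) //= (bigD1 i) //= /cen /q /= eqxx mulr1.
  rewrite mulrBr [Q i i w * v]mulrC addrAC; congr (_ + _).
  by apply: eq_bigr => j ji; rewrite eq_sym (negbTE ji) mulr0 subr0.
have mq p : measurable_fun setT (q p).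
  move=> _ A mA; have := mQ p.1 p.2 measurableT A mA.
  exact: (sub_g_sigma_algebra Gm).
have mZ : measurable_fun setT Z.
  rewrite (_ : Z = fun w => \sum_p q p w * cen p w); last exact/funext.
  apply: measurable_sum => p; apply: measurable_funM => //; exact: mcen.
split=> //.
have QFp w : \sum_p q p w ^+ 2 <= F.
  by rewrite -(pair_bigA _ (fun i j => q (i, j) w ^+ 2)); exact: QF.
have qF p w : q p w ^+ 2 <= F.
  by apply: le_trans (QFp w); rewrite (bigD1 p) //= lerDl; apply: sumr_ge0 => ? _; exact: sqr_ge0.
have Iqq p r : intg (fun w => q p w * q r w).
  apply: (@intg_le _ (fun=> F)); [exact: measurable_funM|exact: intg_cst|].
  by move=> w; apply: le_trans (mul_le_sqr _ _) _; have := qF p w; have := qF r w; lra.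
have mG p r : measurable_fun [set: g_sigma_algebraType G] (fun w => q p w * q r w).
  by apply: measurable_funM; exact: mQ.
have mcT p r : measurable_fun [set: g_sigma_algebraType (subfam X [set: I])]
    (fun w => cen p w * cen r w).
  by apply: measurable_funM; apply: subfam_cen; rewrite inE.
have key p r := indep_systems_Ex Gm (@subfam_measurable _ _ _ _ X mX [set: I]%SET) GX
  (mG p r) (mcT p r) (Iqq p r) (intg_cen2 p r).
pose t p r w := q p w * q r w * (cen p w * cen r w).
have ZZ w : Z w ^+ 2 = \sum_p \sum_r t p r w.
  rewrite ZE expr2 mulr_suml; apply: eq_bigr => p _; rewrite mulr_sumr.
  by apply: eq_bigr => r _; rewrite /t mulrACA.
have It p : intg (fun w => \sum_r t p r w) by apply: intg_sum => r; case: (key p r).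
have IZ : intg (fun w => Z w ^+ 2).
  have := intg_sum It; apply: eq_integrable => // w _ /=; by rewrite ZZ.
have EZ : Ex (fun w => Z w ^+ 2) <= 8 * c4 * F.
  have -> : Ex (fun w => Z w ^+ 2) = \sum_p \sum_r Ex (t p r).
    rewrite (_ : (fun w => _) = (fun w => \sum_p \sum_r t p r w)); last exact/funext.
    rewrite Ex_sum //; apply: eq_bigr => p _; rewrite Ex_sum // => r.
    by case: (key p r).
  have Isq p : intg (fun w => q p w ^+ 2).
    have := Iqq p p; by apply: eq_integrable => // w _ /=; rewrite expr2.
  have c40 : 0 <= c4 by apply: le_trans vc4; exact: sqr_ge0.
  pose E2 p := Ex (fun w => q p w ^+ 2).
  have tb p r : Ex (t p r) <= 4 * c4 * (E2 p / 2 + E2 r / 2) * ((r == p)%:R + (r == swap p)%:R).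
    have qq : `|Ex (fun w => q p w * q r w)| <= E2 p / 2 + E2 r / 2.
      apply: le_trans (Ex_abs (Iqq p r)) _.
      have h s : intg (fun w => 2^-1 * q s w ^+ 2) by exact: intgZ.
      apply: le_trans (Ex_le (g := fun w => 2^-1 * q p w ^+ 2 + 2^-1 * q r w ^+ 2) _ _ _) _.
      - by have /integrable_abse := Iqq p r.
      - exact: intgD.
      - by move=> w; rewrite ![2^-1 * _]mulrC; exact: mul_le_sqr.
      rewrite RintegralD //; [|exact: h|exact: h].
      by rewrite !RintegralZl //; [rewrite ![_ / 2]mulrC|exact: Isq|exact: Isq].
    have E2_0 s : 0 <= E2 s by apply: Rintegral_ge0 => w _; exact: sqr_ge0.
    have [_ ->] := key p r.
    have [rp|rp] := boolP ((r == p) || (r == swap p)); last first.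
      move: rp; rewrite negb_or => /andP[r1 r2].
      by rewrite Ex_cen2_eq0 // mulr0 (negbTE r1) (negbTE r2) addr0 mulr0.
    have h1 : 1 <= (r == p)%:R + (r == swap p)%:R :> R.
      by case/orP: rp => /eqP ->; rewrite eqxx; [rewrite lerDl|rewrite lerDr].
    apply: le_trans (ler_norm _) _; rewrite normrM.
    apply: (@le_trans _ _ (4 * c4 * (E2 p / 2 + E2 r / 2))).
      rewrite mulrC; apply: ler_pM => //; exact: Ex_cen2.
    by rewrite ler_peMr // mulr_ge0 ?mulr_ge0 ?addr_ge0 ?divr_ge0.
  have sumE2 : \sum_p E2 p <= F.
    rewrite /E2 -Ex_sum //; apply: le_trans (Ex_le _ (intg_cst F) QFp) _; last by rewrite Ex_cst.
    exact: intg_sum.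
  apply: (@le_trans _ _ (\sum_p 4 * c4 * (E2 p + (E2 p / 2 + E2 (swap p) / 2)))).
    apply: ler_sum => p _.
    apply: le_trans (ler_sum _ (fun r _ => tb p r)) _.
    under eq_bigr do rewrite mulrDr.
    rewrite big_split /= mulrDr.
    have single s : \sum_r 4 * c4 * (E2 p / 2 + E2 r / 2) * (r == s)%:R =
        4 * c4 * (E2 p / 2 + E2 s / 2).
      rewrite (bigD1 s) //= eqxx mulr1 big1 ?addr0 // => r /negbTE ->.
      by rewrite mulr0.
    rewrite !single; lra.
  rewrite -mulr_sumr !big_split /=.
  have -> : \sum_p E2 (swap p) / 2 = \sum_p E2 p / 2.
    rewrite (reindex_inj (h := fun p : I * I => swap p)) /=; last by move=> [a b] [a' b'] [-> ->].
    by apply: eq_bigr => -[a b] _.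
  rewrite -!mulr_suml; move: sumE2; nra.
have mA : measurable [set w | e <= `|Z w|].
  by apply: measurable_set_le; [exact: measurable_cst|exact: measurableT_comp].
have e20 : 0 < e ^+ 2 by exact: exprn_gt0.
apply: le_trans (prob_le_Ex mA IZ e20 _ _) _.
- by move=> w; exact: sqr_ge0.
- by move=> w /= ew; rewrite -[leRHS]real_normK ?num_real // ler_pXn2r ?nnegrE // ltW.
- by rewrite lee_fin ler_pM2r ?invr_gt0.
Qed.

End family.
End quadratic_forms.

(** * Lebesgue measure on tuples and Gaussian integrals *)

Section sigma_finite_pack.
Context {d} {T : measurableType d} {R : realType} (mu : {measure set T -> \bar R}).

Definition sf_measure of sigma_finite setT mu : set T -> \bar R := mu.

Context (sf : sigma_finite setT mu).
HB.instance Definition _ := Measure.on (sf_measure sf).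
HB.instance Definition _ := Measure_isSigmaFinite.Build _ _ _ (sf_measure sf) sf.

End sigma_finite_pack.

Section tuple_measure.
Context {R : realType}.

Local Notation RR := (measurableTypeR R).
Local Notation V n := (n.-tuple (measurableTypeR R)).
Local Notation leb := (@lebesgue_measure R).

Definition consT n (z : RR * V n) : V n.+1 := cons_tuple z.1 z.2.

Lemma measurable_consT n : measurable_fun setT (@consT n).
Proof.
have := @measurable_cons _ _ (RR * V n)%type RR fst n snd (@measurable_fst _ _ _ _)
  (@measurable_snd _ _ _ _).
by congr (measurable_fun _ _); apply/funext => z; apply: val_inj.
Qed.

Lemma measurable_cons_slice n (A : set (V n.+1)) (x : RR) : measurable A ->
  measurable [set t : V n | A (cons_tuple x t)].
Proof.
move=> mA; rewrite -[X in measurable X]setTI.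
have h : measurable_fun setT (fun t : V n => consT (x, t)).
  apply: (measurableT_comp (@measurable_consT n)).
  by apply: measurable_fun_pair; [exact: measurable_cst|exact: measurable_id].
exact: (h measurableT A mA).
Qed.

(** The iterated integral is a sigma-finite measure: each step is the image of
    a product measure under concatenation. *)
Lemma lebesgue_tuple_measure n : exists mu : {sigma_finite_measure set V n -> \bar R},
  forall A, measurable A -> mu A = lebesgue_tuple A.
Proof.
elim: n => [|n [mu muE]].
  by exists (@dirac _ _ ([tuple] : V 0) R).
pose nu := pushforward (leb \x mu)%E (@consT n).
have nuE A : measurable A -> nu A = lebesgue_tuple A.
  move=> mA; rewrite /nu /pushforward /= /product_measure1.
  apply: eq_integral => x _ /=; rewrite -muE; last exact: measurable_cons_slice.
  by congr (mu _); apply/seteqP; split => t; rewrite /xsection /= inE.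
pose nu' : {measure set V n.+1 -> \bar R} :=
  measure_function_pushforward__canonical__measure_function_Measure (leb \x mu)%E (@measurable_consT n).
have sf : sigma_finite setT nu'.
  have [F1 [F1T F1nd F1y]] := (sigma_finiteP _ _).1 (sigma_finiteT leb).
  have [F2 [F2T F2nd F2y]] := (sigma_finiteP _ _).1 (sigma_finiteT mu).
  pose F k := F1 k `*` F2 k.
  have FT : \bigcup_k F k = setT.
    apply/seteqP; split => // -[x t] _.
    have : [set: RR] x by []. rewrite F1T => -[i _ Fi].
    have : [set: V n] t by []. rewrite F2T => -[j _ Fj].
    exists (maxn i j) => //; split => /=.
      by move: Fi; apply/subsetPset/F1nd/leq_maxl.
    by move: Fj; apply/subsetPset/F2nd/leq_maxr.
  have Ffin i : measurable (F i) /\ ((leb \x mu)%E (F i) < +oo)%E.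
    have [m1 y1] := F1y i; have [m2 y2] := F2y i; split; first exact: measurableX.
    by rewrite product_measure1E // lte_mul_pinfty // ge0_fin_numE.
  pose psi (t : V n.+1) : RR * V n := (thead t, [tuple of behead t]).
  have mpsi : measurable_fun setT psi.
    apply: measurable_fun_pair; last exact: measurable_behead.
    exact: measurable_tnth.
  have psiK z : psi (consT z) = z.
    by case: z => x t; rewrite /psi /consT /= theadE; congr pair; apply: val_inj.
  exists (fun i => psi @^-1` F i).
    by rewrite -preimage_bigcup FT preimage_setT.
  move=> i; have [mF Fy] := Ffin i; split.
    by rewrite -[X in measurable X]setTI; exact: mpsi.
  rewrite -[X in (X < _)%E]/((leb \x mu)%E (@consT n @^-1` (psi @^-1` F i))).
  by rewrite -comp_preimage (_ : psi \o _ = id) //; apply/funext => z; exact: psiK.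
by exists (sf_measure sf) => A mA; exact: nuE.
Qed.

Definition tmeas n : {sigma_finite_measure set V n -> \bar R} :=
  projT1 (cid (lebesgue_tuple_measure n)).

Lemma tmeasE n A : measurable A -> tmeas n A = lebesgue_tuple A.
Proof. by rewrite /tmeas; case: cid => mu /= h; exact: h. Qed.

Lemma integral_tmeas0 (f : V 0 -> \bar R) : measurable_fun setT f ->
  (\int[tmeas 0]_t f t = f [tuple])%E.
Proof.
move=> mf; rewrite (eq_measure_integral (@dirac _ _ ([tuple] : V 0) R)).
  by rewrite integral_dirac // diracT mul1e.
by move=> A mA _; exact: (tmeasE mA).
Qed.

Lemma integral_tmeasS n (f : V n.+1 -> \bar R) : measurable_fun setT f ->
  (forall t, (0 <= f t)%E) ->
  (\int[tmeas n.+1]_t f t = \int[tmeas n]_t \int[leb]_x f (cons_tuple x t))%E.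
Proof.
move=> mf f0.
pose nu : {measure set V n.+1 -> \bar R} :=
  measure_function_pushforward__canonical__measure_function_Measure
    (leb \x tmeas n)%E (@measurable_consT n).
rewrite (eq_measure_integral nu); last first.
  move=> A mA _; apply: (etrans (tmeasE mA)).
  rewrite /= /pushforward /= /product_measure1; apply: eq_integral => x _ /=; rewrite -tmeasE; last exact: measurable_cons_slice.
  by congr (tmeas n _); apply/seteqP; split => t; rewrite /xsection /= inE.
rewrite ge0_integral_pushforward //; last exact: measurable_consT.
rewrite preimage_setT (fubini_tonelli2 (f \o @consT n)) //; last by move=> z; exact: f0.
by apply: measurableT_comp => //; exact: measurable_consT.
Qed.

(** The one-dimensional Gaussian integral, after completing the square. *)
Lemma gauss1 (s a c : R) : 0 < s -> 0 < a ->
  (\int[leb]_x (expR (- (s / 2) * (a * x ^+ 2 - 2 * c * x)))%:E =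
   (Num.sqrt (2 * pi / s / a) * expR (s / 2 * (c ^+ 2 / a)))%:E)%E.
Proof.
move=> s0 a0; pose sg := Num.sqrt (s * a)^-1.
have sa0 : 0 < (s * a)^-1 by rewrite invr_gt0 mulr_gt0.
have sg0 : sg != 0 by rewrite gt_eqF // sqrtr_gt0.
have sg2 : sg ^+ 2 = (s * a)^-1 by rewrite sqr_sqrtr // ltW.
pose k := Num.sqrt (2 * pi / s / a) * expR (s / 2 * (c ^+ 2 / a)).
have h x : expR (- (s / 2) * (a * x ^+ 2 - 2 * c * x)) = k * normal_pdf (c / a) sg x.
  rewrite normal_pdfE // /normal_peak /normal_fun sg2 /k.
  have -> : Num.sqrt ((s * a)^-1 * pi *+ 2) = Num.sqrt (2 * pi / s / a).
    by congr Num.sqrt; rewrite invfM mulr2n; field; rewrite !gt_eqF.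
  have q0 : Num.sqrt (2 * pi / s / a) != 0.
    by rewrite gt_eqF // sqrtr_gt0 !divr_gt0 // mulr_gt0 // pi_gt0.
  rewrite mulrACA mulfV // mul1r -expRD; congr expR.
  rewrite mulr2n; field; rewrite ?mulf_neq0 ?gt_eqF //.
under eq_integral do rewrite h EFinM.
rewrite integralZl //; last exact: integrable_normal_pdf.
by rewrite integral_normal_pdf mule1.
Qed.

Definition coords n (t : V n) : 'cV[R]_n := col_of_tuple t.

Lemma formE n (B : 'M[R]_n) (u : 'cV[R]_n) :
  form B u = \sum_i \sum_j B i j * (u i 0 * u j 0).
Proof.
rewrite /form dotE; apply: eq_bigr => i _; rewrite mxE mulr_sumr.
by apply: eq_bigr => j _; ring.
Qed.

Lemma form1 n (u : 'cV[R]_n) : form 1%:M u = dot u u.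
Proof. by rewrite /form mul1mx. Qed.

Lemma measurable_coord n i : measurable_fun setT (fun t : V n => coords t i 0 : R).
Proof.
rewrite (_ : (fun t => _) = (fun t : V n => tnth t i)); first exact: measurable_tnth.
by apply/funext => t; rewrite mxE.
Qed.

Lemma measurable_form n (B : 'M[R]_n) : measurable_fun setT (fun t : V n => form B (coords t)).
Proof.
rewrite (_ : (fun t => _) =
    (fun t : V n => \sum_i \sum_j B i j * (coords t i 0 * coords t j 0))).
  apply: measurable_sum => i; apply: measurable_sum => j.
  apply: measurable_funM; first exact: measurable_cst.
  by apply: measurable_funM; exact: measurable_coord.
by apply/funext => t; rewrite formE.
Qed.

Section schur.
Context n (B : 'M[R]_n.+1).

Definition corner : 'cV[R]_n := \col_i B (lift 0 i) 0.
Definition minor : 'M[R]_n := \matrix_(i, j) B (lift 0 i) (lift 0 j).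
(* With [Q = 1 - B], the matrix [1 - schur] is the Schur complement of the first
   diagonal entry of [Q]. *)
Definition schur : 'M[R]_n := minor + (1 - B 0 0)^-1 *: (corner *m corner^T).

Hypothesis Bsym : B^T = B.

Lemma Bsymij i j : B i j = B j i.
Proof. by rewrite -[in LHS]Bsym mxE. Qed.

Lemma form_rank1 (b u : 'cV[R]_n) : form (b *m b^T) u = dot b u ^+ 2.
Proof.
rewrite /form -mulmxA [b^T *m u]mx11_scalar mul_mx_scalar dotZr expr2.
by rewrite -/(dot b u) (dotC u).
Qed.

Lemma form_cons (x : R) (u : 'cV[R]_n) (w : 'cV[R]_n.+1) :
  w 0 0 = x -> (forall i, w (lift 0 i) 0 = u i 0) ->
  form B w = B 0 0 * x ^+ 2 + 2 * dot corner u * x + form minor u.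
Proof.
move=> w0 wS; rewrite !formE big_ord_recl big_ord_recl w0.
have -> : \sum_(i < n) B 0 (lift 0 i) * (x * w (lift 0 i) 0) = dot corner u * x.
  by rewrite dotE mulr_suml; apply: eq_bigr => i _; rewrite wS mxE Bsymij; ring.
have -> : \sum_(i < n) \sum_j B (lift 0 i) j * (w (lift 0 i) 0 * w j 0) =
    dot corner u * x + \sum_i \sum_j minor i j * (u i 0 * u j 0).
  rewrite dotE mulr_suml -big_split /=; apply: eq_bigr => i _.
  rewrite big_ord_recl w0 wS; congr (_ + _); first by rewrite mxE; ring.
  by apply: eq_bigr => j _; rewrite wS mxE.
ring.
Qed.

Lemma dot_cons (x : R) (u : 'cV[R]_n) (w : 'cV[R]_n.+1) :
  w 0 0 = x -> (forall i, w (lift 0 i) 0 = u i 0) -> dot w w = x ^+ 2 + dot u u.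
Proof.
by move=> w0 wS; rewrite !dotE big_ord_recl w0 expr2; congr (_ + _);
  apply: eq_bigr => i _; rewrite wS.
Qed.

Lemma schur_sym : schur^T = schur.
Proof.
rewrite /schur linearD /= linearZ /= trmx_mul trmxK; congr (_ + _).
by apply/matrixP => i j; rewrite !mxE Bsymij.
Qed.

Lemma form_schur u : form schur u = form minor u + (1 - B 0 0)^-1 * dot corner u ^+ 2.
Proof.
rewrite /form /schur mulmxDl dotDr -scalemxAl dotZr; congr (_ + _ * _).
exact: form_rank1.
Qed.

Lemma trace_cons : \tr B = B 0 0 + \tr minor.
Proof.
by rewrite /mxtrace big_ord_recl; congr (_ + _); apply: eq_bigr => i _; rewrite mxE.
Qed.

Lemma fro_cons : fro B = B 0 0 ^+ 2 + 2 * dot corner corner + fro minor.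
Proof.
rewrite /fro big_ord_recl big_ord_recl.
have -> : \sum_(i < n) B 0 (lift 0 i) ^+ 2 = dot corner corner.
  by rewrite dotE; apply: eq_bigr => i _; rewrite mxE Bsymij expr2.
have -> : \sum_(i < n) \sum_j B (lift 0 i) j ^+ 2 = dot corner corner + fro minor.
  rewrite dotE /fro -big_split /=; apply: eq_bigr => i _; rewrite big_ord_recl.
  congr (_ + _); first by rewrite mxE expr2.
  by apply: eq_bigr => j _; rewrite mxE.
rewrite /fro; ring.
Qed.

Lemma trace_schur : \tr schur = \tr minor + (1 - B 0 0)^-1 * dot corner corner.
Proof.
rewrite /schur linearD /= linearZ /=; congr (_ + _ * _).
by rewrite mxtrace_mulC /dot trace_mx11.
Qed.

Lemma fro_schur : fro schur = fro minor + 2 * (1 - B 0 0)^-1 * form minor corner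
  + ((1 - B 0 0)^-1 * dot corner corner) ^+ 2.
Proof.
set k := (1 - B 0 0)^-1; set b := corner.
have minor_sym : minor^T = minor by apply/matrixP => i j; rewrite !mxE Bsymij.
have tr_form (M : 'M[R]_n) : \tr (M *m (b *m b^T)) = form M b.
  by rewrite mulmxA mxtrace_mulC /form /dot trace_mx11.
rewrite [LHS]fro_trace schur_sym /schur -/k -/b mulmxDl !mulmxDr !linearD /=.
rewrite -{1}minor_sym -fro_trace -!scalemxAl -!scalemxAr !mxtraceZ.
rewrite (mxtrace_mulC (b *m b^T) minor) !tr_form form_rank1.
ring.
Qed.

Definition consv (x : R) (u : 'cV[R]_n) : 'cV[R]_n.+1 :=
  \col_i oapp (fun j => u j 0) x (unlift 0 i).

Lemma consv0 x u : consv x u 0 0 = x.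
Proof. by rewrite mxE unlift_none. Qed.

Lemma consvS x u i : consv x u (lift 0 i) 0 = u i 0.
Proof. by rewrite mxE liftK. Qed.

Hypothesis Bbnd : forall w, `|form B w| <= 8^-1 * dot w w.

Lemma form_cons_bnd x (u : 'cV[R]_n) :
  `|B 0 0 * x ^+ 2 + 2 * dot corner u * x + form minor u| <=
  8^-1 * (x ^+ 2 + dot u u).
Proof.
have := Bbnd (consv x u).
by rewrite (form_cons (consv0 x u) (consvS x u)) (dot_cons (consv0 x u) (consvS x u)).
Qed.

Lemma head_bnd : `|B 0 0| <= 8^-1.
Proof.
have := form_cons_bnd 1 0.
by rewrite /form mulmx0 !dot0r !mulr0 mul0r !addr0 expr1n !mulr1.
Qed.

Lemma minor_bnd u : `|form minor u| <= 8^-1 * dot u u.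
Proof.
by have := form_cons_bnd 0 u; rewrite expr0n /= !mulr0 !add0r.
Qed.

Lemma corner_bnd : dot corner corner <= 7^-1.
Proof.
have := form_cons_bnd 1 corner; have := head_bnd; have := minor_bnd corner.
rewrite !ler_norml expr1n !mulr1; set c := dot corner corner; lra.
Qed.

Lemma schur_bnd u : `|form schur u| <= 8^-1 * dot u u.
Proof.
rewrite form_schur; have := head_bnd; rewrite ler_norml => hB.
have a0 : 0 < 1 - B 0 0 by lra.
set g := dot corner u; set k := (1 - B 0 0)^-1; set x := k * g.
have := form_cons_bnd x u; rewrite -/g.
have := minor_bnd u; rewrite !ler_norml => hm hc.
have k0 : 0 <= k * g ^+ 2 by rewrite mulr_ge0 ?sqr_ge0 // invr_ge0 ltW.
have gE : g = (1 - B 0 0) * x by rewrite /x mulrA mulfV ?mul1r ?gt_eqF.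
have kg : k * g ^+ 2 = (1 - B 0 0) * x ^+ 2.
  by rewrite expr2 mulrA -/x expr2 mulrA -gE mulrC.
apply/andP; split; first by move: hm; lra.
rewrite kg; move: hc; rewrite gE; have := sqr_ge0 x; nra.
Qed.

End schur.

Lemma sqrt_inv_le (x : R) : `|x| <= 8^-1 -> Num.sqrt (1 - x)^-1 <= expR (x / 2 + x ^+ 2).
Proof.
rewrite ler_norml => hx; have a0 : 0 < 1 - x by lra.
have i0 : 0 <= (1 - x)^-1 by rewrite invr_ge0 ltW.
rewrite -(@ler_pXn2r _ 2) // ?nnegrE ?sqrtr_ge0 ?expR_ge0 // sqr_sqrtr //.
rewrite -expRM_natl -[X in X <= _]mulr1 ler_pdivrMl // mulr2n.
apply: (@le_trans _ _ ((1 - x) * (1 + (2%:R * (x / 2 + x ^+ 2))))); last first.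
  by rewrite ler_pM2l // expR_ge1Dx.
have := sqr_ge0 x; rewrite !expr2; nra.
Qed.

Definition gauss_weight n (s : R) (B : 'M[R]_n) (t : V n) : R :=
  expR (- (s / 2) * (dot (coords t) (coords t) - form B (coords t))).

Lemma measurable_gauss_weight n s (B : 'M[R]_n) : measurable_fun setT (gauss_weight s B).
Proof.
apply: measurableT_comp; first exact: measurable_expR.
apply: measurable_funM; first exact: measurable_cst.
apply: measurable_funB; last exact: measurable_form.
by under eq_fun do rewrite -form1; exact: measurable_form.
Qed.

Lemma coords_cons0 n x (t : V n) : coords (cons_tuple x t) 0 0 = x.
Proof. by rewrite mxE. Qed.

Lemma coords_consS n x (t : V n) i : coords (cons_tuple x t) (lift 0 i) 0 = coords t i 0.
Proof. by rewrite !mxE tnthS. Qed.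

(** A Gaussian integral with precision matrix [1 - B], by elimination of one
    variable at a time; the trace and the Frobenius norm of [B] majorize
    [- ln (det (1 - B)) / 2] and decrease along the Schur complements. *)
Lemma gauss_integral_le n s (B : 'M[R]_n) : 0 < s -> B^T = B ->
  (forall w, `|form B w| <= 8^-1 * dot w w) ->
  (\int[tmeas n]_t (gauss_weight s B t)%:E <=
   (Num.sqrt (2 * pi / s) ^+ n * expR (\tr B / 2 + fro B))%:E)%E.
Proof.
move=> s0; elim: n B => [|n IH] B Bsym Bbnd.
  rewrite integral_tmeas0; last by apply/measurable_EFinP; exact: measurable_gauss_weight.
  rewrite lee_fin expr0 mul1r /gauss_weight formE !dotE /mxtrace /fro !big_ord0.
  by rewrite subr0 mulr0 mul0r addr0.
have a0 : 0 < 1 - B 0 0 by have := head_bnd Bsym Bbnd; rewrite ler_norml; lra.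
rewrite integral_tmeasS; last 2 first.
- by apply/measurable_EFinP; exact: measurable_gauss_weight.
- by move=> t; rewrite lee_fin expR_ge0.
have step (t : V n) : (\int[leb]_x (gauss_weight s B (cons_tuple x t))%:E =
    (Num.sqrt (2 * pi / s / (1 - B 0 0)) * gauss_weight s (schur B) t)%:E)%E.
  pose g := dot (corner B) (coords t).
  pose r := dot (coords t) (coords t) - form (minor B) (coords t).
  have split1 x : gauss_weight s B (cons_tuple x t) =
      expR (- (s / 2) * r) * expR (- (s / 2) * ((1 - B 0 0) * x ^+ 2 - 2 * g * x)).
    rewrite /gauss_weight (form_cons Bsym (coords_cons0 x t) (coords_consS x t)).
    rewrite (dot_cons (coords_cons0 x t) (coords_consS x t)) -expRD /r /g.
    by congr expR; ring.
  under eq_integral => x _ do rewrite split1 EFinM.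
  rewrite ge0_integralZl_EFin //; last first.
    apply/measurable_EFinP; apply: measurableT_comp; first exact: measurable_expR.
    apply: measurable_funM; first exact: measurable_cst.
    apply: measurable_funB; apply: measurable_funM => //.
  rewrite gauss1 // -EFinM; congr EFin.
  rewrite mulrCA; congr (_ * _); rewrite -expRD /gauss_weight; congr expR.
  by rewrite form_schur /r /g; field; rewrite gt_eqF.
under eq_integral => t _ do rewrite step EFinM.
rewrite ge0_integralZl_EFin //; last 2 first.
- by move=> t _; rewrite lee_fin expR_ge0.
- by apply/measurable_EFinP; exact: measurable_gauss_weight.
have := IH _ (schur_sym Bsym) (schur_bnd Bsym Bbnd).
move=> /(lee_wpmul2l (_ : 0 <= (Num.sqrt (2 * pi / s / (1 - B 0 0)))%:E)%E).
rewrite lee_fin sqrtr_ge0 => /(_ isT) /le_trans; apply.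
rewrite -EFinM lee_fin.
have := sqrt_inv_le (head_bnd Bsym Bbnd).
have p0 : 0 <= 2 * pi / s by rewrite divr_ge0 ?mulr_ge0 ?pi_ge0 // ltW.
rewrite sqrtrM // => h1.
rewrite mulrACA -exprS; apply: ler_wpM2l; first by rewrite exprn_ge0 ?sqrtr_ge0.
apply: (@le_trans _ _ (expR (B 0 0 / 2 + B 0 0 ^+ 2) * expR (\tr (schur B) / 2 + fro (schur B)))).
  by rewrite ler_wpM2r ?expR_ge0.
rewrite -expRD ler_expR trace_cons trace_schur (fro_cons Bsym) (fro_schur Bsym).
have := minor_bnd Bsym Bbnd (corner B); have := corner_bnd Bsym Bbnd.
have := dot_ge0 (corner B).
have : 0 <= (1 - B 0 0)^-1 <= 8 / 7.
  rewrite invr_ge0 ltW //= -[leRHS]invf_div lef_pV2 ?posrE ?divr_gt0 //.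
  by have := head_bnd Bsym Bbnd; rewrite ler_norml; lra.
rewrite ler_norml; set c := dot _ _; set k := _^-1; set f := form _ _.
move=> /andP[k0 k1] c0 c1 /andP[_ fc].
have kf : k * f <= 8 / 7 * (8^-1 * c).
  apply: (@le_trans _ _ (k * (8^-1 * c))); first by rewrite ler_wpM2l.
  by rewrite ler_wpM2r // mulr_ge0.
have kc : k * c <= 8 / 7 * c by rewrite ler_wpM2r.
have kc2 : (k * c) ^+ 2 <= (8 / 7) ^+ 2 * 7^-1 * c.
  rewrite exprMn -mulrA; apply: ler_pM; rewrite ?sqr_ge0 //.
    by rewrite ler_pXn2r // nnegrE // divr_ge0.
  by rewrite expr2 ler_wpM2r.
rewrite -(mulrA 2 k f); move: kf kc kc2.
move: ((k * c) ^+ 2) => y; move: (k * c) (k * f) => z w; rewrite !expr2; lra.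
Qed.

End tuple_measure.

(** * Concentration of quadratic forms on the ball *)

Section ball_concentration.
Context {R : realType}.
Local Notation V n := (n.-tuple (measurableTypeR R)).

Lemma gauss_integral0 n s : 0 < s ->
  (\int[tmeas n]_t (gauss_weight s (0 : 'M[R]_n) t)%:E = (Num.sqrt (2 * pi / s) ^+ n)%:E)%E.
Proof.
move=> s0; elim: n => [|n IH].
  rewrite integral_tmeas0; last by apply/measurable_EFinP; exact: measurable_gauss_weight.
  by rewrite /gauss_weight formE !dotE !big_ord0 subr0 mulr0 expR0 expr0.
rewrite integral_tmeasS; last 2 first.
- by apply/measurable_EFinP; exact: measurable_gauss_weight.
- by move=> t; rewrite lee_fin expR_ge0.
have form0 k (u : 'cV[R]_k) : form 0 u = 0 by rewrite /form mul0mx dot0r.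
have step (t : V n) : (\int[@lebesgue_measure R]_x (gauss_weight s (0 : 'M[R]_n.+1) (cons_tuple x t))%:E =
    (Num.sqrt (2 * pi / s))%:E * (gauss_weight s (0 : 'M[R]_n) t)%:E)%E.
  have split1 x : gauss_weight s (0 : 'M[R]_n.+1) (cons_tuple x t) =
      gauss_weight s (0 : 'M[R]_n) t * expR (- (s / 2) * (1 * x ^+ 2 - 2 * 0 * x)).
    rewrite /gauss_weight !form0 (dot_cons (coords_cons0 x t) (coords_consS x t)) -expRD.
    by congr expR; ring.
  under eq_integral => x _ do rewrite split1 EFinM.
  rewrite ge0_integralZl_EFin //; last 2 first.
  - apply/measurable_EFinP; apply: measurableT_comp; first exact: measurable_expR.
    apply: measurable_funM; first exact: measurable_cst.
    by apply: measurable_funB; apply: measurable_funM.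
  - exact: expR_ge0.
  by rewrite gauss1 // expr0n /= mul0r mulr0 expR0 mulr1 divr1 muleC.
under eq_integral => t _ do rewrite step.
rewrite ge0_integralZl_EFin //; last 2 first.
- by move=> t _; rewrite lee_fin expR_ge0.
- by apply/measurable_EFinP; exact: measurable_gauss_weight.
by rewrite IH -EFinM exprS.
Qed.

Definition norm2 n (t : V n) : R := dot (coords t) (coords t).

Lemma measurable_norm2 n : measurable_fun setT (@norm2 n).
Proof.
rewrite (_ : @norm2 n = fun t => form 1%:M (coords t)); first exact: measurable_form.
by apply/funext => t; rewrite form1.
Qed.

Lemma norm2_ge0 n (t : V n) : 0 <= norm2 t.
Proof. exact: dot_ge0. Qed.

Definition ballT n (r : R) : set (V n) := [set t | norm2 t <= r ^+ 2].

Lemma measurable_ballT n r : measurable (@ballT n r).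
Proof. by apply: measurable_set_le; [exact: measurable_norm2|exact: measurable_cst]. Qed.

Lemma tmeas_le_integral n (E : set (V n)) (f : V n -> R) : measurable E ->
  measurable_fun setT f -> (forall t, 0 <= f t) -> (forall t, E t -> 1 <= f t) ->
  (tmeas n E <= \int[tmeas n]_t (f t)%:E)%E.
Proof.
move=> mE mf f0 fE; rewrite -[X in tmeas n X]setIT -integral_indic //.
apply: ge0_le_integral => //.
- exact/measurable_EFinP/measurable_indic.
- exact/measurable_EFinP.
move=> t _; rewrite lee_fin indicE; have [tE|//] := boolP (t \in E).
by apply: fE; rewrite -in_setE.
Qed.

Lemma gauss_weightE n s c (t : V n) :
  gauss_weight s (c%:M : 'M[R]_n) t = expR (- (s / 2) * (1 - c) * norm2 t).
Proof.
rewrite /gauss_weight /form mul_scalar_mx dotZr -/(norm2 t).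
by congr expR; ring.
Qed.

Lemma gauss_integral_scalar n s c : 0 < s -> `|c| <= 8^-1 ->
  (\int[tmeas n]_t (gauss_weight s (c%:M : 'M[R]_n) t)%:E <=
   (Num.sqrt (2 * pi / s) ^+ n * expR (n%:R * (c / 2 + c ^+ 2)))%:E)%E.
Proof.
move=> s0 c8; have cT : (c%:M : 'M[R]_n)^T = c%:M by exact: tr_scalar_mx.
have cB w : `|form (c%:M : 'M[R]_n) w| <= 8^-1 * dot w w.
  rewrite /form mul_scalar_mx dotZr normrM (ger0_norm (dot_ge0 w)).
  by rewrite ler_wpM2r // dot_ge0.
apply: le_trans (gauss_integral_le s0 cT cB) _; rewrite lee_fin.
rewrite ler_wpM2l ?exprn_ge0 ?sqrtr_ge0 // ler_expR mxtrace_scalar.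
have -> : fro (c%:M : 'M[R]_n) = c ^+ 2 * n%:R.
  by rewrite fro_trace tr_scalar_mx mul_scalar_mx mxtraceZ mxtrace_scalar -mulr_natr; ring.
by rewrite -mulr_natr; lra.
Qed.

(** The Gaussian density of precision [n / (1 - a)] is concentrated on the shell
    between the radii [sqrt (1 - 2 a)] and [1], where it is comparable to its
    maximum on the unit sphere. *)
Lemma ball_volume_ge n (a : R) : 0 < a <= 4^-1 -> 32 <= n%:R * a ^+ 2 ->
  ((2^-1 * Num.sqrt (2 * pi / n%:R) ^+ n * expR (n%:R / 2 - 2 * n%:R * a))%:E <=
   tmeas n (@ballT n 1))%E.
Proof.
move=> /andP[a0 a4] na.
have n0 : 0 < n%:R :> R.
  by have := ltr0n R n; case: n na => [|n] //; rewrite mul0r; lra.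
set N : R := n%:R in n0 na *.
have a1 : 0 < 1 - a by lra.
pose s := N / (1 - a); have s0 : 0 < s by rewrite divr_gt0.
have sa : s * (1 - a) = N by rewrite /s divfK // gt_eqF.
pose b := a / 4; have b8 : `|b| <= 8^-1 by rewrite ger0_norm /b ?divr_ge0; lra.
have b8' : `|- b| <= 8^-1 by rewrite normrN.
pose k := expR (- (s / 2) * (1 - 2 * a)).
pose k1 := expR (- (s / 2) * b); pose k2 := expR ((s / 2) * b * (1 - 2 * a)).
pose g := Num.sqrt (2 * pi / s) ^+ n.
have g0 : 0 < g by rewrite exprn_gt0 // sqrtr_gt0 divr_gt0 // mulr_gt0 // pi_gt0.
have mW c : measurable_fun setT (fun t : V n => (gauss_weight s (c%:M : 'M[R]_n) t)%:E).
  by apply/measurable_EFinP; exact: measurable_gauss_weight.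
have W0 c (t : V n) : (0 <= (gauss_weight s (c%:M : 'M[R]_n) t)%:E)%E.
  by rewrite lee_fin expR_ge0.
have mI : measurable_fun setT (fun t : V n => (\1_(@ballT n 1) t)%:E : \bar R).
  by apply/measurable_EFinP/measurable_indic; exact: measurable_ballT.
have pw (t : V n) : ((gauss_weight s (0%:M : 'M[R]_n) t)%:E <=
    k%:E * (\1_(@ballT n 1) t)%:E + (k1%:E * (gauss_weight s (b%:M : 'M[R]_n) t)%:E +
    k2%:E * (gauss_weight s ((- b)%:M : 'M[R]_n) t)%:E))%E.
  rewrite -!EFinM -!EFinD lee_fin !gauss_weightE subr0 mulr1 opprK.
  set r := norm2 t; have r0 : 0 <= r := norm2_ge0 t.
  have p1 : 0 <= k1 * expR (- (s / 2) * (1 - b) * r) by rewrite mulr_ge0 ?expR_ge0.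
  have p2 : 0 <= k2 * expR (- (s / 2) * (1 + b) * r) by rewrite mulr_ge0 ?expR_ge0.
  have p3 : 0 <= k * \1_(@ballT n 1) t by rewrite mulr_ge0 ?expR_ge0.
  have sb0 : 0 <= s / 2 * b by rewrite !mulr_ge0 ?invr_ge0 // ?ltW // /b; lra.
  have [r1|r1] := ltP 1 r.
    suff : expR (- (s / 2) * r) <= k1 * expR (- (s / 2) * (1 - b) * r) by lra.
    rewrite -expRD ler_expR -subr_ge0.
    have -> : - (s / 2) * b + - (s / 2) * (1 - b) * r - - (s / 2) * r = s / 2 * b * (r - 1) by ring.
    by rewrite mulr_ge0 // subr_ge0 ltW.
  have [r2|r2] := ltP r (1 - 2 * a).
    suff : expR (- (s / 2) * r) <= k2 * expR (- (s / 2) * (1 + b) * r) by lra.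
    rewrite -expRD ler_expR -subr_ge0.
    have -> : s / 2 * b * (1 - 2 * a) + - (s / 2) * (1 + b) * r - - (s / 2) * r =
      s / 2 * b * (1 - 2 * a - r) by ring.
    by rewrite mulr_ge0 // subr_ge0 ltW.
  have -> : \1_(@ballT n 1) t = 1 :> R.
    by rewrite indicE mem_set //= /ballT /= expr1n.
  rewrite mulr1; suff : expR (- (s / 2) * r) <= k by lra.
  rewrite ler_expR -subr_ge0.
  have -> : - (s / 2) * (1 - 2 * a) - - (s / 2) * r = s / 2 * (r - (1 - 2 * a)) by ring.
  by rewrite mulr_ge0 ?subr_ge0 // divr_ge0 // ltW.
have : (g%:E <= k%:E * tmeas n (@ballT n 1) +
    (k1%:E * (g * expR (N * (b / 2 + b ^+ 2)))%:E +
     k2%:E * (g * expR (N * (- b / 2 + (- b) ^+ 2)))%:E))%E.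
  rewrite -gauss_integral0 //.
  apply: (@le_trans _ _ (\int[tmeas n]_t (k%:E * (\1_(@ballT n 1) t)%:E +
    (k1%:E * (gauss_weight s (b%:M : 'M[R]_n) t)%:E +
    k2%:E * (gauss_weight s ((- b)%:M : 'M[R]_n) t)%:E)))%E).
    apply: ge0_le_integral => //.
    - by move=> t _; rewrite lee_fin expR_ge0.
    - by apply/measurable_EFinP; exact: measurable_gauss_weight.
    - by do 2?[apply: emeasurable_funD => //]; apply: measurable_funeM.
    - move=> t _; have -> : (0 : 'M[R]_n) = 0%:M by apply/matrixP => i j; rewrite !mxE mul0rn.
      exact: pw.
  have kge : forall c, (0 <= (expR c)%:E :> \bar R)%E by move=> c; rewrite lee_fin expR_ge0.
  rewrite ge0_integralD //; last 4 first.
  - by move=> t _; rewrite mule_ge0 ?lee_fin ?expR_ge0.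
  - exact: measurable_funeM.
  - by move=> t _; apply: adde_ge0; apply: mule_ge0; rewrite lee_fin; exact: expR_ge0.
  - by apply: emeasurable_funD; exact: measurable_funeM.
  rewrite [X in (_ + X <= _)%E]ge0_integralD //; last 4 first.
  - by move=> t _; rewrite mule_ge0 // lee_fin expR_ge0.
  - exact: measurable_funeM.
  - by move=> t _; rewrite mule_ge0 // lee_fin expR_ge0.
  - exact: measurable_funeM.
  rewrite !ge0_integralZl_EFin ?expR_ge0 //.
  rewrite integral_indic ?setIT //; last exact: measurable_ballT.
  apply: leeD => //; apply: leeD.
    by apply: lee_wpmul2l; [exact: kge|exact: gauss_integral_scalar s0 b8].
  by apply: lee_wpmul2l; [exact: kge|exact: gauss_integral_scalar s0 b8'].
set L := tmeas n _ => H.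
have tail : forall c, c <= - (N * a ^+ 2 / 16) -> expR c <= 4^-1.
  move=> c hc; apply: (@le_trans _ _ (expR (- 2))); first by rewrite ler_expR; lra.
  rewrite expRN lef_pV2 ?posrE ?expR_gt0 //.
  have -> : 2 = 1 + 1 :> R by []. rewrite expRD.
  have := expR_ge1Dx (1 : R); set e1 := expR 1; nra.
have sN : N * (1 + a) <= s.
  by rewrite /s ler_pdivlMr // -mulrA ler_piMr ?ltW //; nra.
have b2 : b ^+ 2 = a ^+ 2 / 16 by rewrite /b exprMn exprVn; congr (_ / _); ring.
have t1 : k1 * (g * expR (N * (b / 2 + b ^+ 2))) <= g / 4.
  rewrite mulrCA ler_pM2l // -expRD; apply: tail.
  have : N * (1 + a) * b <= s * b by rewrite ler_wpM2r // /b; lra.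
  have e : N * a * b = 4 * (N * b ^+ 2) by rewrite /b; field.
  rewrite b2 in e *; rewrite mulrDr mulr1 mulrDl; lra.
have t2 : k2 * (g * expR (N * (- b / 2 + (- b) ^+ 2))) <= g / 4.
  rewrite mulrCA ler_pM2l // -expRD; apply: tail.
  have e : N * a * b = 4 * (N * b ^+ 2) by rewrite /b; field.
  have e2 : s * (1 - 2 * a) = N - s * a by rewrite -sa; ring.
  have : N * a * b <= s * a * b.
    rewrite !ler_wpM2r //; [by rewrite /b; lra|by lra|].
    by apply: le_trans sN; rewrite ler_peMr ?ltW //; lra.
  have -> : s / 2 * b * (1 - 2 * a) = (s * (1 - 2 * a)) * b / 2 by field.
  rewrite e2 sqrrN b2 in e *; rewrite mulrBl; lra.
have {}H : ((g / 2)%:E <= k%:E * L)%E.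
  have : (g%:E <= k%:E * L + (g / 2)%:E)%E.
    apply: le_trans H _; apply: leeD => //; rewrite -!EFinM -EFinD lee_fin; lra.
  rewrite -leeBlDr ?fin_numE //; apply: le_trans; rewrite -EFinB lee_fin; lra.
pose q := Num.sqrt (2 * pi / N) ^+ n.
have q0 : 0 < q by rewrite exprn_gt0 // sqrtr_gt0 divr_gt0 // mulr_gt0 // pi_gt0.
have gq : g = q * Num.sqrt (1 - a) ^+ n.
  rewrite /g /q -exprMn -sqrtrM ?divr_ge0 ?mulr_ge0 ?pi_ge0 ?(ltW n0) //.
  by congr (Num.sqrt _ ^+ _); rewrite -sa; field; rewrite !gt_eqF.
have sq : expR (- (N * a)) <= Num.sqrt (1 - a) ^+ n.
  rewrite /N mulrC -mulNr -[X in expR X]mulrC expRM_natl.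
  rewrite ler_pXn2r ?nnegrE ?expR_ge0 ?sqrtr_ge0 //; last by rewrite -(ltr0n R).
  rewrite -(@ler_pXn2r _ 2) // ?nnegrE ?expR_ge0 ?sqrtr_ge0 // sqr_sqrtr ?(ltW a1) //.
  have h2 : 0 < 1 + 2 * a by lra.
  rewrite -(ler_pM2r h2); apply: (@le_trans _ _ (expR (- a) ^+ 2 * expR (2 * a))).
    by rewrite ler_wpM2l ?exprn_ge0 ?expR_ge0 // expR_ge1Dx.
  rewrite expr2 -!expRD (_ : - a + - a + 2 * a = 0) ?expR0; last by ring.
  have -> : (1 - a) * (1 + 2 * a) = 1 + a * (1 - 2 * a) by ring.
  by rewrite lerDl mulr_ge0 ?(ltW a0) //; lra.
have kk : expR (- (N * a)) * expR (N / 2 - N * a) <= Num.sqrt (1 - a) ^+ n * k^-1.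
  apply: ler_pM; [exact: expR_ge0|exact: expR_ge0|exact: sq|rewrite /k -expRN ler_expR].
  have : s <= 2 * N by rewrite /s ler_pdivrMr //; nra.
  move=> s2; have : s * a <= 2 * N * a by rewrite ler_wpM2r // ltW.
  have e2 : s * (1 - 2 * a) = N - s * a by rewrite -sa; ring.
  have -> : - (- (s / 2) * (1 - 2 * a)) = s * (1 - 2 * a) / 2 by field.
  by rewrite e2; lra.
have fin : 2^-1 * q * expR (N / 2 - 2 * N * a) <= k^-1 * (g / 2).
  have -> : N / 2 - 2 * N * a = - (N * a) + (N / 2 - N * a) by ring.
  rewrite expRD gq.
  have -> : k^-1 * (q * Num.sqrt (1 - a) ^+ n / 2) = 2^-1 * q * (Num.sqrt (1 - a) ^+ n * k^-1) by ring.
  by rewrite ler_pM2l // mulr_gt0.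
apply: (@le_trans _ _ (k^-1 * (g / 2))%:E); first by rewrite lee_fin.
rewrite EFinM; have k0 : 0 < k := expR_gt0 _.
apply: (@le_trans _ _ ((k^-1)%:E * (k%:E * L))%E).
  by apply: lee_wpmul2l => //; rewrite lee_fin invr_ge0 ltW.
by rewrite muleA -EFinM mulVf ?gt_eqF // mul1e.
Qed.

Lemma ball_finite n : (tmeas n (@ballT n 1) < +oo)%E.
Proof.
apply: (@le_lt_trans _ _ (\int[tmeas n]_t (expR (2^-1) * gauss_weight 1 (0 : 'M[R]_n) t)%:E)%E).
  apply: tmeas_le_integral; first exact: measurable_ballT.
  - apply: measurable_funM; first exact: measurable_cst.
    exact: measurable_gauss_weight.
  - by move=> t; rewrite mulr_ge0 ?expR_ge0.
  move=> t; rewrite /ballT /= expr1n => t1.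
  rewrite /gauss_weight /form mul0mx dot0r subr0 -/(norm2 t) -expRD -[leLHS]expR0 ler_expR; lra.
under eq_integral do rewrite EFinM.
rewrite ge0_integralZl_EFin ?expR_ge0 //; last 2 first.
- by move=> t _; rewrite lee_fin expR_ge0.
- by apply/measurable_EFinP; exact: measurable_gauss_weight.
by rewrite gauss_integral0 // -EFinM ltry.
Qed.

(** Exponential tilting by [B], centred to have trace zero, against the lower
    bound for the volume of the ball. *)
Lemma ball_quadratic_form n (B : 'M[R]_n) (tau : R) : B^T = B -> bnd B 1 ->
  0 < tau <= 1 -> 32 * 256 ^+ 2 <= n%:R * tau ^+ 4 ->
  (tmeas n [set t | (norm2 t <= 1 /\ tau <= form B (coords t) - norm2 t * (\tr B / n%:R))%R] <=
   (2 * expR (- (n%:R * tau ^+ 2 / 64)))%:E * tmeas n (@ballT n 1))%E.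
Proof.
move=> Bsym B1 /andP[tau0 tau1] ntau.
have n0 : 0 < n%:R :> R.
  by have := ltr0n R n; case: n ntau B Bsym B1 => [|n] //; rewrite mul0r; lra.
set N : R := n%:R in n0 ntau *.
pose B0 := B - (\tr B / N)%:M.
have form0 w : form B0 w = form B w - dot w w * (\tr B / N).
  by rewrite /form mulmxBl dotBr mul_scalar_mx dotZr (mulrC (dot w w)).
have tr0 : \tr B0 = 0.
  by rewrite /B0 linearB /= mxtrace_scalar -mulr_natr -/N divfK ?gt_eqF // subrr.
have B0sym : B0^T = B0 by rewrite /B0 linearB /= tr_scalar_mx Bsym.
have froB : fro B <= N by have := fro_bnd ler01 B1; rewrite expr1n mul1r.
have fro0 : fro B0 <= N.
  apply: le_trans froB; rewrite !fro_trace B0sym Bsym.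
  have -> : \tr (B0 *m B0) = \tr (B *m B) - \tr B ^+ 2 / N.
    have -> : B0 *m B0 = B *m B0 - (\tr B / N)%:M *m B0 by rewrite -mulmxBl.
    rewrite linearB /= mul_scalar_mx mxtraceZ tr0 mulr0 subr0.
    rewrite /B0 mulmxBr linearB /= mul_mx_scalar mxtraceZ; congr (_ - _).
    by rewrite expr2 mulrAC.
  by rewrite gerBl divr_ge0 ?sqr_ge0 // ltW.
have trB : `|\tr B| <= N by have := trace_bnd ler01 B1; rewrite mul1r.
have form2 w : `|form B0 w| <= 2 * dot w w.
  rewrite form0; apply: le_trans (ler_normB _ _) _.
  have -> : 2 * dot w w = dot w w + dot w w by ring.
  apply: lerD.
    by have := bnd_dot w w B1; rewrite mul1r -expr2 enorm_sqr.
  rewrite normrM (ger0_norm (dot_ge0 w)) ler_piMr ?dot_ge0 //.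
  by rewrite normrM normfV (gtr0_norm n0) ler_pdivrMr // mul1r.
pose l := tau / 16; have l0 : 0 < l by rewrite divr_gt0.
pose C := l *: B0.
have Csym : C^T = C by rewrite /C linearZ /= B0sym.
have formC w : form C w = l * form B0 w by rewrite /form -scalemxAl dotZr.
have Cb w : `|form C w| <= 8^-1 * dot w w.
  rewrite formC normrM (gtr0_norm l0); apply: (@le_trans _ _ (l * (2 * dot w w))).
    by rewrite ler_wpM2l // ltW.
  by rewrite mulrA ler_wpM2r ?dot_ge0 // /l; lra.
have trC : \tr C = 0 by rewrite mxtraceZ tr0 mulr0.
have froC : fro C <= l ^+ 2 * N.
  have -> : fro C = l ^+ 2 * fro B0.
    rewrite !fro_trace Csym B0sym /C -scalemxAl -scalemxAr !mxtraceZ; ring.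
  by rewrite ler_wpM2l ?sqr_ge0.
set E := [set t | _]; have mE : measurable E.
  apply: measurableI; first by have := @measurable_ballT n 1; rewrite /ballT expr1n.
  apply: measurable_set_le; first exact: measurable_cst.
  apply: measurable_funB; first exact: measurable_form.
  by apply: measurable_funM; [exact: measurable_norm2|exact: measurable_cst].
pose k := expR (N / 2 * (1 - l * tau)).
pose q := Num.sqrt (2 * pi / N) ^+ n.
have q0 : 0 <= q by rewrite exprn_ge0 // sqrtr_ge0.
have up : (tmeas n E <= (k * (q * expR (l ^+ 2 * N)))%:E)%E.
  apply: (@le_trans _ _ (\int[tmeas n]_t (k * gauss_weight N C t)%:E)%E).
    apply: tmeas_le_integral => //.
    - by apply: measurable_funM; [exact: measurable_cst|exact: measurable_gauss_weight].
    - by move=> t; rewrite mulr_ge0 ?expR_ge0.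
    move=> t [t1 t2]; rewrite -expRD -[leLHS]expR0 ler_expR formC form0 -/(norm2 t) -/N.
    have -> : N / 2 * (1 - l * tau) + - (N / 2) * (norm2 t - l * (form B (coords t) - norm2 t * (\tr B / N)))
      = N / 2 * ((1 - norm2 t) + l * ((form B (coords t) - norm2 t * (\tr B / N)) - tau)) by ring.
    rewrite mulr_ge0 ?divr_ge0 ?(ltW n0) // addr_ge0 ?subr_ge0 // mulr_ge0 ?(ltW l0) //.
    by rewrite subr_ge0.
  under eq_integral do rewrite EFinM.
  rewrite ge0_integralZl_EFin ?expR_ge0 //; last 2 first.
  - by move=> t _; rewrite lee_fin expR_ge0.
  - by apply/measurable_EFinP; exact: measurable_gauss_weight.
  rewrite EFinM; apply: lee_wpmul2l; first by rewrite lee_fin expR_ge0.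
  apply: le_trans (gauss_integral_le n0 Csym Cb) _; rewrite lee_fin ler_wpM2l //.
  by rewrite ler_expR trC mul0r add0r.
apply: le_trans up _.
pose a := tau ^+ 2 / 256.
have t2 : tau ^+ 2 <= 1 by rewrite expr_le1 // ltW.
have a4 : 0 < a <= 4^-1 by rewrite /a divr_gt0 ?exprn_gt0 //=; lra.
have na : 32 <= N * a ^+ 2.
  have -> : N * a ^+ 2 = N * tau ^+ 4 / 256 ^+ 2.
    by rewrite /a exprMn exprVn -exprM mulrA.
  by rewrite ler_pdivlMr // exprn_gt0.
have low := ball_volume_ge a4 na.
apply: le_trans (lee_wpmul2l _ low); last by rewrite lee_fin mulr_ge0 ?expR_ge0.
rewrite -EFinM lee_fin -/q -/N.
have -> : 2 * expR (- (N * tau ^+ 2 / 64)) * (2^-1 * q * expR (N / 2 - 2 * N * a)) =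
  q * (expR (- (N * tau ^+ 2 / 64)) * expR (N / 2 - 2 * N * a)) by field.
rewrite mulrCA ler_wpM2l // -!expRD ler_expR /a /l.
rewrite exprMn !expr2; have : 0 <= N * (tau * tau) by rewrite mulr_ge0 ?mulr_ge0 // ltW.
lra.
Qed.

(** On the ball of radius [r] the Gaussian density of precision [n] is at least
    [exp (- n / 8)], against [exp (- n / 2)] near the unit sphere. *)
Lemma small_ball n (r : R) : 0 <= r <= 2^-1 -> 32 * 256 ^+ 2 <= n%:R :> R ->
  (tmeas n (@ballT n r) <= 2^-1%:E * tmeas n (@ballT n 1))%E.
Proof.
move=> /andP[r0 r2] nbig; set N : R := n%:R in nbig *.
have n0 : 0 < N by move: nbig; rewrite !expr2; clearbody N; lra.
pose q := Num.sqrt (2 * pi / N) ^+ n.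
have q0 : 0 <= q by rewrite exprn_ge0 // sqrtr_ge0.
have up : (tmeas n (@ballT n r) <= (expR (N / 8) * q)%:E)%E.
  apply: (@le_trans _ _ (\int[tmeas n]_t (expR (N / 8) * gauss_weight N (0 : 'M[R]_n) t)%:E)%E).
    apply: tmeas_le_integral; first exact: measurable_ballT.
    - by apply: measurable_funM; [exact: measurable_cst|exact: measurable_gauss_weight].
    - by move=> t; rewrite mulr_ge0 ?expR_ge0.
    move=> t; rewrite /ballT /= => tr.
    rewrite /gauss_weight /form mul0mx dot0r subr0 -/(norm2 t) -expRD -[leLHS]expR0 ler_expR.
    have : r ^+ 2 <= 4^-1 by rewrite expr2; nra.
    move=> r4; have : N * norm2 t <= N * 4^-1 by rewrite ler_wpM2l ?(ltW n0) //; lra.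
    lra.
  under eq_integral do rewrite EFinM.
  rewrite ge0_integralZl_EFin ?expR_ge0 //; last 2 first.
  - by move=> t _; rewrite lee_fin expR_ge0.
  - by apply/measurable_EFinP; exact: measurable_gauss_weight.
  by rewrite gauss_integral0 // -EFinM.
apply: le_trans up _.
have a4 : (0 < (32^-1 : R)) && ((32^-1 : R) <= 4^-1) by apply/andP; split; lra.
have na : 32 <= N * 32^-1 ^+ 2 by rewrite !expr2 in nbig *; lra.
have low := ball_volume_ge a4 na.
apply: le_trans (lee_wpmul2l _ low); last by rewrite lee_fin.
rewrite -EFinM lee_fin -/q -/N.
have -> : 2^-1 * (2^-1 * q * expR (N / 2 - 2 * N / 32)) = q * (4^-1 * expR (N / 2 - 2 * N / 32)) by field.
rewrite mulrC ler_wpM2l //.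
have -> : N / 2 - 2 * N / 32 = N / 8 + (5 / 16 * N) by field.
rewrite expRD mulrCA ler_peMr ?expR_ge0 //.
have := expR_ge1Dx (5 / 16 * N); set e := expR _; rewrite !expr2 in nbig; lra.
Qed.

End ball_concentration.

(** * Random matrices and moments *)

Section measurable_matrices.
Context {R : realType} {d : measure_display} {T : measurableType d}.

Definition mxmeas p q (F : T -> 'M[R]_(p, q)) :=
  forall i j, measurable_fun setT (fun w => F w i j).

Lemma mxmeas_eq p q (F G : T -> 'M[R]_(p, q)) : F =1 G -> mxmeas F -> mxmeas G.
Proof. by move=> /funext ->. Qed.

Lemma mxmeas_cst p q (A : 'M[R]_(p, q)) : mxmeas (fun=> A).
Proof. by move=> i j; exact: measurable_cst. Qed.

Lemma mxmeasD p q (F G : T -> 'M[R]_(p, q)) : mxmeas F -> mxmeas G ->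
  mxmeas (fun w => F w + G w).
Proof.
move=> mF mG i j; under eq_fun do rewrite mxE; exact: measurable_funD.
Qed.

Lemma mxmeasN p q (F : T -> 'M[R]_(p, q)) : mxmeas F -> mxmeas (fun w => - F w).
Proof.
move=> mF i j; under eq_fun do rewrite mxE.
exact: measurableT_comp.
Qed.

Lemma mxmeasB p q (F G : T -> 'M[R]_(p, q)) : mxmeas F -> mxmeas G ->
  mxmeas (fun w => F w - G w).
Proof. by move=> mF mG; apply: mxmeasD => //; exact: mxmeasN. Qed.

Lemma mxmeasZ p q k (F : T -> 'M[R]_(p, q)) : mxmeas F -> mxmeas (fun w => k *: F w).
Proof.
move=> mF i j; under eq_fun do rewrite mxE.
by apply: measurable_funM; [exact: measurable_cst|exact: mF].
Qed.

Lemma mxmeas_tr p q (F : T -> 'M[R]_(p, q)) : mxmeas F -> mxmeas (fun w => (F w)^T).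
Proof. by move=> mF i j; under eq_fun do rewrite mxE; exact: mF. Qed.

Lemma mxmeasM p q r (F : T -> 'M[R]_(p, q)) (G : T -> 'M[R]_(q, r)) :
  mxmeas F -> mxmeas G -> mxmeas (fun w => F w *m G w).
Proof.
move=> mF mG i j; under eq_fun do rewrite mxE.
by apply: measurable_sum => k; apply: measurable_funM.
Qed.

Lemma measurable_det n (F : T -> 'M[R]_n) : mxmeas F ->
  measurable_fun setT (fun w => \det (F w)).
Proof.
move=> mF; rewrite /determinant; apply: measurable_sum => s.
apply: measurable_funM; first exact: measurable_cst.
by apply: measurable_prod => i _; exact: mF.
Qed.

Lemma measurable_trace n (F : T -> 'M[R]_n) : mxmeas F ->
  measurable_fun setT (fun w => \tr (F w)).
Proof. by move=> mF; apply: measurable_sum => i; exact: mF. Qed.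

Lemma measurable_dot n (F G : T -> 'cV[R]_n) : mxmeas F -> mxmeas G ->
  measurable_fun setT (fun w => dot (F w) (G w)).
Proof. by move=> mF mG; exact: (mxmeasM (mxmeas_tr mF) mG 0 0). Qed.

Lemma mxmeas_inv n (F : T -> 'M[R]_n) : mxmeas F -> (forall w, F w \in unitmx) ->
  mxmeas (fun w => invmx (F w)).
Proof.
move=> mF uF; apply: (@mxmeas_eq _ _ (fun w => (\det (F w) * ((\det (F w) ^+ 2) `^ (-1))) *: \adj (F w))).
  move=> w; rewrite /invmx uF; congr (_ *: _).
  have := uF w; rewrite unitmxE unitfE => d0.
  by rewrite powR_inv1 ?sqr_ge0 // expr2 invfM mulrA divff // mul1r.
have md := measurable_det mF.
move=> i j; under eq_fun do rewrite mxE.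
apply: measurable_funM.
  apply: measurable_funM => //.
  apply: (measurableT_comp (@measurable_powR R (-1))).
  by apply: measurable_funX.
under eq_fun do rewrite mxE /cofactor.
apply: measurable_funM; first exact: measurable_cst.
apply: measurable_det => k l; under eq_fun do rewrite !mxE.
exact: mF.
Qed.

Lemma mxmeas_gram m n (x : T -> 'M[R]_(m, n)) : mxmeas x ->
  mxmeas (fun w => gram (x w)).
Proof.
move=> mx; apply: (@mxmeas_eq _ _ (fun w => (x w)^T *m x w)); first by move=> w; rewrite gramE.
by apply: mxmeasM => //; exact: mxmeas_tr.
Qed.

Lemma mxmeas_res m n (x : T -> 'M[R]_(m, n)) e : 0 < e -> mxmeas x ->
  mxmeas (fun w => res (gram (x w)) e).
Proof.
move=> e0 mx; apply: mxmeas_inv; last by move=> w; apply: shift_unit => //; exact: gram_psd.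
by apply: mxmeasD; [exact: mxmeas_gram|exact: mxmeas_cst].
Qed.

Lemma mxmeas_cutoff m n (x : T -> 'M[R]_(m, n)) b : 0 < b -> mxmeas x ->
  mxmeas (fun w => cutoff (x w) b).
Proof.
by move=> b0 mx; do 2?apply: mxmeasM; do ?[exact: mxmeas_gram|exact: mxmeas_res].
Qed.

Lemma mxmeas_cvg p q (F : nat -> T -> 'M[R]_(p, q)) (G : T -> 'M[R]_(p, q)) :
  (forall k, mxmeas (F k)) ->
  (forall w i j, F k w i j @[k --> \oo] --> G w i j) -> mxmeas G.
Proof.
move=> mF FG i j; apply: (@measurable_fun_cvg _ _ _ _ (fun k w => F k w i j)) => //.
by move=> k; exact: mF.
Qed.

End measurable_matrices.

(** The orthogonal projection on the row space is the limit of [S (S + e)^-1]. *)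
Lemma mxmeas_rangeproj (R : realType) d (T : measurableType d) m n (x : T -> 'M[R]_(m, n)) :
  mxmeas x -> mxmeas (fun w => rangeproj (x w)).
Proof.
move=> mx; apply: (@mxmeas_cvg _ _ _ _ _ (fun k w => gram (x w) *m res (gram (x w)) (k.+1%:R^-1))).
  by move=> k; apply: mxmeasM; [exact: mxmeas_gram|exact: mxmeas_res].
move=> w i j; have psd := gram_psd (x w); set G := gram (x w).
pose c := Num.sqrt (fro (penrose G)); have c0 : 0 <= c := sqrtr_ge0 _.
have close k : `|rangeproj (x w) i j - (G *m res G (k.+1%:R^-1)) i j| <= c * k.+1%:R^-1.
  set e := k.+1%:R^-1; have e0 : 0 < e by rewrite invr_gt0.
  have -> : rangeproj (x w) i j - (G *m res G e) i j = (e *: (penrose G *m (G *m res G e))) i j.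
    rewrite mulmxA -rangeprojC scalemxAr (scale_resE psd e0) mulmxBr mulmx1.
    by rewrite mulmxA rangeproj_gram [RHS]mxE; congr (_ + _); rewrite [RHS]mxE.
  rewrite mxE normrM (gtr0_norm e0) mulrC ler_wpM2r ?(ltW e0) //.
  apply: mxentry_bnd; rewrite -[c]mulr1; apply: bnd_mul => //; first exact: bnd_fro.
  exact: mul_res_bnd.
apply/cvgrPdist_le => eps eps0.
have c1 : 0 < eps / (c + 1) by rewrite divr_gt0 // ltr_wpDl.
near=> k; apply: le_trans (close k) _.
apply: (@le_trans _ _ ((c + 1) * k.+1%:R^-1)); first by rewrite ler_wpM2r ?invr_ge0 // lerDl.
rewrite mulrC -ler_pdivlMr ?ltr_wpDl //.
near: k; have := near_infty_natSinv_lt (PosNum c1).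
by apply: filterS => k /ltW.
Unshelve. all: by end_near.
Qed.

Section moments.
Context {d} {T : measurableType d} {R : realType} (P : probability T R).
Local Notation Ex f := (Rintegral P setT f).

Lemma psi2_norm_lt (B : R) (X : T -> R) : (psi2_norm P X <= B%:E)%E ->
  exists t, [/\ 0 < t, t < B + 1 & ('E_P[fun w => expR (X w ^+ 2 / t ^+ 2)] <= 2%:E)%E].
Proof.
move=> XB; have : (psi2_norm P X < (B + 1)%:E)%E.
  by apply: le_lt_trans XB _; rewrite lte_fin ltrDl.
move=> /ereal_inf_lt [_ [t [t0 tE] <-]]; rewrite lte_fin => tB.
by exists t.
Qed.

(** The fourth moment of a sub-Gaussian variable, from [x ^ 4 / 4 <= exp (x ^ 2)]. *)
Lemma standard_subgaussian_moments (B : R) (X : {RV P >-> R}) : 0 < B ->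
  standard_subgaussian B X ->
  [/\ L4 P X, Ex X = 0, Ex (fun w => X w * X w) = 1 &
      Ex (fun w => X w ^+ 4) <= 8 * (B + 1) ^+ 4].
Proof.
move=> B0 [EX VX /psi2_norm_lt [t [t0 tB tE]]].
have mX : measurable_fun setT X by [].
have t20 : 0 < t ^+ 2 by rewrite exprn_gt0.
pose g w := 4 * t ^+ 4 * expR (X w ^+ 2 / t ^+ 2).
have g0 w : 0 <= g w by rewrite mulr_ge0 ?expR_ge0 ?mulr_ge0 ?exprn_ge0 ?ltW.
have Xg w : X w ^+ 4 <= g w.
  rewrite /g; set y := X w ^+ 2 / t ^+ 2.
  have y0 : 0 <= y by rewrite divr_ge0 ?sqr_ge0.
  have -> : X w ^+ 4 = t ^+ 4 * y ^+ 2.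
    rewrite /y exprMn exprVn -!exprM mulrCA divff ?mulr1 //.
    by rewrite gt_eqF // exprn_gt0.
  have -> : expR y = expR (y / 2) ^+ 2 by rewrite expr2 -expRD -splitr.
  have := expR_ge1Dx (y / 2); set z := expR _ => h.
  have : y ^+ 2 <= 4 * z ^+ 2 by rewrite !expr2; nra.
  have : 0 <= t ^+ 4 by rewrite exprn_ge0 // ltW.
  nra.
have mg : measurable_fun setT g.
  apply: measurable_funM; first exact: measurable_cst.
  apply: measurableT_comp; first exact: measurable_expR.
  by apply: measurable_funM; [exact: measurable_funX|exact: measurable_cst].
have gE : (\int[P]_w (g w)%:E <= (8 * t ^+ 4)%:E)%E.
  under eq_integral do rewrite EFinM.
  have t4 : 0 <= 4 * t ^+ 4 by rewrite mulr_ge0 // exprn_ge0 // ltW.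
  have me : measurable_fun setT (fun w => expR (X w ^+ 2 / t ^+ 2)).
    apply: measurableT_comp; first exact: measurable_expR.
    by apply: measurable_funM; [exact: measurable_funX|exact: measurable_cst].
  rewrite ge0_integralZl_EFin //; last exact/measurable_EFinP.
  rewrite unlock in tE.
  have -> : (8 * t ^+ 4)%:E = ((4 * t ^+ 4)%:E * 2%:E)%E by rewrite -EFinM; congr EFin; ring.
  apply: lee_wpmul2l => //; rewrite lee_fin mulr_ge0 // exprn_ge0 // ltW.
have Ig : intg P g.
  apply/integrableP; split; first exact/measurable_EFinP.
  under eq_integral => w _ do rewrite /= ger0_norm //.
  by apply: le_lt_trans gE _; rewrite ltry.
have L4X : L4 P X.
  split => //; apply: intg_le Ig _; first exact: measurable_funX.
  by move=> w; rewrite ger0_norm // exprn_even_ge0.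
have EX0 : Ex X = 0 by move: EX; rewrite unlock /Rintegral => ->.
split => //.
  move: VX; rewrite /variance unlock /= EX /=; rewrite unlock /Rintegral => h.
  rewrite (_ : (\int[P]_w _)%E = 1%E) // -h; apply: eq_integral => w _ /=.
  by congr EFin; rewrite -[RHS]/((X w - 0) * (X w - 0)) subr0.
apply: (@le_trans _ _ (8 * t ^+ 4)); last first.
  by rewrite ler_pM2l // ler_pXn2r ?nnegrE ?ltW // addr_gt0.
apply: (@le_trans _ _ (Ex g)); first by apply: Ex_le => //; case: L4X.
rewrite /Rintegral -lee_fin fineK //.
exact: integrable_fin_num.
Qed.

Lemma mutually_independent_scale (I : finType) (X : I -> T -> R) c :
  mutually_independent P X -> mutually_independent P (fun i w => c * X i w).
Proof.
move=> Xind J A mA; apply: (Xind J (fun i => ( *%R c) @^-1` A i)) => i.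
rewrite -[X in measurable X]setTI.
have : measurable_fun setT ( *%R c : measurableTypeR R -> measurableTypeR R).
  by apply: measurable_funM => //; exact: measurable_cst.
by apply.
Qed.

(** Outer negligibility with a quantitative bound: no measurability of the set
    itself is required, so that bad events can be assembled freely. *)
Definition negl (A : set T) (p : R) :=
  exists A', [/\ measurable A', (P A' <= p%:E)%E & A `<=` A'].

Lemma negl_measurable A p : measurable A -> negl A p -> (P A <= p%:E)%E.
Proof.
by move=> mA [A' [mA' Ap sub]]; apply: le_trans Ap; apply: le_measure; rewrite ?inE.
Qed.

Lemma negl_sub A A' p : A `<=` A' -> negl A' p -> negl A p.
Proof. by move=> AA [B [mB Bp BA]]; exists B; split => //; exact: subset_trans BA. Qed.

Lemma negl_le A p q : p <= q -> negl A p -> negl A q.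
Proof.
by move=> pq [B [mB Bp BA]]; exists B; split => //; apply: le_trans Bp _; rewrite lee_fin.
Qed.

Lemma neglU A A' p q : negl A p -> negl A' q -> negl (A `|` A') (p + q).
Proof.
move=> [B [mB Bp BA]] [B' [mB' Bq BA']]; exists (B `|` B'); split.
- exact: measurableU.
- by apply: le_trans (measureU2 _ _ _) _ => //; rewrite EFinD leeD.
- exact: setUSS.
Qed.

Lemma negl0 p : 0 <= p -> negl set0 p.
Proof. by move=> p0; exists set0; split; rewrite ?measure0 ?lee_fin. Qed.

Lemma negl_bigU N (A : nat -> set T) p : (forall i, (i < N)%N -> negl (A i) p) ->
  negl [set w | exists2 i, (i < N)%N & A i w] (N%:R * p).
Proof.
elim: N => [|N IH] hA; first by rewrite mul0r; apply: negl_sub (negl0 (lexx _)) => w [].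
rewrite mulrSr mulrDl mul1r.
apply: negl_sub (neglU (IH _) (hA N _)) => //; last first.
  by move=> i iN; apply: hA; exact: leqW.
move=> w [i iN Ai]; move: iN; rewrite ltnS leq_eqVlt => /orP[/eqP iN|iN].
  by right; rewrite -iN.
by left; exists i.
Qed.

(** Markov's inequality for the number of events that occur, without assuming
    them independent. *)
Lemma negl_count m (A : 'I_m -> set T) p g : 0 < g -> (forall a, negl (A a) p) ->
  negl [set w | exists2 D : {set 'I_m}, g <= #|D|%:R & forall a, a \in D -> A a w]
    (m%:R * p / g).
Proof.
move=> g0 hA.
have [A' hA'] := choice hA.
pose f w := \sum_a (\1_(A' a) w : R).
have If : intg P f.
  by apply: intg_sum => a; apply: integrable_indic => //; case: (hA' a).
have f0 w : 0 <= f w by apply: sumr_ge0.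
have mf : measurable_fun setT f.
  by apply: measurable_sum => a; apply: measurable_indic; case: (hA' a).
exists [set w | g <= f w]; split.
- by apply: measurable_set_le => //; exact: measurable_cst.
- apply: le_trans (prob_le_Ex _ If g0 f0 _) _ => //.
    by apply: measurable_set_le => //; exact: measurable_cst.
  rewrite lee_fin ler_pM2r ?invr_gt0 // Ex_sum; last first.
    by move=> a; apply: integrable_indic => //; case: (hA' a).
  rewrite -[m in m%:R]card_ord -sumr_const mulr_suml; apply: ler_sum => a _.
  have [mA Ap _] := hA' a; rewrite mul1r /Rintegral integral_indic // setIT.
  by rewrite -lee_fin fineK // fin_num_measure.
move=> w [D gD DA] /=; apply: le_trans gD _.
rewrite /f (bigID (mem D)) /= -[leLHS]addr0; apply: lerD; last exact: sumr_ge0.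
rewrite -sumr_const; apply: ler_sum => a aD.
by rewrite indicE mem_set //; case: (hA' a) => _ _; apply; exact: DA.
Qed.

End moments.

(** * Perturbation of the ridge risk in the regularization *)

Section risk_expansion.
Context {R : realType} {m n : nat}.
Implicit Types (M B : 'M[R]_n) (v : 'cV[R]_n).

Lemma formD M u v : M^T = M -> form M (u + v) = form M u + 2 * dot (M *m u) v + form M v.
Proof.
move=> Mt; rewrite /form mulmxDr !dotDr !dotDl.
have -> : dot v (M *m u) = dot (M *m u) v by rewrite dotC.
have -> : dot u (M *m v) = dot (M *m u) v by rewrite dot_mulr Mt.
by ring.
Qed.

(** The increment [D] is tested against [M e] only after filtering by [B]; the
    unfiltered part of the cross term is absorbed into half of the quadratic
    term. [Q] is a projection fixing [D], which makes the price small when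
    [1 - B] is only small on the range of [Q]. *)
Lemma form_lower_coercive M Q B k e D : M^T = M -> 0 < k ->
  (forall v, k * enorm v ^+ 2 <= form M v) -> B^T = B -> Q^T = Q -> Q *m D = D ->
  k * enorm D ^+ 2 / 2 - 2 / k * enorm (Q *m ((1%:M - B) *m (M *m e))) ^+ 2
    + 2 * dot (M *m e) (B *m D) <= form M (e + D) - form M e.
Proof.
move=> Mt k0 Mk Bt Qt QD; rewrite formD //; have := Mk D.
have -> : dot (M *m e) D = dot (M *m e) (B *m D) + dot (Q *m ((1%:M - B) *m (M *m e))) D.
  rewrite [in RHS](dot_mull Q) Qt QD [in RHS](dot_mull (1%:M - B)) linearB /= Bt trmx1.
  by rewrite mulmxBl mul1mx dotBr addrC subrK.
set p := Q *m _; set cc := dot _ (B *m D).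
have : 0 <= enorm (k *: D + 2 *: p) ^+ 2 by exact: sqr_ge0.
rewrite !enorm_sqr !dotDr !dotDl !dotZl !dotZr (dotC D p) => h h2.
have {h} : 0 <= k * dot D D / 2 + 2 * dot p D + 2 / k * dot p p.
  have -> : k * dot D D / 2 + 2 * dot p D + 2 / k * dot p p =
    (k * (k * dot D D) + 2 * (k * dot p D) + (k * (2 * dot p D) + 2 * (2 * dot p p))) / (2 * k).
    by field; rewrite gt_eqF.
  by rewrite divr_ge0 // mulr_ge0 // ltW.
lra.
Qed.

Context (x : 'M[R]_(m, n)).
Local Notation S := (gram x).

Lemma dot_gram u v : dot (x *m u) (x *m v) = dot (S *m u) v.
Proof. by rewrite dot_mulr gramE -mulmxA. Qed.

(** The same completion of the square in the seminorm of the Gram matrix, which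
    is not coercive but commutes with [B]. *)
Lemma form_lower_gram B e D : B^T = B -> B *m S = S *m B ->
  enorm (x *m D) ^+ 2 / 2 - 2 * enorm (x *m ((1%:M - B) *m e)) ^+ 2
    + 2 * dot (S *m e) (B *m D) <= form S (e + D) - form S e.
Proof.
move=> Bt BS; rewrite formD ?(gram_psd x).1 // !gram_form.
have -> : dot (S *m e) D = dot (S *m e) (B *m D) + dot (x *m ((1%:M - B) *m e)) (x *m D).
  rewrite dot_gram (dot_mulr B) Bt -dotDl; congr (dot _ _).
  by rewrite mulmxBl mul1mx mulmxBr !mulmxA BS addrC subrK.
set p := x *m ((1%:M - B) *m e); set q := x *m D.
have : 0 <= enorm (q + 2 *: p) ^+ 2 by exact: sqr_ge0.
rewrite !enorm_sqr !dotDr !dotDl !dotZl !dotZr (dotC q p); lra.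
Qed.

Definition risk_weight (k : risk_kind) (Sigma : 'M[R]_n) : 'M[R]_n :=
  match k with Pred => Sigma | Est => 1%:M | In => S end.

(** The lower bounds of [form_lower_coercive] and [form_lower_gram], in a common
    notation: [gain] is the quadratic term and [penalty] the price of the filter. *)
Definition gain (k : risk_kind) (kap : R) v : R :=
  match k with In => enorm (x *m v) ^+ 2 | _ => kap * enorm v ^+ 2 end.

Definition penalty (k : risk_kind) (kap : R) (Sigma B : 'M[R]_n) v : R :=
  match k with
  | In => 2 * enorm (x *m ((1%:M - B) *m v)) ^+ 2
  | _ => 2 / kap * enorm (rangeproj x *m ((1%:M - B) *m (risk_weight k Sigma *m v))) ^+ 2
  end.

Lemma gainZ k kap a v : gain k kap (a *: v) = a ^+ 2 * gain k kap v.
Proof.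
by case: k => /=; rewrite ?linearZ /= enormZ exprMn real_normK ?num_real //; ring.
Qed.

(** The range projection is only inserted in the coercive cases. For the
    in-sample risk the weight degenerates, but commutes with [B]. *)
Lemma risk_lower k kap Sigma B e D : Sigma^T = Sigma -> 0 < kap <= 1 ->
  (forall v, kap * enorm v ^+ 2 <= form Sigma v) -> B^T = B -> B *m S = S *m B ->
  rangeproj x *m D = D ->
  let M := risk_weight k Sigma in
  gain k kap D / 2 - penalty k kap Sigma B e + 2 * dot (M *m e) (B *m D) <=
    form M (e + D) - form M e.
Proof.
move=> St /andP[k0 k1] Sk Bt BS PD; case: k => /=.
- exact: form_lower_coercive (rangeproj_tr x) PD.
- apply: form_lower_coercive (rangeproj_tr x) PD => //; first by rewrite trmx1.
  by move=> v; rewrite /form mul1mx -enorm_sqr ler_piMl ?sqr_ge0.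
- exact: form_lower_gram.
Qed.

(** [S mu + x^T a] is the right-hand side of the normal equations. *)
Definition ridge_err (mu : 'cV[R]_n) (a : 'cV[R]_m) e : 'cV[R]_n :=
  res S e *m (S *m mu + x^T *m a) - mu.

Lemma ridge_errE mu a e : 0 < e ->
  ridge_err mu a e = res S e *m (x^T *m a - e *: mu).
Proof.
move=> e0; have -> : x^T *m a - e *: mu = (S *m mu + x^T *m a) - (S + e%:M) *m mu.
  by rewrite mulmxDl mul_scalar_mx opprD addrACA subrr add0r.
by rewrite [RHS]mulmxBr [_ *m (_ *m mu)]mulmxA (resKl (gram_psd x) e0) mul1mx.
Qed.

Lemma ridge_err_diff mu a e z : 0 < e -> 0 < z ->
  ridge_err mu a e = ridge_err mu a z +
    (z - e) *: (res S e *m (res S z *m (S *m mu + x^T *m a))).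
Proof.
move=> e0 z0; rewrite [res S e *m (_ *m _)]mulmxA scalemxAl -(res_diff (gram_psd x) e0 z0).
rewrite mulmxBl /ridge_err; set p := _ *m _; set q := _ *m _.
by rewrite addrAC [q + _]addrC subrK.
Qed.

Lemma tr_mul_rangeproj : rangeproj x *m x^T = x^T.
Proof. by rewrite -[in RHS](mul_rangeproj x) trmx_mul rangeproj_tr. Qed.

(** Differences of the ridge path stay in the row space of the design, even for
    regularizations close to [0]. *)
Lemma rangeproj_path (mu : 'cV[R]_n) (a : 'cV[R]_m) e z : 0 < e -> 0 < z ->
  rangeproj x *m (res S e *m (res S z *m (S *m mu + x^T *m a))) =
    res S e *m (res S z *m (S *m mu + x^T *m a)).
Proof.
move=> e0 z0; set y := S *m mu + _.
have Py : rangeproj x *m y = y by rewrite mulmxDr !mulmxA rangeproj_gram tr_mul_rangeproj.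
rewrite mulmxA -(res_rangeprojC x e0) -mulmxA [rangeproj x *m (_ *m y)]mulmxA.
by rewrite -(res_rangeprojC x z0) -mulmxA Py.
Qed.

Lemma res_pushthrough e : 0 < e -> x *m res S e = res (gram x^T) e *m x.
Proof.
move=> e0; have psd := gram_psd x; have psd' := gram_psd x^T.
have c : (gram x^T + e%:M) *m x = x *m (S + e%:M).
  by rewrite mulmxDl mulmxDr !gramE trmxK mul_scalar_mx mul_mx_scalar !mulmxA.
rewrite -[LHS]mul1mx -(resKl psd' e0) -!mulmxA; congr (_ *m _).
by rewrite mulmxA c -mulmxA (resKr psd e0) mulmx1.
Qed.

(** Changing the regularization of a resolvent costs a bounded factor. *)
Lemma gain_res k kap e z v : 0 < kap -> 0 < e -> 0 < z ->
  gain k kap (res S z *m v) <= (2 + e / z) ^+ 2 * gain k kap (res S e *m v).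
Proof.
move=> k0 e0 z0; set c := 2 + e / z.
have psd := gram_psd x; have psd' := gram_psd x^T.
have c0 : 0 <= c by rewrite addr_ge0 // divr_ge0 // ltW.
have B p (T : 'M[R]_p) : bnd T z^-1 -> bnd (1%:M + (e - z) *: T) c.
  move=> Tb; apply: bnd_le (bnd_add (@bnd1 _ _) (bnd_scale (e - z) Tb)) _.
  have : `|e - z| / z <= (e + z) / z.
    rewrite ler_wpM2r ?invr_ge0 ?(ltW z0) //; apply: le_trans (ler_normB _ _) _.
    by rewrite !gtr0_norm.
  by rewrite mulrDl divff ?gt_eqF // /c; lra.
have rE : res S z *m v = (1%:M + (e - z) *: res S z) *m (res S e *m v).
  rewrite mulmxDl mul1mx -scalemxAl mulmxA scalemxAl -(res_diff psd z0 e0) mulmxBl.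
  by rewrite addrC subrK.
have le_sq p q (u : 'cV[R]_p) (w : 'cV[R]_q) : enorm u <= c * enorm w ->
    enorm u ^+ 2 <= c ^+ 2 * enorm w ^+ 2.
  move=> h; rewrite -exprMn ler_pXn2r ?nnegrE ?mulr_ge0 ?enorm_ge0 //.
have Bz := B _ _ (res_bnd psd z0); have Bz' := B _ _ (res_bnd psd' z0).
have cc : enorm (res S z *m v) ^+ 2 <= c ^+ 2 * enorm (res S e *m v) ^+ 2.
  by apply: le_sq; rewrite rE; exact: Bz.
have mul1 : kap * enorm (res S z *m v) ^+ 2 <= c ^+ 2 * (kap * enorm (res S e *m v) ^+ 2).
  by rewrite [leRHS]mulrCA ler_wpM2l // ltW.
case: k => //=; apply: le_sq.
rewrite {1}rE [x *m (_ *m (_ *m v))]mulmxA mulmxDr mulmx1 -scalemxAr (res_pushthrough z0).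
have -> : x + (e - z) *: (res (gram x^T) z *m x) = (1%:M + (e - z) *: res (gram x^T) z) *m x.
  by rewrite mulmxDl mul1mx scalemxAl.
by rewrite -mulmxA; exact: Bz'.
Qed.

Definition gain_weight (k : risk_kind) (kap : R) z : 'M[R]_n :=
  match k with In => res S z *m (res S z *m S *m res S z) *m res S z
  | _ => kap *: (res S z *m (res S z *m res S z) *m res S z) end.

(** The gain contains a pure noise term [u^T W u], with a mean of order one, and a
    pure signal term, which is nonnegative and dropped; the interaction of noise
    and signal is small because the noise is centred. *)
Lemma gain_lower k kap z mu a : 0 < kap -> 0 < z ->
  dot (x^T *m a) (gain_weight k kap z *m (x^T *m a)) +
    2 * dot (x^T *m a) (gain_weight k kap z *m (S *m mu)) <=
    gain k kap (res S z *m (res S z *m (S *m mu + x^T *m a))).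
Proof.
move=> k0 z0; set u := x^T *m a; set W := gain_weight k kap z.
have Rt := res_tr (gram_psd x) z.
set r := res S z in Rt W *.
have cross v : enorm (r *m (r *m v)) ^+ 2 = dot v (r *m (r *m r) *m r *m v).
  by rewrite enorm_sqr -!mulmxA dot_mull Rt dot_mull Rt.
have crossS v : enorm (x *m (r *m (r *m v))) ^+ 2 = dot v (r *m (r *m S *m r) *m r *m v).
  by rewrite enorm_sqr dot_mull [x^T *m (x *m _)]mulmxA -gramE -!mulmxA dot_mull Rt dot_mull Rt.
set y := S *m mu.
have Wt : W^T = W.
  rewrite /W /gain_weight; case: k {W} => /=; rewrite ?linearZ /= !trmx_mul !Rt ?(gram_psd x).1 !mulmxA //.
have gE v : gain k kap (r *m (r *m v)) = dot v (W *m v).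
  by rewrite /W /gain_weight; case: k {W Wt} => /=; rewrite ?cross ?crossS -?scalemxAl ?dotZr // !mulmxA.
have g0 v : 0 <= gain k kap v.
  by case: k {W Wt gE} => /=; rewrite ?sqr_ge0 // mulr_ge0 ?sqr_ge0 // ltW.
rewrite gE [W *m (y + u)]mulmxDr dotDl !dotDr.
have -> : dot y (W *m u) = dot u (W *m y) by rewrite dot_mulr Wt dotC.
have : 0 <= dot y (W *m y) by rewrite -gE.
lra.
Qed.

(** The cross term of the expansion of the risk, as a quadratic polynomial in
    the noise and the signal. *)
Lemma cross_term_expand z mu a (E : 'M[R]_n) : 0 < z ->
  let u := x^T *m a in let N := res S z *m E *m res S z in
  dot (ridge_err mu a z) (E *m (res S z *m (S *m mu + u))) =
  (dot a (x *m N *m x^T *m a) - z * dot mu (N *m S *m mu)) +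
  (dot a (x *m N *m S *m mu) - z * dot a (x *m N^T *m mu)).
Proof.
move=> z0 u N; have Rt := res_tr (gram_psd x) z.
rewrite ridge_errE // dot_mull Rt -/u.
have -> : res S z *m (E *m (res S z *m (S *m mu + u))) = N *m (S *m mu) + N *m u.
  by rewrite -mulmxDr /N -!mulmxA.
rewrite dotBl dotZl !dotDr {1 2}/u.
rewrite !dot_mull !trmxK -/u.
have -> : dot mu (N *m u) = dot a (x *m N^T *m mu).
  by rewrite /u dot_mulr dotC dot_mull trmxK mulmxA.
by rewrite /u -!mulmxA mulrDr; ring.
Qed.

End risk_expansion.

(** * The ridge path and its uniform bounds *)

Section ridge_path.
Context {R : realType} {m n : nat} (x : 'M[R]_(m, n)).
Local Notation S := (gram x).
Implicit Types (mu : 'cV[R]_n) (a : 'cV[R]_m).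

Definition ridge_path mu a e : 'cV[R]_n :=
  if e == 0 then penrose S *m (S *m mu + x^T *m a) - mu else ridge_err x mu a e.

Lemma range_sqr (y : 'cV[R]_n) : rangeproj x *m y = y ->
  exists q, y = S *m (S *m q) /\ penrose S *m y = S *m q.
Proof.
move=> Py; exists (penrose S *m (penrose S *m y)).
have [_ comm] := penrose_sym (gram_psd x).1.
have PS : S *m penrose S = rangeproj x by [].
split; rewrite !mulmxA.
  by rewrite -(mulmxA S S) comm mulmxA PS -(mulmxA (rangeproj x)) PS rangeproj_idem Py.
by rewrite comm -(mulmxA (penrose S)) PS -mulmxA Py.
Qed.

(** The right-hand side of the normal equations is in the range of [S], hence of
    the form [S ^ 2 q], which makes the path Lipschitz up to the ridgeless end. *)
Lemma ridge_path_lipschitz mu a : exists2 q, 0 <= q & forall e e', 0 <= e -> 0 <= e' ->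
  enorm (ridge_path mu a e - ridge_path mu a e') <= `|e - e'| * q.
Proof.
set y := S *m mu + x^T *m a.
have psd := gram_psd x.
have Py : rangeproj x *m y = y by rewrite mulmxDr !mulmxA rangeproj_gram tr_mul_rangeproj.
have [q [ySq pSq]] := range_sqr Py.
exists (enorm q) => [|e e' e0 e'0]; first exact: enorm_ge0.
have main t t' : 0 < t -> 0 <= t' -> enorm (ridge_path mu a t - ridge_path mu a t') <= `|t - t'| * enorm q.
  move=> t0 t'0; rewrite /ridge_path (gt_eqF t0) /ridge_err -/y.
  have [->|t'n] := eqVneq t' 0.
    rewrite pSq ySq opprB addrA subrK subr0.
    have -> : res S t *m (S *m (S *m q)) - S *m q = - t *: (S *m res S t *m q).
      by rewrite [res S t *m _]mulmxA (res_mulE psd t0) mulmxBl mul1mx addrAC subrr add0r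
        -scalemxAl scaleNr mulmxA -(res_comm psd t0).
    rewrite enormZ normrN ler_wpM2l //.
    by have := mul_res_bnd psd t0 q; rewrite mul1r.
  have t'p : 0 < t' by rewrite lt_neqAle eq_sym t'n.
  rewrite opprB addrA subrK -mulmxBl (res_diff psd t0 t'p) -scalemxAl enormZ distrC ler_wpM2l //.
  have -> : res S t *m res S t' *m y = (S *m res S t) *m ((S *m res S t') *m q).
    by rewrite ySq -!(res_comm psd) // -!mulmxA; congr (_ *m _); rewrite !mulmxA (res_comm psd t'p).
  apply: le_trans (mul_res_bnd psd t0 _) _; rewrite mul1r.
  by have := mul_res_bnd psd t'p q; rewrite mul1r.
have [e00|en] := eqVneq e 0; last by apply: main => //; rewrite lt_neqAle eq_sym en.
have [e'00|e'n] := eqVneq e' 0; first by rewrite e00 e'00 !subrr normr0 mul0r enorm0.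
by rewrite -enormN opprB distrC; apply: main => //; rewrite lt_neqAle eq_sym e'n.
Qed.

Lemma form_ridge_path_lipschitz (M : 'M[R]_n) mu a A : 0 <= A -> exists2 C, 0 <= C &
  forall e e', 0 <= e <= A -> 0 <= e' <= A ->
  `|form M (ridge_path mu a e) - form M (ridge_path mu a e')| <= C * `|e - e'|.
Proof.
move=> A0; have [q q0 lip] := ridge_path_lipschitz mu a.
pose c := Num.sqrt (fro M); have c0 : 0 <= c := sqrtr_ge0 _.
pose r := enorm (ridge_path mu a 0) + A * q.
have r0 : 0 <= r by rewrite addr_ge0 ?enorm_ge0 // mulr_ge0.
have pr e : 0 <= e <= A -> enorm (ridge_path mu a e) <= r.
  move=> /andP[e0 eA]; rewrite -[ridge_path mu a e](subrK (ridge_path mu a 0)) addrC.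
  apply: le_trans (enormD _ _) _; rewrite lerD2l.
  apply: le_trans (lip _ _ e0 (lexx 0)) _; rewrite subr0 ger0_norm //.
  by rewrite ler_wpM2r.
exists (2 * c * r * q) => [|e e' he he']; first by rewrite !mulr_ge0.
have /andP[e0 _] := he; have /andP[e'0 _] := he'.
set v := ridge_path mu a e; set v' := ridge_path mu a e'.
have -> : form M v - form M v' = dot (v - v') (M *m v) + dot v' (M *m (v - v')).
  by rewrite /form dotBl mulmxBr dotBr; ring.
apply: le_trans (ler_normD _ _) _.
have vv : enorm (v - v') <= `|e - e'| * q := lip _ _ e0 e'0.
have b1 := bnd_dot (v - v') v (bnd_fro M); have b2 := bnd_dot v' (v - v') (bnd_fro M).
have hv : enorm v <= r := pr _ he; have hv' : enorm v' <= r := pr _ he'.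
apply: le_trans (lerD b1 b2) _; rewrite -/c -mulrDr.
have -> : 2 * c * r * q * `|e - e'| = c * (`|e - e'| * q * r + r * (`|e - e'| * q)) by ring.
by rewrite ler_wpM2l // lerD // ler_pM ?enorm_ge0.
Qed.

End ridge_path.

Section ridge_risk.
Context {R : realType} {m n : nat} (Sigma : 'M[R]_n) (Z : 'M[R]_(m, n)).
Hypothesis n0 : (0 < n)%N.
Hypothesis Sigma_psd : psdmx Sigma.

Definition design : 'M[R]_(m, n) := Num.sqrt (n%:R^-1) *: (Z *m sqrtmx Sigma).

Let sqn : Num.sqrt (n%:R^-1) ^+ 2 = n%:R^-1 :> R.
Proof. by rewrite sqr_sqrtr. Qed.

Lemma trmxZ p q c (A : 'M[R]_(p, q)) : (c *: A)^T = c *: A^T.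
Proof. exact: linearZ. Qed.

Lemma gram_design : n%:R^-1 *: ((Z *m sqrtmx Sigma)^T *m (Z *m sqrtmx Sigma)) = gram design.
Proof.
by rewrite gramE /design trmxZ -scalemxAl -scalemxAr scalerA -expr2 sqn.
Qed.

Lemma form_sqrtmx v : form Sigma v = enorm (sqrtmx Sigma *m v) ^+ 2.
Proof.
have [[Ht _] HH] := sqrtmxP Sigma_psd.
by rewrite enorm_sqr dot_mull Ht mulmxA HH.
Qed.

(** The ridgeless estimator is the solution of the normal equations in the range
    of [S], whatever the normalization of the Gram matrix. *)
Lemma ridge_risk_path k mu xi e : 0 <= e ->
  ridge_risk k Sigma mu Z xi e =
  form (risk_weight design k Sigma)
    (ridge_path design mu (Num.sqrt (n%:R^-1) *: xi) e).
Proof.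
move=> e0; set x := design; set a := _ *: xi.
have nR : (n%:R : R) != 0 by rewrite pnatr_eq0 -lt0n.
have psd := gram_psd x.
rewrite /ridge_risk; set X := Z *m sqrtmx Sigma; set Y := X *m mu + xi.
have yE : n%:R^-1 *: (X^T *m Y) = gram x *m mu + x^T *m a.
  rewrite /Y mulmxDr scalerDr mulmxA scalemxAl gram_design; congr (_ + _).
  by rewrite /x /design /a trmxZ -scalemxAl -scalemxAr scalerA -expr2 sqn.
have XX : X^T *m X = n%:R *: gram x by rewrite -gram_design scalerA divff // scale1r.
have errE : ridge_estimator X Y e - mu = ridge_path x mu a e.
  rewrite /ridge_estimator /ridge_path; case: eqP => [_|/eqP en].
    congr (_ - _); rewrite -yE.
    have [q [ySq pSq]] : exists q, n%:R^-1 *: (X^T *m Y) = gram x *m (gram x *m q) /\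
        penrose (gram x) *m (n%:R^-1 *: (X^T *m Y)) = gram x *m q.
      apply: range_sqr; rewrite yE mulmxDr !mulmxA rangeproj_gram.
      by rewrite tr_mul_rangeproj.
    rewrite pSq -mulmxA; set G := X^T *m X.
    have Gt : G^T = G by rewrite /G trmx_mul trmxK.
    have [_ comm] := penrose_sym Gt; have [p1 _ _ _] := penroseP Gt.
    have -> : X^T *m Y = G *m (G *m (n%:R^-1 *: q)).
      have -> : X^T *m Y = n%:R *: (n%:R^-1 *: (X^T *m Y)) by rewrite scalerA divff // scale1r.
      rewrite ySq /G XX -!scalemxAl -!scalemxAr; congr (_ *: _).
      by rewrite scalerA divff // scale1r.
    have -> : gram x *m q = G *m (n%:R^-1 *: q).
      by rewrite /G XX -scalemxAl -scalemxAr scalerA divff // scale1r.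
    by clearbody G; rewrite !mulmxA -comm p1.
  rewrite [n%:R^-1 *: (X^T *m X)]gram_design.
  by rewrite /ridge_err -yE /res -scalemxAr mulmxA.
rewrite errE; case: k => /=.
- by rewrite form_sqrtmx.
- by rewrite /form mul1mx -enorm_sqr.
- rewrite gram_form /x /design -/X -scalemxAl enormZ exprMn real_normK ?num_real //.
  by rewrite sqn.
Qed.

End ridge_risk.

Section covariance_bounds.
Context {R : realType} {n : nat} (Sigma : 'M[R]_n) (K : R).
Hypotheses (n0 : (0 < n)%N) (Spsd : psdmx Sigma) (Sunit : Sigma \in unitmx).
Hypothesis SK : Num.max (opnorm (invmx Sigma)) (opnorm Sigma) <= K.

Lemma covariance_bnd : bnd Sigma K.
Proof. by apply: opnorm_bnd; apply: le_trans SK; rewrite le_max lexx orbT. Qed.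

Lemma covariance_inv_bnd : bnd (invmx Sigma) K.
Proof. by apply: opnorm_bnd; apply: le_trans SK; rewrite le_max lexx. Qed.

Lemma covariance_ge1 : 1 <= K.
Proof.
have [v v1] : exists v : 'cV[R]_n, enorm v = 1.
  exists (delta_mx (Ordinal n0) 0); rewrite enormE dotE (bigD1 (Ordinal n0)) //= big1 => [|k kj].
    by rewrite !mxE eqxx mulr1 addr0 sqrtr1.
  by rewrite !mxE (negbTE kj) mul0r.
have K0 : 0 <= K.
  by have := covariance_bnd v; rewrite v1 mulr1; apply: le_trans; exact: enorm_ge0.
have := bnd_mul K0 covariance_bnd covariance_inv_bnd v.
rewrite mulmxV // mul1mx v1 mulr1 => h; nra.
Qed.

Lemma covariance_form_ge v : K^-1 * enorm v ^+ 2 <= form Sigma v.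
Proof.
have K0 : 0 < K by apply: lt_le_trans covariance_ge1.
have [[Ht _] HH] := sqrtmxP Spsd.
rewrite form_sqrtmx // ler_pdivrMl //; set H := sqrtmx Sigma in Ht HH *.
have Hu : H \in unitmx.
  by move: Sunit; rewrite -HH unitmx_mul => /andP[].
have -> : enorm v ^+ 2 = dot (H *m v) (invmx Sigma *m (H *m v)).
  rewrite enorm_sqr [RHS]dot_mull Ht !mulmxA.
  suff -> : H *m invmx Sigma *m H = 1%:M by rewrite mul1mx.
  by rewrite -[LHS](mulmxK Hu) -(mulmxA _ H H) HH -(mulmxA H) mulVmx // mulmx1 mulmxV.
apply: le_trans (ler_norm _) _; apply: le_trans (bnd_dot _ _ covariance_inv_bnd) _.
by rewrite -expr2.
Qed.

End covariance_bounds.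

(** * A deterministic gap between risks *)

Section risk_gap.
Context {R : realType} {m n : nat} (x : 'M[R]_(m, n)).
Local Notation S := (gram x).

(** A spectral filter [B] through which the resolvents are bounded by [be] down
    to the regularization [lo]; it is the identity when the regularization is
    bounded away from zero. *)
Record smoothing (B : 'M[R]_n) (lo be : R) : Prop := Smoothing {
  smoothing_tr : B^T = B;
  smoothing_comm : B *m S = S *m B;
  smoothing_bnd1 : bnd B 1;
  smoothing_res : forall e, 0 < e -> lo <= e -> bnd (B *m res S e) be;
  smoothing_lip : forall e e', 0 < e -> 0 < e' -> lo <= e -> lo <= e' ->
    bnd (B *m res S e - B *m res S e') (`|e - e'| * be ^+ 2) }.

Lemma smoothing_id L : 0 < L -> smoothing 1%:M L^-1 L.
Proof.
move=> L0; have psd := gram_psd x.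
have rb e : 0 < e -> L^-1 <= e -> bnd (res S e) L.
  move=> e0 Le; apply: bnd_le (res_bnd psd e0) _.
  by rewrite -[leRHS]invrK lef_pV2 ?posrE ?invr_gt0.
split; rewrite ?trmx1 ?mul1mx ?mulmx1 //; first exact: bnd1.
  by move=> e e0 Le; rewrite mul1mx; exact: rb.
move=> e e' e0 e'0 Le Le'; rewrite !mul1mx (res_diff psd e0 e'0) distrC.
by apply: bnd_scale; rewrite expr2; apply: bnd_mul; [exact: ltW|exact: rb|exact: rb].
Qed.

Lemma smoothing_cutoff b : 0 < b -> smoothing (cutoff x b) 0 b^-1.
Proof.
move=> b0; have psd := gram_psd x.
split; [exact: cutoff_tr| |exact: cutoff_bnd| |].
- have c : S *m res S b *m S = S *m (S *m res S b) by rewrite -mulmxA (res_comm psd b0).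
  rewrite /cutoff; set P := S *m _ in c *; clearbody P.
  by rewrite -(mulmxA P P) c mulmxA c mulmxA.
- by move=> e e0 _; exact: cutoff_res_bnd.
- by move=> e e' e0 e'0 _ _; rewrite exprVn; exact: cutoff_res_diff_bnd.
Qed.

Lemma comm_res (B : 'M[R]_n) e : B *m S = S *m B -> 0 < e -> B *m res S e = res S e *m B.
Proof.
move=> BS e0; have psd := gram_psd x.
have c : (S + e%:M) *m B = B *m (S + e%:M).
  by rewrite mulmxDl mulmxDr BS mul_scalar_mx mul_mx_scalar.
rewrite -[LHS]mul1mx -(resKl psd e0) -!mulmxA; congr (_ *m _).
by rewrite mulmxA c -mulmxA (resKr psd e0) mulmx1.
Qed.

Context (Sigma : 'M[R]_n) (K : R).
Hypotheses (K1 : 1 <= K) (St : Sigma^T = Sigma) (SK : bnd Sigma K).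
Hypothesis Sk : forall v, K^-1 * enorm v ^+ 2 <= form Sigma v.

Let K0 : 0 < K. Proof. exact: lt_le_trans K1. Qed.

Context (B : 'M[R]_n) (lo be : R).
Hypotheses (sB : smoothing B lo be) (be1 : 1 <= be).

Let be0 : 0 <= be. Proof. exact: le_trans be1. Qed.

(** The matrix between the two resolvents at [z] in the cross term; it depends on
    the regularization in a Lipschitz way, so that a finite grid suffices. *)
Definition filtered (k : risk_kind) e : 'M[R]_n :=
  risk_weight x k Sigma *m (B *m res S e).

Lemma filtered_bnd k e : 0 < e -> lo <= e -> bnd (filtered k e) (K * be).
Proof.
move=> e0 le; have h := smoothing_res sB e0 le.
case: k; rewrite /filtered /=.
- by apply: bnd_mul => //; exact: ltW.
- by rewrite mul1mx; apply: bnd_le h _; rewrite ler_peMl.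
- rewrite mulmxA -(smoothing_comm sB) -mulmxA.
  apply: bnd_le (bnd_mul ler01 (smoothing_bnd1 sB) (mul_res_bnd (gram_psd x) e0)) _.
  by apply: ler_pM.
Qed.

Lemma filtered_lip k e e' : 0 < e -> 0 < e' -> lo <= e -> lo <= e' ->
  bnd (filtered k e - filtered k e') (K * (`|e - e'| * be ^+ 2)).
Proof.
move=> e0 e'0 le le'; rewrite /filtered -mulmxBr.
have h := smoothing_lip sB e0 e'0 le le'.
have p0 : 0 <= `|e - e'| * be ^+ 2 by rewrite mulr_ge0 ?sqr_ge0.
have psd := gram_psd x.
case: k => /=.
- by apply: bnd_mul => //; exact: ltW.
- by rewrite mul1mx; apply: bnd_le h _; rewrite ler_peMl.
- rewrite -mulmxBr (res_diff psd e0 e'0) -!scalemxAr distrC mulrCA.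
  apply: bnd_scale; rewrite [B *m (_ *m _)]mulmxA (comm_res (smoothing_comm sB) e0).
  rewrite -[res S e *m B *m _]mulmxA [S *m (_ *m _)]mulmxA.
  apply: bnd_le (bnd_mul ler01 (mul_res_bnd psd e0) (smoothing_res sB e'0 le')) _.
  by apply: ler_pM => //; rewrite expr2 ler_peMl.
Qed.

Section bounded_by_resolvent.
Context (z : R) (E : 'M[R]_n) (c : R).
Hypotheses (zK : K^-1 <= z) (c0 : 0 <= c) (Ec : bnd E c).

Let z0 : 0 < z. Proof. by apply: lt_le_trans zK; rewrite invr_gt0. Qed.
Let zV : z^-1 <= K. Proof. by rewrite -[K]invrK lef_pV2 ?posrE ?invr_gt0. Qed.

Lemma sqrt_resK : Num.sqrt z^-1 <= K.
Proof.
rewrite -[leRHS](gtr0_norm K0) -sqrtr_sqr ler_wsqrtr //.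
by apply: le_trans zV _; rewrite expr2 ler_peMl // ltW.
Qed.

(** All the quadratic forms of the expansion have this shape, which depends on the
    design only and is bounded through the regularization [z] away from [0]. *)
Definition sandwich : 'M[R]_n := res S z *m E *m res S z.

Let psd := gram_psd x.
Let Rt := res_tr psd z.
Let bR : bnd (res S z) K. Proof. exact: bnd_le (res_bnd psd z0) zV. Qed.
Let bxR : bnd (x *m res S z) K.
Proof. exact: bnd_le (mul_gram_res_bnd x z0) sqrt_resK. Qed.
Let bRx : bnd (res S z *m x^T) K.
Proof. exact: bnd_le (res_gram_tr_bnd x z0) sqrt_resK. Qed.
Let bRS : bnd (res S z *m S) 1.
Proof. by rewrite (res_comm psd z0); exact: mul_res_bnd. Qed.
Let K0' : 0 <= K. Proof. exact: ltW. Qed.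
Let KE0 : 0 <= K * c. Proof. exact: mulr_ge0. Qed.

Let to_K2 d : 0 <= d <= K -> K * c * d <= K ^+ 2 * c.
Proof.
move=> /andP[d0 dK]; have -> : K ^+ 2 * c = K * c * K by ring.
exact: ler_wpM2l.
Qed.

Lemma sandwich_noise_bnd : bnd (x *m sandwich *m x^T) (K ^+ 2 * c).
Proof.
rewrite /sandwich !mulmxA -(mulmxA _ (res S z) x^T).
by apply: bnd_le (bnd_mul KE0 (bnd_mul K0' bxR Ec) bRx) _; rewrite to_K2 // lexx K0'.
Qed.

Lemma sandwich_gram_bnd : bnd (sandwich *m S) (K ^+ 2 * c).
Proof.
rewrite /sandwich -(mulmxA _ (res S z) S).
by apply: bnd_le (bnd_mul KE0 (bnd_mul K0' bR Ec) bRS) _; rewrite to_K2 // ler01 K1.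
Qed.

Lemma sandwich_bnd : bnd sandwich (K ^+ 2 * c).
Proof.
by apply: bnd_le (bnd_mul KE0 (bnd_mul K0' bR Ec) bR) _; rewrite to_K2 // lexx K0'.
Qed.

Lemma sandwich_cross_bnd : bnd (x *m sandwich *m S) (K ^+ 2 * c).
Proof.
rewrite /sandwich !mulmxA -(mulmxA _ (res S z) S).
by apply: bnd_le (bnd_mul KE0 (bnd_mul K0' bxR Ec) bRS) _; rewrite to_K2 // ler01 K1.
Qed.

Lemma sandwich_cross_tr_bnd : bnd (x *m sandwich^T) (K ^+ 2 * c).
Proof.
rewrite /sandwich !trmx_mul Rt !mulmxA.
apply: bnd_le (bnd_mul KE0 (bnd_mul K0' bxR (bnd_tr c0 Ec)) bR) _.
by rewrite to_K2 // lexx K0'.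
Qed.

Lemma sandwich_trace : \tr (x *m sandwich *m x^T) = \tr (sandwich *m S).
Proof. by rewrite -mulmxA mxtrace_mulC gramE mulmxA. Qed.

Hypothesis n0 : (0 < n)%N.

Lemma sandwich_trace_bnd : `|\tr (sandwich *m S) / n%:R| <= K ^+ 2 * c.
Proof.
have c'0 : 0 <= K ^+ 2 * c by rewrite mulr_ge0 ?sqr_ge0.
have nR : 0 < (n%:R : R) by rewrite ltr0n.
rewrite normrM normfV (gtr0_norm nR) ler_pdivrMr //.
exact: trace_bnd sandwich_gram_bnd.
Qed.

Context (mu : 'cV[R]_n) (a : 'cV[R]_m) (s2 rho ep L A0 : R).
Hypotheses (mu1 : enorm mu <= 1) (zL : z <= L) (aA : enorm a <= A0).
Hypothesis quad : `|dot a (x *m sandwich *m x^T *m a) - s2 * (\tr (sandwich *m S) / n%:R)| <= ep.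
Hypothesis cross : `|dot a (x *m sandwich *m S *m mu)| <= ep.

(** At [z = s2 / |mu| ^ 2] the contributions of the noise and of the signal to
    the cross term have opposite expectations. *)
Lemma cross_term_small :
  `|dot a (x *m sandwich^T *m mu)| <= ep ->
  `|dot mu (sandwich *m S *m mu) - dot mu mu * (\tr (sandwich *m S) / n%:R)| <= ep ->
  `|s2 - z * dot mu mu| <= rho ->
  `|dot (ridge_err x mu a z) (E *m (res S z *m (S *m mu + x^T *m a)))| <=
    2 * (1 + L) * ep + rho * (K ^+ 2 * c).
Proof.
move=> crossT signal s2z; rewrite cross_term_expand // -/sandwich.
move: quad cross crossT signal; have := sandwich_trace_bnd.
set t := \tr _ / _; set q1 := dot a (x *m sandwich *m x^T *m a); set q2 := dot mu _.
set q3 := dot a (x *m sandwich *m S *m mu); set q4 := dot a _ => ht h1 h3 h4 h2.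
have -> : q1 - z * q2 + (q3 - z * q4) =
  (q1 - s2 * t) + (s2 - z * dot mu mu) * t - z * (q2 - dot mu mu * t) + q3 - z * q4 by ring.
have zz : `|z| = z by rewrite gtr0_norm.
have ep0 : 0 <= ep := le_trans (normr_ge0 _) h3.
have g2 : `|z * (q2 - dot mu mu * t)| <= L * ep by rewrite normrM zz ler_pM // ltW.
have g4 : `|z * q4| <= L * ep by rewrite normrM zz ler_pM // ltW.
have g5 : `|(s2 - z * dot mu mu) * t| <= rho * (K ^+ 2 * c) by rewrite normrM ler_pM.
apply: le_trans (ler_normB _ _) _; apply: le_trans (lerD (ler_normD _ _) (lexx _)) _.
apply: le_trans (lerD (lerD (ler_normB _ _) (lexx _)) (lexx _)) _.
apply: le_trans (lerD (lerD (lerD (ler_normD _ _) (lexx _)) (lexx _)) (lexx _)) _.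
lra.
Qed.

Lemma ridge_err_bnd : enorm (ridge_err x mu a z) <= 1 + K * A0.
Proof.
rewrite ridge_errE // mulmxBr mulmxA -scalemxAr scalemxAl; apply: le_trans (enormB _ _) _.
rewrite addrC lerD //.
  have h := bnd_scale z (res_bnd psd z0); apply: le_trans (h mu) _.
  by rewrite (gtr0_norm z0) divff ?mul1r ?gt_eqF.
by apply: le_trans (bRx a) _; rewrite ler_wpM2l.
Qed.

Lemma response_bnd : enorm (res S z *m (S *m mu + x^T *m a)) <= 1 + K * A0.
Proof.
rewrite mulmxDr !mulmxA; apply: le_trans (enormD _ _) _; apply: lerD.
  by apply: le_trans (bRS mu) _; rewrite mul1r.
by apply: le_trans (bRx a) _; rewrite ler_wpM2l.
Qed.

End bounded_by_resolvent.

Definition gain_core (k : risk_kind) z : 'M[R]_n :=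
  match k with In => res S z *m S *m res S z | _ => K^-1 *: (res S z *m res S z) end.

Lemma gain_core_bnd k z : K^-1 <= z -> bnd (gain_core k z) K.
Proof.
move=> zK; have z0 : 0 < z by apply: lt_le_trans zK; rewrite invr_gt0.
have zV : z^-1 <= K by rewrite -[K]invrK lef_pV2 ?posrE ?invr_gt0.
have bR : bnd (res S z) K by apply: bnd_le (res_bnd (gram_psd x) z0) zV.
have c : bnd (K^-1 *: (res S z *m res S z)) K.
  apply: bnd_le (bnd_scale _ (bnd_mul (ltW K0) bR bR)) _.
  by rewrite gtr0_norm ?invr_gt0 // mulKf // gt_eqF.
case: k => //=; rewrite -mulmxA -[X in bnd _ X]mulr1; apply: bnd_mul => //; first exact: ltW.
by apply: mul_res_bnd => //; exact: gram_psd.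
Qed.

Lemma gain_weight_sandwich k z : gain_weight x k K^-1 z = sandwich z (gain_core k z).
Proof.
by rewrite /sandwich; case: k; rewrite //= -scalemxAr -scalemxAl.
Qed.

(** Cauchy-Schwarz propagates a lower bound for the trace of [S (S + z)^-1]. *)
Lemma gain_trace k z t T : 0 < z -> 0 < t -> 1 <= T -> (0 < n)%N ->
  t * n%:R <= \tr (S *m res S z) -> \tr S <= T * n%:R ->
  K^-1 * (t ^+ 2 / T) ^+ 2 / T <= \tr (sandwich z (gain_core k z) *m S) / n%:R.
Proof.
move=> z0 t0 T1 n0 tS ST; have psd := gram_psd x; have Rt := res_tr psd z.
have T0 : 0 < T by apply: lt_le_trans T1.
set N : R := n%:R in tS ST *; have N0 : 0 < N by rewrite ltr0n.
set r := res S z in Rt tS *; set f1 := fro (x *m r); set f2 := fro (x *m r *m r).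
have xS : fro x <= T * N by rewrite -gram_trace.
have S1 : t ^+ 2 / T * N <= f1.
  have := trace_CS x (x *m r); rewrite mulmxA -gramE -/f1 => CS.
  have : (t * N) ^+ 2 <= T * N * f1.
    apply: (@le_trans _ _ (\tr (S *m r) ^+ 2)).
      by rewrite ler_pXn2r ?nnegrE // ?mulr_ge0 ?(ltW t0) ?(ltW N0) // (le_trans _ tS) // mulr_ge0 ?(ltW t0) ?(ltW N0).
    by apply: le_trans CS _; rewrite ler_wpM2r ?fro_ge0.
  have -> : (t * N) ^+ 2 = T * N * (t ^+ 2 / T * N) by field; rewrite gt_eqF.
  by rewrite ler_pM2l // mulr_gt0.
have f1E : f1 = \tr (S *m (r *m r)).
  by rewrite /f1 fro_trace trmx_mul Rt -mulmxA mxtrace_mulC !mulmxA -gramE -!mulmxA.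
have g0 : 0 <= t ^+ 2 / T by rewrite divr_ge0 ?sqr_ge0 // ltW.
have S2 : (t ^+ 2 / T) ^+ 2 / T * N <= f2.
  have := trace_CS x (x *m r *m r); rewrite -[x *m r *m r]mulmxA mulmxA -gramE -f1E [x *m (r *m r)]mulmxA -/f2 => CS.
  have : (t ^+ 2 / T * N) ^+ 2 <= T * N * f2.
    apply: (@le_trans _ _ (f1 ^+ 2)).
      by rewrite ler_pXn2r ?nnegrE ?fro_ge0 // mulr_ge0 // ltW.
    by apply: le_trans CS _; rewrite ler_wpM2r ?fro_ge0.
  have -> : (t ^+ 2 / T * N) ^+ 2 = T * N * ((t ^+ 2 / T) ^+ 2 / T * N) by field; rewrite gt_eqF.
  by rewrite ler_pM2l // mulr_gt0.
have S3 : (t ^+ 2 / T) ^+ 2 * N <= fro (r *m S *m r).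
  have := trace_CS 1%:M (r *m S *m r); rewrite trmx1 mul1mx fro1 -/N.
  have -> : \tr (r *m S *m r) = f1 by rewrite f1E -mulmxA mxtrace_mulC mulmxA.
  move=> CS; have : (t ^+ 2 / T * N) ^+ 2 <= N * fro (r *m S *m r).
    apply: le_trans CS; rewrite ler_pXn2r ?nnegrE ?fro_ge0 // mulr_ge0 // ltW.
  have -> : (t ^+ 2 / T * N) ^+ 2 = N * ((t ^+ 2 / T) ^+ 2 * N) by ring.
  by rewrite ler_pM2l.
have KV : K^-1 <= 1 by rewrite invf_le1.
have co : K^-1 * (t ^+ 2 / T) ^+ 2 / T * N <= K^-1 * f2.
  have -> : K^-1 * (t ^+ 2 / T) ^+ 2 / T * N = K^-1 * ((t ^+ 2 / T) ^+ 2 / T * N) by rewrite !mulrA.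
  by rewrite ler_pM2l ?invr_gt0.
rewrite ler_pdivlMr //.
have trc : K^-1 * f2 = \tr (sandwich z (K^-1 *: (r *m r)) *m S).
  rewrite /sandwich -/r -scalemxAr -!scalemxAl mxtraceZ; congr (_ * _).
  rewrite /f2 -fro_tr fro_trace trmxK !trmx_mul Rt !mulmxA mxtrace_mulC !mulmxA -gramE.
  by rewrite [RHS]mxtrace_mulC !mulmxA.
case: k => /=; rewrite -/r -?trc //.
apply: (@le_trans _ _ ((t ^+ 2 / T) ^+ 2 * N)).
  rewrite ler_wpM2r ?(ltW N0) // ler_pdivrMr //.
  by rewrite mulrC ler_wpM2l ?sqr_ge0 // (le_trans KV).
apply: le_trans S3 _.
rewrite fro_trace !trmx_mul Rt psd.1 /sandwich -/r !mulmxA.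
by rewrite [leLHS]mxtrace_mulC !mulmxA.
Qed.

Lemma risk_weight_tr k : (risk_weight x k Sigma)^T = risk_weight x k Sigma.
Proof. by case: k; rewrite //= ?trmx1 // (gram_psd x).1. Qed.

(** The in-sample penalty is bounded deterministically, by the smallness of
    [x (1 - B)], hence the default value. *)
Definition penalty_half (k : risk_kind) : 'M[R]_n :=
  match k with In => 0
  | _ => rangeproj x *m (1%:M - B) *m risk_weight x k Sigma end.

Definition penalty_core k : 'M[R]_n := (penalty_half k)^T *m penalty_half k.

Let bA : bnd (rangeproj x *m (1%:M - B)) 2.
Proof.
rewrite -[2]mul1r; apply: bnd_mul => //; first exact: rangeproj_bnd.
by rewrite -[2]/(1 + 1); apply: bnd_add; [exact: bnd1|exact/bnd_opp/(smoothing_bnd1 sB)].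
Qed.

Let bM k : k <> In -> bnd (risk_weight x k Sigma) K.
Proof. by case: k => //= _; apply: bnd_le (@bnd1 _ _) K1. Qed.

Lemma penalty_core_bnd k : bnd (penalty_core k) (4 * K ^+ 2).
Proof.
have K2 : 0 <= 2 * K by rewrite mulr_ge0 // ltW.
have h : bnd (penalty_half k) (2 * K).
  case: k => /=.
  - by apply: bnd_mul => //; exact: (@bM Pred).
  - by apply: bnd_mul => //; exact: (@bM Est).
  - by move=> v; rewrite mul0mx enorm0 mulr_ge0 // enorm_ge0.
have -> : 4 * K ^+ 2 = 2 * K * (2 * K) by ring.
by apply: bnd_mul => //; exact: bnd_tr.
Qed.

(** The mean of the penalty over noise and signal is a Frobenius norm, small by
    the hypothesis on [rangeproj x * (1 - B)]; the error at [z] is split into its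
    noise and signal parts, which are both concentrated. *)
Lemma penalty_small k mu a (z s2 ep L A0 phi xb : R) : K^-1 <= z -> z <= L -> (0 < n)%N ->
  enorm mu <= 1 -> enorm a <= A0 -> 0 <= s2 <= K -> 0 <= phi -> 0 <= xb -> 0 <= ep ->
  fro (rangeproj x *m (1%:M - B)) <= phi * n%:R -> bnd (x *m (1%:M - B)) xb ->
  let N := sandwich z (penalty_core k) in
  `|dot a (x *m N *m x^T *m a) - s2 * (\tr (N *m S) / n%:R)| <= ep ->
  `|dot mu (N *m mu) - dot mu mu * (\tr N / n%:R)| <= ep ->
  penalty x k K^-1 Sigma B (ridge_err x mu a z) <=
    4 * K * (K + L ^+ 2) * (K ^+ 4 * phi) + 4 * K * (1 + L ^+ 2) * ep + 2 * xb ^+ 2 * (1 + K * A0) ^+ 2.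
Proof.
move=> zK zL n0 mu1 aA /andP[s20 s2K] phi0 xb0 ep0 Aphi xB N.
have z0 : 0 < z by apply: lt_le_trans zK; rewrite invr_gt0.
have zV : z^-1 <= K by rewrite -[K]invrK lef_pV2 ?posrE ?invr_gt0.
have A00 : 0 <= A0 := le_trans (enorm_ge0 a) aA.
have K0' := ltW K0.
have KA : 0 <= 1 + K * A0 by rewrite addr_ge0 // mulr_ge0.
have p1 : 0 <= 4 * K * (K + L ^+ 2) * (K ^+ 4 * phi).
  by rewrite !mulr_ge0 ?addr_ge0 ?sqr_ge0 ?exprn_ge0.
have p2 : 0 <= 4 * K * (1 + L ^+ 2) * ep by rewrite !mulr_ge0 ?addr_ge0 ?sqr_ge0.
have p3 : 0 <= 2 * xb ^+ 2 * (1 + K * A0) ^+ 2 by rewrite !mulr_ge0 ?sqr_ge0.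
case: (EM (k = In)) => [->|kIn] => [_ _|quad signal].
  rewrite /penalty mulmxA; have := xB (ridge_err x mu a z).
  have := ridge_err_bnd zK mu1 aA; set v := enorm (ridge_err _ _ _ _); set q := enorm _ => h1 h2.
  have : q ^+ 2 <= (xb * (1 + K * A0)) ^+ 2.
    rewrite ler_pXn2r ?nnegrE ?enorm_ge0 ?mulr_ge0 //.
    by apply: le_trans h2 _; rewrite ler_wpM2l.
  by rewrite exprMn; lra.
set P := penalty_half k.
have Rt := res_tr (gram_psd x) z.
have penE v : penalty x k K^-1 Sigma B v = 2 * K * enorm (P *m v) ^+ 2.
  by rewrite /P /penalty; case: k kIn {N quad signal P} => // _; rewrite invrK /= -!mulmxA.
have NE p (w : 'M[R]_(n, p)) : N *m w = res S z *m (P^T *m (P *m (res S z *m w))).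
  by rewrite /N /sandwich /penalty_core -/P -!mulmxA.
have dotN v : dot v (N *m v) = enorm (P *m (res S z *m v)) ^+ 2.
  by rewrite NE dot_mulr Rt dot_mulr trmxK enorm_sqr.
have froP : fro P <= K ^+ 2 * (phi * n%:R).
  have PE : P = rangeproj x *m (1%:M - B) *m risk_weight x k Sigma.
    by rewrite /P; case: k kIn {N quad signal P penE NE dotN}.
  rewrite PE; apply: le_trans (fro_mulr _ (ltW K0) (bM kIn)) _.
  by rewrite ler_wpM2l ?sqr_ge0.
have nR : 0 < (n%:R : R) by rewrite ltr0n.
have frob q (T : 'M[R]_(n, q)) t : 0 <= t <= K -> bnd T t -> fro (P *m T) / n%:R <= K ^+ 4 * phi.
  move=> /andP[t0 tK] Tt; rewrite ler_pdivrMr //.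
  apply: le_trans (fro_mulr _ t0 Tt) _.
  apply: (@le_trans _ _ (K ^+ 2 * (K ^+ 2 * (phi * n%:R)))).
    apply: ler_pM; rewrite ?sqr_ge0 ?fro_ge0 //.
    by rewrite ler_pXn2r ?nnegrE // ltW.
  by rewrite mulrA -exprD mulrA.
have KK : 0 <= K <= K by rewrite lexx ltW.
have tr1 : \tr (N *m S) / n%:R <= K ^+ 4 * phi.
  have -> : \tr (N *m S) = fro (P *m (res S z *m x^T)).
    have -> : N *m S = N *m x^T *m x by rewrite -mulmxA -gramE.
    by rewrite mxtrace_mulC fro_trace !trmx_mul trmxK Rt NE !mulmxA.
  apply: frob KK _; apply: bnd_le (res_gram_tr_bnd x z0) _; exact: sqrt_resK.
have tr2 : \tr N / n%:R <= K ^+ 4 * phi.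
  have -> : \tr N = fro (P *m res S z).
    by rewrite fro_trace !trmx_mul Rt -[N]mulmx1 NE !mulmxA mulmx1.
  apply: frob KK _; apply: bnd_le (res_bnd (gram_psd x) z0) _ => //.
rewrite penE ridge_errE // !mulmxBr -!scalemxAr.
set v1 := P *m (res S z *m (x^T *m a)); set v2 := P *m (res S z *m mu).
have e1 : enorm v1 ^+ 2 <= K * (K ^+ 4 * phi) + ep.
  have := le_trans (ler_norm _) quad.
  have -> : dot a (x *m N *m x^T *m a) = enorm v1 ^+ 2.
    by rewrite -[x *m N *m x^T *m a]mulmxA -[x *m N *m _]mulmxA dot_mulr dotN.
  have : s2 * (\tr (N *m S) / n%:R) <= K * (K ^+ 4 * phi).
    apply: (@le_trans _ _ (s2 * (K ^+ 4 * phi))); first by rewrite ler_wpM2l.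
    by rewrite ler_wpM2r // mulr_ge0 // exprn_ge0 // ltW.
  lra.
have e2 : enorm v2 ^+ 2 <= K ^+ 4 * phi + ep.
  have := le_trans (ler_norm _) signal; rewrite dotN -/v2.
  have : dot mu mu * (\tr N / n%:R) <= 1 * (K ^+ 4 * phi).
    apply: (@le_trans _ _ (dot mu mu * (K ^+ 4 * phi))); first by rewrite ler_wpM2l ?dot_ge0.
    rewrite ler_wpM2r ?mulr_ge0 ?exprn_ge0 ?(ltW K0) // -enorm_sqr.
    by rewrite expr_le1 // enorm_ge0.
  lra.
have zz : z ^+ 2 <= L ^+ 2 by rewrite ler_pXn2r ?nnegrE ?(ltW z0) // (le_trans (ltW z0)).
have e3 : z ^+ 2 * enorm v2 ^+ 2 <= L ^+ 2 * (K ^+ 4 * phi + ep).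
  by apply: ler_pM => //; exact: sqr_ge0.
have par : enorm (v1 - z *: v2) ^+ 2 <= 2 * enorm v1 ^+ 2 + 2 * (z ^+ 2 * enorm v2 ^+ 2).
  have : 0 <= enorm (v1 + z *: v2) ^+ 2 by exact: sqr_ge0.
  rewrite !enorm_sqr !(dotDl, dotDr, dotNl, dotNr, dotZl, dotZr) (dotC v2 v1) expr2.
  lra.
have : enorm (v1 - z *: v2) ^+ 2 <= 2 * (K * (K ^+ 4 * phi) + ep) + 2 * (L ^+ 2 * (K ^+ 4 * phi + ep)).
  by apply: le_trans par _; lra.
move=> h; have := ler_wpM2l (mulr_ge0 (ler0n _ 2) (ltW K0)) h.
set X := K ^+ 4 * phi in p1 *; set L2 := L ^+ 2 in p1 p2 *; lra.
Qed.

(** The lower bound on the risk at [e], whose cross term is only known at the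
    neighbour [e'] of a finite grid. *)
Lemma risk_gap k mu a (z e e' A0 g p ep rho L dl : R) :
  K^-1 <= z -> z <= L -> 0 < e -> lo <= e -> e <= L -> 0 < e' -> lo <= e' ->
  `|e - e'| <= rho -> dl <= `|e - z| -> 0 <= dl -> enorm mu <= 1 -> enorm a <= A0 -> 0 <= g ->
  g <= gain x k K^-1 (res S z *m (res S z *m (S *m mu + x^T *m a))) ->
  penalty x k K^-1 Sigma B (ridge_err x mu a z) <= p ->
  `|dot (ridge_err x mu a z) (filtered k e' *m (res S z *m (S *m mu + x^T *m a)))| <= ep ->
  dl ^+ 2 * g / (2 * (2 + L * K) ^+ 2) - p -
     2 * L * (ep + K * (rho * be ^+ 2) * (1 + K * A0) ^+ 2) <=
  form (risk_weight x k Sigma) (ridge_err x mu a e) - form (risk_weight x k Sigma) (ridge_err x mu a z).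
Proof.
move=> zK zL e0 le eL e'0 le' ee' dlz dl0 mu1 aA g0 gE pE cE.
have z0 : 0 < z by apply: lt_le_trans zK; rewrite invr_gt0.
have zV : z^-1 <= K by rewrite -[K]invrK lef_pV2 ?posrE ?invr_gt0.
have L0 : 0 < L by exact: lt_le_trans zL.
have A00 : 0 <= A0 := le_trans (enorm_ge0 a) aA.
have KV : 0 < K^-1 <= 1 by rewrite invr_gt0 K0 invf_le1.
set h := res S z *m (S *m mu + x^T *m a) in gE cE *.
set ez := ridge_err x mu a z in pE cE *.
have PD : rangeproj x *m ((z - e) *: (res S e *m h)) = (z - e) *: (res S e *m h).
  by rewrite -scalemxAr (rangeproj_path x mu a e0 z0).
have := risk_lower k ez St KV Sk (smoothing_tr sB) (smoothing_comm sB) PD.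
rewrite -(ridge_err_diff x mu a e0 z0); apply: le_trans.
rewrite gainZ.
have -> : dot (risk_weight x k Sigma *m ez) (B *m ((z - e) *: (res S e *m h))) =
    (z - e) * dot ez (filtered k e *m h).
  by rewrite -scalemxAr dotZr dot_mull risk_weight_tr /filtered -!mulmxA.
have G1 : dl ^+ 2 * g / (2 * (2 + L * K) ^+ 2) <= (z - e) ^+ 2 * gain x k K^-1 (res S e *m h) / 2.
  have KV0 : 0 < K^-1 by rewrite invr_gt0.
  have := gain_res x k h KV0 e0 z0; set c1 := 2 + e / z => gr.
  have c1L : c1 <= 2 + L * K by rewrite lerD2l ler_pM // ?invr_ge0 ltW.
  have c10 : 0 < c1 by rewrite addr_gt0 // divr_gt0.
  have cL0 : 0 < 2 + L * K by exact: lt_le_trans c1L.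
  set c2 := 2 + L * K in c1L cL0 *.
  set gg := gain x k K^-1 (res S e *m h) in gr *.
  have gg0 : 0 <= gg by rewrite /gg; case: (k) => /=; rewrite ?sqr_ge0 // mulr_ge0 ?sqr_ge0 // ltW.
  have g2 : g <= c2 ^+ 2 * gg.
    apply: le_trans gE _; apply: le_trans gr _; rewrite ler_wpM2r //.
    by rewrite ler_pXn2r ?nnegrE // ltW.
  have d2 : dl ^+ 2 <= (z - e) ^+ 2.
    rewrite -(real_normK (num_real (z - e))) distrC ler_pXn2r ?nnegrE ?normr_ge0 //.
  have c20 : 0 < c2 ^+ 2 by rewrite exprn_gt0.
  rewrite invfM mulrA mulrAC ler_pM2r ?invr_gt0 //.
  rewrite ler_pdivrMr //.
  have -> : (z - e) ^+ 2 * gg * c2 ^+ 2 = (z - e) ^+ 2 * (c2 ^+ 2 * gg) by ring.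
  by apply: ler_pM => //; exact: sqr_ge0.
have C1 : `|dot ez (filtered k e *m h)| <= ep + K * (rho * be ^+ 2) * (1 + K * A0) ^+ 2.
  have -> : dot ez (filtered k e *m h) = dot ez (filtered k e' *m h) +
     dot ez ((filtered k e - filtered k e') *m h) by rewrite mulmxBl dotBr addrC subrK.
  apply: le_trans (ler_normD _ _) _; apply: lerD => //.
  apply: le_trans (bnd_dot _ _ (filtered_lip k e0 e'0 le le')) _.
  apply: ler_pM; rewrite ?mulr_ge0 ?sqr_ge0 ?enorm_ge0 ?(ltW K0) //.
    by rewrite ler_pM2l // ler_wpM2r ?sqr_ge0.
  rewrite expr2; apply: ler_pM; rewrite ?enorm_ge0 //.
    exact: ridge_err_bnd.
  exact: response_bnd.
have C2 : - (2 * L * (ep + K * (rho * be ^+ 2) * (1 + K * A0) ^+ 2)) <=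
    2 * ((z - e) * dot ez (filtered k e *m h)).
  set cc := dot ez _ in C1 *; set bb := ep + _ in C1 *.
  have : `|(z - e) * cc| <= L * bb.
    rewrite normrM; apply: ler_pM => //.
    by rewrite ler_norml; apply/andP; split; lra.
  rewrite ler_norml => /andP[h1 _]; lra.
set X := _ / (2 * _) in G1 *; set Y := 2 * L * _ in C2 *; lra.
Qed.

End risk_gap.

(** * Traces of resolvents through their diagonal *)

Section traces.
Context {R : realType}.

Lemma weighted_fro p n (A : 'M[R]_(p, n)) (W : 'M[R]_n) k :
  (forall v, k * enorm v ^+ 2 <= form W v) -> k * fro A <= \tr (A *m W *m A^T).
Proof.
move=> Wk; rewrite /fro mulr_sumr /mxtrace; apply: ler_sum => i _.
have := Wk (row i A)^T; rewrite enorm_sqr !dotE.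
have -> : \sum_i0 (row i A)^T i0 0 * (row i A)^T i0 0 = \sum_j A i j ^+ 2.
  by apply: eq_bigr => j _; rewrite !mxE expr2.
suff -> : form W (row i A)^T = (A *m W *m A^T) i i by [].
rewrite /form /dot trmxK mulmxA -row_mul.
by rewrite [LHS]mxE [RHS]mxE; apply: eq_bigr => j _; rewrite !mxE.
Qed.

Context {m n : nat} (x : 'M[R]_(m, n)).
Local Notation S := (gram x).

Lemma res_form_ge0 e v : 0 < e -> 0 * enorm v ^+ 2 <= form (res S e) v.
Proof.
move=> e0; rewrite mul0r /form; have psd := gram_psd x.
have {1}-> : v = (S + e%:M) *m (res S e *m v) by rewrite mulmxA (resKr psd e0) mul1mx.
rewrite mulmxDl dotDl mul_scalar_mx dotZl addr_ge0 ?mulr_ge0 ?dot_ge0 ?(ltW e0) //.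
by rewrite dotC; have := psdmx_form (res S e *m v) psd.
Qed.

(** The resolvent is a sum of Gram matrices, on which the weight acts through its
    lower bound. *)
Lemma trace_weight_res (W : 'M[R]_n) k e : 0 < e ->
  (forall v, k * enorm v ^+ 2 <= form W v) -> k * \tr (res S e) <= \tr (W *m res S e).
Proof.
move=> e0 Wk; have psd := gram_psd x; have Rt := res_tr psd e.
set r := res S e in Rt *.
have RE : r = r *m x^T *m x *m r + e *: (r *m r).
  have -> : r *m x^T *m x *m r + e *: (r *m r) = r *m ((S + e%:M) *m r).
    by rewrite mulmxDl mul_scalar_mx mulmxDr -scalemxAr gramE !mulmxA.
  by rewrite (resKr psd e0) mulmx1.
have wE : \tr (W *m r) = \tr ((x *m r) *m W *m (x *m r)^T) + e * \tr (r *m W *m r^T).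
  rewrite {1}RE mulmxDr -scalemxAr linearD /= mxtraceZ trmx_mul Rt; congr (_ + _ * _).
    by rewrite [RHS]mxtrace_mulC !mulmxA mxtrace_mulC !mulmxA.
  by rewrite [RHS]mxtrace_mulC !mulmxA [LHS]mxtrace_mulC !mulmxA mxtrace_mulC !mulmxA.
have tE : \tr r = fro (x *m r) + e * fro r.
  rewrite {1}RE linearD /= mxtraceZ !fro_trace trmx_mul Rt; congr (_ + _).
  by rewrite !mulmxA.
rewrite wE tE mulrDr mulrCA; apply: lerD; first exact: weighted_fro.
by rewrite ler_wpM2l ?(ltW e0) //; exact: weighted_fro.
Qed.

(** The inequality [1 / t >= 2 s - s ^ 2 t] applied to the eigenvalues of [S + e],
    at the inverse [s] of an upper bound of their mean. *)
Lemma trace_res_ge e T : 0 < e -> 0 < T -> \tr S <= T * n%:R ->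
  n%:R / (T + e) <= \tr (res S e).
Proof.
move=> e0 T0 ST; have psd := gram_psd x.
have Te : 0 < T + e by rewrite addr_gt0.
set s := (T + e)^-1; pose A := S + e%:M.
have := weighted_fro (1%:M - s *: A) (fun v => res_form_ge0 v e0).
rewrite mul0r.
have At : A^T = A by rewrite /A linearD /= psd.1 tr_scalar_mx.
have -> : (1%:M - s *: A)^T = 1%:M - s *: A by rewrite linearB /= trmx1 trmxZ At.
have -> : (1%:M - s *: A) *m res S e *m (1%:M - s *: A) =
   res S e - (2 * s) *: 1%:M + s ^+ 2 *: A.
  rewrite mulmxBl mul1mx -scalemxAl (resKr psd e0) mulmxBr mulmx1 -scalemxAr mulmxBl.
  rewrite (resKl psd e0) -scalemxAl mul1mx scalerBr scalerA -expr2.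
  by rewrite mulrDl mul1r scalerDl !opprD !addrA opprK addrAC.
rewrite mxtraceD raddfB /= !mxtraceZ mxtrace1 /A mxtraceD mxtrace_scalar.
rewrite -[e *+ n]mulr_natr.
have : s ^+ 2 * (\tr S + e * n%:R) <= s * n%:R.
  rewrite expr2 -mulrA ler_pM2l ?invr_gt0 // mulrC /s ler_pdivrMr //; nra.
rewrite -[2 * s * _]mulrA -/s [n%:R * s]mulrC.
move: (s * n%:R) (s ^+ 2 * _) (\tr (res S e)) => q X Y; lra.
Qed.

Lemma trace_gram_res e : \tr (S *m res S e) = \sum_a (x *m res S e *m x^T) a a.
Proof.
transitivity (\tr (x *m res S e *m x^T)) => //.
by rewrite [RHS]mxtrace_mulC mulmxA -gramE.
Qed.

Lemma trace_gram_res_le e : 0 < e -> \tr (S *m res S e) <= m%:R.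
Proof.
move=> e0; rewrite trace_gram_res -[leRHS](_ : \sum_(a < m) 1 = _); last first.
  by rewrite sumr_const card_ord.
apply: ler_sum => a _; have [t0 ->] := leave_one_out x a e0.
by rewrite gerBl invr_ge0 addr_ge0.
Qed.

Lemma trace_zero_row a : \tr (gram (zero_row x a)) <= \tr S.
Proof.
rewrite [in leRHS](gram_zero_row x a) linearD /= lerDl.
by have := fro_ge0 (row a x); rewrite fro_trace.
Qed.

End traces.

(** * Typical behaviour of the design and of the noise *)

Section model.
Context {R : realType} (B K : R) (m n : nat) (Sigma : 'M[R]_n) (sigma : R).
Context {d : measure_display} {T : measurableType d} (P : probability T R).
Context (Z : 'I_m -> 'I_n -> {RV P >-> R}) (xi0 : 'I_m -> {RV P >-> R}).
Hypothesis B0 : 0 < B.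
Hypothesis model : ridge_model B K Sigma sigma Z xi0.
Hypotheses (mK : m%:R <= K * n%:R :> R) (sK : sigma ^+ 2 <= K).

Local Notation x w := (design Sigma (random_matrix Z w)).
Local Notation S w := (gram (x w)).

Definition scaled_noise (w : T) : 'cV[R]_m := Num.sqrt (n%:R^-1) *: noise sigma xi0 w.
Local Notation a w := (scaled_noise w).

Definition entry (p : 'I_m * 'I_n) : T -> R := Z p.1 p.2.
Definition noise_entry (i : 'I_m) : T -> R := fun w => noise sigma xi0 w i 0.

Definition Zsys (J : {set 'I_m * 'I_n}) : set (set T) := subfam entry J.
Definition Zall := Zsys [set: 'I_m * 'I_n].

Let n0 := rm_n_gt0 model.
Let m0 := rm_m_gt0 model.
Let nR : 0 < (n%:R : R). Proof. by rewrite ltr0n. Qed.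
Let mR : 0 < (m%:R : R). Proof. by rewrite ltr0n. Qed.
Let K1 : 1 <= K. Proof. exact: covariance_ge1 (rm_Sigma_unit model) (rm_Sigma_bound model). Qed.
Let K0 : 0 < K. Proof. exact: lt_le_trans K1. Qed.
Let sqn : Num.sqrt (n%:R^-1) ^+ 2 = n%:R^-1 :> R.
Proof. by rewrite sqr_sqrtr // invr_ge0 ltW. Qed.

Definition c4 : R := 8 * (B + 1) ^+ 4.

Let c41 : 1 <= c4.
Proof.
have : 1 <= (B + 1) ^+ 4 by rewrite exprn_ege1 // lerDr ltW.
by rewrite /c4; lra.
Qed.

Let c40 : 0 <= c4. Proof. exact: le_trans c41. Qed.

Let mentry p : measurable_fun setT (entry p). Proof. by rewrite /entry. Qed.
Let mnoise i : measurable_fun setT (noise_entry i).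
Proof.
rewrite /noise_entry; under eq_fun do rewrite mxE.
by apply: measurable_funM => //; exact: measurable_cst.
Qed.

Let Zm p := standard_subgaussian_moments B0 (rm_Z_subgaussian model p.1 p.2).
Let xm i := standard_subgaussian_moments B0 (rm_xi0_subgaussian model i).

Lemma Zsys_measurable J : Zsys J `<=` measurable.
Proof. exact: subfam_measurable. Qed.

Lemma mxmeas_sub p q (G : set (set T)) (F : T -> 'M[R]_(p, q)) : G `<=` measurable ->
  @mxmeas R _ (g_sigma_algebraType G) p q F -> mxmeas F.
Proof.
move=> Gm mF i j _ A mA; have := mF i j measurableT A mA.
exact: (sub_g_sigma_algebra Gm).
Qed.

Lemma mxmeas_design : @mxmeas R _ (g_sigma_algebraType Zall) m n (fun w => x w).
Proof.
apply: mxmeasZ; apply: mxmeasM; last exact: mxmeas_cst.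
move=> i j; under eq_fun do rewrite mxE.
by apply: (@subfam_fun _ _ _ _ entry _ (i, j)); rewrite inE.
Qed.

Lemma mxmeas_noise : mxmeas (fun w => a w).
Proof.
apply: mxmeasZ => i j; rewrite ord1; exact: mnoise.
Qed.

Let Zall_noise : indep_systems P <<s Zall>> <<s subfam noise_entry [set: 'I_m]>>.
Proof.
have setTE (I : finType) : [set: I] = [set` [set: I]%SET].
  by apply/seteqP; split => i //= _; rewrite inE.
move=> E F GE GF; apply: (rm_Z_xi_indep model); rewrite /sigma_of setTE; [exact: GE|exact: GF].
Qed.

Let noise_indep : mutually_independent P noise_entry.
Proof.
have -> : noise_entry = (fun i w => sigma * xi0 i w).
  by apply/funext => i; apply/funext => w; rewrite /noise_entry mxE.
exact: mutually_independent_scale (rm_xi0_indep model).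
Qed.

Let noiseE i : noise_entry i = (fun w => sigma * xi0 i w).
Proof. by apply/funext => w; rewrite /noise_entry mxE. Qed.

Definition noise_rate : R := 8 * (K ^+ 2 * c4) * K.

(** The noise is independent of the design, so that [Q] can be frozen. The rates
    are those of a second moment bound: [Q] has squared Frobenius norm [O(n)]. *)
Lemma noise_quad (Q : T -> 'M[R]_m) (be e : R) : 0 <= be -> 0 < e ->
  @mxmeas R _ (g_sigma_algebraType Zall) m m Q -> (forall w, bnd (Q w) be) ->
  negl P [set w | e <= `|dot (a w) (Q w *m a w) - sigma ^+ 2 * (\tr (Q w) / n%:R)|]
    (noise_rate * be ^+ 2 / e ^+ 2 / n%:R).
Proof.
move=> be0 e0 mQ Qb.
pose q i j w := n%:R^-1 * Q w i j.
have mq i j : measurable_fun [set: g_sigma_algebraType Zall] (q i j).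
  by apply: measurable_funM; [exact: measurable_cst|exact: mQ].
pose F := be ^+ 2 * m%:R / n%:R ^+ 2.
have qF w : \sum_i \sum_j q i j w ^+ 2 <= F.
  have -> : \sum_i \sum_j q i j w ^+ 2 = fro (Q w) / n%:R ^+ 2.
    rewrite /fro mulr_suml; apply: eq_bigr => i _; rewrite mulr_suml.
    by apply: eq_bigr => j _; rewrite /q exprMn exprVn mulrC.
  by rewrite ler_wpM2r ?invr_ge0 ?sqr_ge0 //; exact: fro_bnd.
have L4n i : L4 P (noise_entry i).
  rewrite noiseE; have [[mX IX] _ _ _] := xm i; split.
    by apply: measurable_funM => //; exact: measurable_cst.
  have := intgZ (sigma ^+ 4) IX; apply: eq_integrable => // w _ /=.
  by rewrite exprMn.
have En i : Rintegral P setT (noise_entry i) = 0.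
  rewrite noiseE; have [L X0 _ _] := xm i.
  by rewrite RintegralZl ?X0 ?mulr0 //; exact: L4_intg.
have Vn i : Rintegral P setT (fun w => noise_entry i w * noise_entry i w) = sigma ^+ 2.
  rewrite noiseE; have [L _ X2 _] := xm i.
  under eq_Rintegral do rewrite mulrACA -expr2.
  by rewrite RintegralZl ?X2 ?mulr1 //; exact: L4_mul2.
have s2 : sigma ^+ 2 ^+ 2 <= K ^+ 2 by rewrite ler_pXn2r ?nnegrE ?sqr_ge0 // ltW.
have Fn i : Rintegral P setT (fun w => noise_entry i w ^+ 4) <= K ^+ 2 * c4.
  rewrite noiseE; have [[_ I4] _ _ X4] := xm i.
  under eq_Rintegral do rewrite exprMn.
  rewrite RintegralZl //; apply: ler_pM => //.
  - by rewrite exprn_even_ge0.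
  - by apply: Rintegral_ge0 => // w _; rewrite exprn_even_ge0.
  - by rewrite -exprM in s2.
have vc : (sigma ^+ 2) ^+ 2 <= K ^+ 2 * c4.
  by apply: le_trans s2 _; rewrite ler_peMr // sqr_ge0.
have [mZ PZ] := quadratic_form_chebyshev L4n noise_indep En Vn Fn vc
  (@Zsys_measurable _) Zall_noise mq qF e0.
apply: (@negl_le _ _ _ P _ (8 * (K ^+ 2 * c4) * F / e ^+ 2)).
  rewrite /noise_rate /F.
  have -> : 8 * (K ^+ 2 * c4) * (be ^+ 2 * m%:R / n%:R ^+ 2) / e ^+ 2 =
    8 * (K ^+ 2 * c4) * (be ^+ 2 / e ^+ 2 / n%:R) * (m%:R / n%:R).
    by field; rewrite !gt_eqF.
  have -> : 8 * (K ^+ 2 * c4) * K * be ^+ 2 / e ^+ 2 / n%:R =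
    8 * (K ^+ 2 * c4) * (be ^+ 2 / e ^+ 2 / n%:R) * K by field; rewrite !gt_eqF.
  apply: ler_wpM2l; last by rewrite ler_pdivrMr.
  apply: mulr_ge0; first by apply: mulr_ge0 => //; apply: mulr_ge0 => //; exact: sqr_ge0.
  by rewrite !divr_ge0 ?sqr_ge0 ?(ltW nR).
eexists; split; [|exact: PZ|].
  by apply: measurable_set_le; [exact: measurable_cst|exact: measurableT_comp].
move=> w /=; set l := (X in _ <= `|X|); set r := (X in _ -> is_true (_ <= `|X|)).
suff -> : l = r by [].
rewrite /l /r; congr (_ - _ * _); last first.
  by rewrite /q -mulr_sumr mulrC.
rewrite dotE; apply: eq_bigr => i _.
rewrite !mxE mulr_sumr; apply: eq_bigr => j _.
have -> : scaled_noise w j 0 = Num.sqrt (n%:R^-1) * noise_entry j w by rewrite mxE.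
have -> : sigma * xi0 i w = noise_entry i w by rewrite noiseE.
transitivity (Num.sqrt (n%:R^-1) ^+ 2 * (Q w i j * (noise_entry i w * noise_entry j w))); first by ring.
by rewrite sqn /q -mulrA.
Qed.

Lemma noise_norm : negl P [set w | ~ enorm (a w) <= K + 1] (noise_rate / n%:R).
Proof.
have h := @noise_quad (fun=> 1%:M) 1 1 ler01 ltr01 (@mxmeas_cst _ _ _ _ _ _) (fun=> @bnd1 _ _).
rewrite !expr1n !mulr1 divr1 in h; apply: negl_sub h => w /= aw.
rewrite leNgt; apply: contra_notN aw; rewrite mul1mx mxtrace1 => h.
rewrite -(@ler_pXn2r _ 2) ?nnegrE ?enorm_ge0 ?addr_ge0 ?(ltW K0) // enorm_sqr.
have := le_lt_trans (ler_norm _) h.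
have : sigma ^+ 2 * (m%:R / n%:R) <= K * K.
  by apply: ler_pM; rewrite ?sqr_ge0 ?divr_ge0 ?ler_pdivrMr // ltW.
by move=> h1 h2; rewrite expr2; move: h1 h2 K0; lra.
Qed.

(** A linear form of the noise is the square root of a quadratic form of rank
    one. *)
Lemma noise_cross (D : T -> 'M[R]_(m, n)) mu (be e : R) : 0 <= be -> 0 < e ->
  2 * K * be ^+ 2 / e ^+ 2 <= n%:R -> enorm mu <= 1 ->
  @mxmeas R _ (g_sigma_algebraType Zall) m n D -> (forall w, bnd (D w) be) ->
  negl P [set w | ~ `|dot (a w) (D w *m mu)| <= e]
    (noise_rate * be ^+ 4 * 4 / e ^+ 4 / n%:R).
Proof.
move=> be0 e0 nbig mu1 mD Db.
pose v w := D w *m mu; pose Q w := v w *m (v w)^T.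
have mQ : @mxmeas R _ (g_sigma_algebraType Zall) m m Q.
  by apply: mxmeasM; [|apply: mxmeas_tr]; apply: mxmeasM => //; exact: mxmeas_cst.
have vb w : enorm (v w) <= be.
  by apply: le_trans (Db w _) _; rewrite ler_piMr.
have QE w u : Q w *m u = dot (v w) u *: v w.
  rewrite /Q -mulmxA [_^T *m u]mx11_scalar -[in RHS]/(dot (v w) u) mul_mx_scalar.
  by rewrite /dot.
have Qb w : bnd (Q w) (be ^+ 2).
  move=> u; rewrite QE enormZ; apply: (@le_trans _ _ (enorm (v w) * enorm u * enorm (v w))).
    by rewrite ler_wpM2r ?enorm_ge0 // dot_CS.
  rewrite mulrAC -expr2 ler_wpM2r ?enorm_ge0 // ler_pXn2r ?nnegrE ?enorm_ge0 //.
have trQ w : \tr (Q w) <= be ^+ 2.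
  rewrite /Q mxtrace_mulC trace_mx11 -[X in X <= _]/(dot (v w) (v w)) -enorm_sqr.
  by rewrite ler_pXn2r ?nnegrE ?enorm_ge0.
have e2 : 0 < e ^+ 2 / 2 by rewrite divr_gt0 // exprn_gt0.
have := noise_quad (sqr_ge0 be) e2 mQ Qb.
have -> : noise_rate * be ^+ 2 ^+ 2 / (e ^+ 2 / 2) ^+ 2 / n%:R =
    noise_rate * be ^+ 4 * 4 / e ^+ 4 / n%:R by field; rewrite !gt_eqF.
apply: negl_sub => w /= aw; rewrite leNgt; apply: contra_notN aw => h.
rewrite leNgt; apply/negP => he.
have : dot (a w) (Q w *m a w) = dot (a w) (D w *m mu) ^+ 2.
  by rewrite QE dotZr (dotC (v w)) expr2.
have : e ^+ 2 < dot (a w) (D w *m mu) ^+ 2.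
  by rewrite -(real_normK (num_real (dot _ _))) ltr_pXn2r ?nnegrE ?normr_ge0 // ltW.
have : sigma ^+ 2 * (\tr (Q w) / n%:R) <= e ^+ 2 / 2.
  have : sigma ^+ 2 * \tr (Q w) <= K * be ^+ 2.
    apply: (@le_trans _ _ (sigma ^+ 2 * be ^+ 2)); first by rewrite ler_wpM2l ?sqr_ge0.
    by rewrite ler_wpM2r ?sqr_ge0.
  rewrite mulrA ler_pdivrMr // => h1; apply: le_trans h1 _.
  move: nbig; rewrite ler_pdivrMr ?exprn_gt0 //; lra.
have := le_lt_trans (ler_norm _) h; lra.
Qed.

Definition zrow (i : 'I_m) (w : T) : 'cV[R]_n := (row i (random_matrix Z w))^T.
Definition other_rows (i : 'I_m) : {set 'I_m * 'I_n} := [set p | p.1 != i]%SET.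
Definition row_rate : R := 8 * c4.

Let entry_indep : mutually_independent P entry := rm_Z_indep model.

Let row_indep i : mutually_independent P (fun j => Z i j : T -> R).
Proof.
move=> J A mA; have := entry_indep [set (i, j) | j in J]%SET (fun p : 'I_m * 'I_n => mA p.2).
rewrite big_imset /=; last by move=> j k _ _ [].
move=> <-; congr (P _); apply/seteqP; split => w /= h.
  by move=> p /imsetP[j jJ ->]; exact: h.
by move=> j jJ; apply: (h (i, j)); apply/imsetP; exists j.
Qed.

(** The rows are independent, so that [Q], which does not see row [i], can be
    frozen. *)
Lemma row_quad i (Q : T -> 'M[R]_n) (be e : R) : 0 <= be -> 0 < e ->
  @mxmeas R _ (g_sigma_algebraType (Zsys (other_rows i))) n n Q -> (forall w, bnd (Q w) be) ->
  negl P [set w | e * n%:R <= `|dot (zrow i w) (Q w *m zrow i w) - \tr (Q w)|]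
    (row_rate * be ^+ 2 / e ^+ 2 / n%:R).
Proof.
move=> be0 e0 mQ Qb.
have en0 : 0 < e * n%:R by rewrite mulr_gt0.
have qF w : \sum_j \sum_k Q w j k ^+ 2 <= be ^+ 2 * n%:R by exact: fro_bnd.
have ind : indep_systems P <<s Zsys (other_rows i)>> <<s subfam (fun j => Z i j : T -> R) [set: 'I_n]>>.
  have := subfam_indep mentry (J1 := other_rows i) (J2 := [set p | p.1 == i]%SET) entry_indep.
  move=> /(_ _) h; have {}h : indep_systems P <<s subfam entry (other_rows i)>> <<s subfam entry [set p | p.1 == i]%SET>>.
    by apply: h => p; rewrite !inE => /negbTE ->.
  move=> E F GE GF; apply: h GE _; move: F GF; apply: smallest_sub; first exact: smallest_sigma_algebra.
  move=> _ [j _ [A mA <-]]; apply: sub_sigma_algebra.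
  by exists (i, j); [rewrite /= inE eqxx|exists A].
have [mZ PZ] := quadratic_form_chebyshev (fun j => (let: And4 a _ _ _ := Zm (i, j) in a))
  (row_indep i) (fun j => (let: And4 _ a _ _ := Zm (i, j) in a))
  (fun j => (let: And4 _ _ a _ := Zm (i, j) in a)) (fun j => (let: And4 _ _ _ a := Zm (i, j) in a))
  (eq_ind_r (fun z => z <= c4) c41 (expr1n _ 2)) (@Zsys_measurable _) ind mQ qF en0.
apply: (@negl_le _ _ _ P _ (8 * (8 * (B + 1) ^+ 4) * (be ^+ 2 * n%:R) / (e * n%:R) ^+ 2)).
  rewrite le_eqVlt /row_rate /c4; apply/orP; left; apply/eqP.
  by field; rewrite !gt_eqF.
eexists; split; [|exact: PZ|].
  by apply: measurable_set_le; [exact: measurable_cst|exact: measurableT_comp].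
move=> w /=; set l := (X in _ <= `|X|); set r := (X in _ -> is_true (_ <= `|X|)).
suff -> : l = r by [].
rewrite /l /r mul1r; congr (_ - _).
rewrite dotE; apply: eq_bigr => j _; rewrite [zrow _ _ _ _]mxE !mxE mulr_sumr.
by apply: eq_bigr => k _; rewrite !mxE mulrCA.
Qed.

(** The trace of [S] is a quadratic form in all the entries of the design, with a
    deterministic block diagonal matrix. *)
Lemma trace_design : negl P [set w | ~ \tr (S w) <= (K ^+ 2 + 1) * n%:R]
  (8 * c4 * K ^+ 3 / n%:R).
Proof.
pose q (p r : 'I_m * 'I_n) (w : T) := n%:R^-1 * ((p.1 == r.1)%:R * Sigma p.2 r.2).
have SK := covariance_bnd (rm_Sigma_bound model).
have qF w : \sum_p \sum_r q p r w ^+ 2 <= K ^+ 3.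
  have -> : \sum_p \sum_r q p r w ^+ 2 = m%:R * fro Sigma / n%:R ^+ 2.
    rewrite -(pair_bigA _ (fun i j => \sum_r q (i, j) r w ^+ 2)) /=.
    rewrite -[m in m%:R]card_ord -sumr_const !mulr_suml; apply: eq_bigr => i _.
    rewrite mul1r /fro mulr_suml; apply: eq_bigr => j _.
    rewrite -(pair_bigA _ (fun k l => q (i, j) (k, l) w ^+ 2)) /= (bigD1 i) //=.
    rewrite [X in _ + X]big1 ?addr0 => [|k ki]; last first.
      by rewrite big1 // => l _; rewrite /q /= eq_sym (negbTE ki) mul0r mulr0 expr0n.
    rewrite mulr_suml; apply: eq_bigr => l _.
    by rewrite /q /= eqxx mul1r exprMn exprVn mulrC.
  have fS : fro Sigma <= K ^+ 2 * n%:R by apply: fro_bnd => //; exact: ltW.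
  rewrite ler_pdivrMr ?exprn_gt0 //.
  apply: (@le_trans _ _ (K * n%:R * (K ^+ 2 * n%:R))).
    by apply: ler_pM => //; rewrite fro_ge0.
  by rewrite le_eqVlt; apply/orP; left; apply/eqP; ring.
have ind : indep_systems P <<s subfam noise_entry [set: 'I_m]>> <<s subfam entry [set: 'I_m * 'I_n]>>.
  exact: indep_systemsC.
have mq p r : measurable_fun [set: g_sigma_algebraType (subfam noise_entry [set: 'I_m])] (q p r).
  exact: measurable_cst.
have [mZ PZ] := quadratic_form_chebyshev (fun p => (let: And4 a _ _ _ := Zm p in a))
  entry_indep (fun p => (let: And4 _ a _ _ := Zm p in a))
  (fun p => (let: And4 _ _ a _ := Zm p in a)) (fun p => (let: And4 _ _ _ a := Zm p in a))
  (eq_ind_r (fun z => z <= c4) c41 (expr1n _ 2)) (@subfam_measurable _ _ _ _ noise_entry mnoise _) ind mq qF nR.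
apply: (@negl_le _ _ _ P _ (8 * (8 * (B + 1) ^+ 4) * K ^+ 3 / n%:R ^+ 2)).
  rewrite -/c4; apply: ler_wpM2l.
    by apply: mulr_ge0; [exact: mulr_ge0|rewrite exprn_ge0 // ltW].
  rewrite lef_pV2 ?posrE ?exprn_gt0 // expr2 ler_peMl ?(ltW nR) //.
  by rewrite ler1n.
eexists; split; [|exact: PZ|].
  by apply: measurable_set_le; [exact: measurable_cst|exact: measurableT_comp].
move=> w /= hS; rewrite leNgt; apply: contra_notN hS => h.
have trE : \tr (S w) = \sum_p \sum_r q p r w * (Z p.1 p.2 w * Z r.1 r.2 w).
  rewrite gram_trace.
  have [[Ht _] HH] := sqrtmxP (rm_Sigma_psd model).
  set H := sqrtmx Sigma in Ht HH; set z := random_matrix Z w.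
  have -> : fro (x w) = n%:R^-1 * \tr (z *m Sigma *m z^T).
    rewrite /design -fro_tr fro_trace trmxK trmxZ -scalemxAl -scalemxAr scalerA -expr2 sqn.
    by rewrite mxtraceZ trmx_mul Ht -/H -HH !mulmxA.
  rewrite -(pair_bigA _ (fun i j => \sum_r q (i, j) r w * (Z i j w * Z r.1 r.2 w))) /=.
  rewrite mulr_sumr; apply: eq_bigr => i _.
  rewrite mxE mulr_sumr [LHS](eq_bigr (fun l => \sum_j n%:R^-1 * (z i j * Sigma j l * z i l))); last first.
    by move=> l _; rewrite mxE [z^T _ _]mxE mulr_suml mulr_sumr.
  rewrite [LHS]exchange_big; apply: eq_bigr => j _ /=.
  rewrite -(pair_bigA _ (fun k l => q (i, j) (k, l) w * (Z i j w * Z k l w))) /= (bigD1 i) //=.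
  rewrite [X in _ + X]big1 ?addr0 => [|k ki]; last first.
    by rewrite big1 // => l _; rewrite /q /= eq_sym (negbTE ki) mul0r mulr0 mul0r.
  by apply: eq_bigr => l _; rewrite /q /= eqxx mul1r /z !mxE; ring.
have qd : 1 * (\sum_p q p p w) <= K ^+ 2 * n%:R.
  have -> : \sum_p q p p w = m%:R / n%:R * \tr Sigma.
    rewrite -(pair_bigA _ (fun i j => q (i, j) (i, j) w)) /=.
    rewrite -[m in m%:R]card_ord -sumr_const !mulr_suml; apply: eq_bigr => i _.
    rewrite mul1r /mxtrace mulr_sumr; apply: eq_bigr => j _.
    by rewrite /q /= eqxx mul1r.
  have tS : \tr Sigma <= K * n%:R.
    exact: le_trans (ler_norm _) (trace_bnd (ltW K0) SK).
  rewrite mul1r expr2 -(mulrA K); apply: (@le_trans _ _ (m%:R / n%:R * (K * n%:R))).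
    by rewrite ler_wpM2l // divr_ge0 // ltW.
  by rewrite ler_wpM2r ?ler_pdivrMr // mulr_ge0 // ltW.
have := le_lt_trans (ler_norm _) h.
rewrite trE mulrDl mul1r /=; move: qd; rewrite /entry; lra.
Qed.

Let bH : bnd (sqrtmx Sigma) K.
Proof.
move=> v; rewrite -(@ler_pXn2r _ 2) ?nnegrE ?mulr_ge0 ?enorm_ge0 ?(ltW K0) //.
rewrite -(form_sqrtmx (rm_Sigma_psd model)) exprMn.
have h := bnd_dot v v (covariance_bnd (rm_Sigma_bound model)).
apply: le_trans (ler_norm _) _; apply: le_trans h _; rewrite -expr2 ler_wpM2r ?sqr_ge0 //.
by rewrite expr2 ler_peMl // ltW.
Qed.

Definition row_form (i : 'I_m) e w : 'M[R]_n :=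
  sqrtmx Sigma *m res (gram (zero_row (x w) i)) e *m sqrtmx Sigma.

(** Rows whose form with the leave-one-out resolvent deviates from its mean. *)
Definition bad_rows e eps w : {set 'I_m} :=
  [set i | eps * n%:R <= `|dot (zrow i w) (row_form i e w *m zrow i w) - \tr (row_form i e w)|]%SET.

(** A single row is bad with probability [O(1/n)], so that by the Markov inequality
    for their number a positive proportion of bad rows has the same rate. *)
Lemma few_bad_rows e eps g : 0 < e -> 0 < eps -> 0 < g ->
  negl P [set w | g * n%:R <= #|bad_rows e eps w|%:R]
    (row_rate * K ^+ 5 / (e ^+ 2 * eps ^+ 2 * g) / n%:R).
Proof.
move=> e0 eps0 g0; have [[Ht _] _] := sqrtmxP (rm_Sigma_psd model).
have K2e : 0 <= K ^+ 2 / e by rewrite divr_ge0 ?sqr_ge0 // ltW.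
have fb i w : bnd (row_form i e w) (K ^+ 2 / e).
  have -> : K ^+ 2 / e = K * e^-1 * K by rewrite mulrAC.
  have rb := res_bnd (gram_psd (zero_row (x w) i)) e0.
  by apply: bnd_mul (bnd_mul (ltW K0) bH rb) bH; rewrite divr_ge0 // ltW.
have mf i : @mxmeas R _ (g_sigma_algebraType (Zsys (other_rows i))) n n (row_form i e).
  apply: mxmeasM; last exact: mxmeas_cst.
  apply: mxmeasM; first exact: mxmeas_cst.
  apply: mxmeas_res => // k j; under eq_fun do rewrite mxE.
  have [ki|ki] := eqVneq k i; first exact: measurable_cst.
  rewrite /design; under eq_fun do rewrite mxE.
  apply: measurable_funM; first exact: measurable_cst.
  under eq_fun do rewrite mxE.
  apply: measurable_sum => l; apply: measurable_funM; last exact: measurable_cst.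
  under eq_fun do rewrite mxE.
  by apply: (@subfam_fun _ _ _ _ entry _ (k, l)); rewrite inE.
have gn0 : 0 < g * n%:R by rewrite mulr_gt0.
have := negl_count gn0 (fun i => row_quad K2e eps0 (mf i) (fb i)).
move=> h; apply: negl_le (negl_sub _ h); last first.
  move=> w /= hw; exists (bad_rows e eps w) => // i; by rewrite inE.
have -> : m%:R * (row_rate * (K ^+ 2 / e) ^+ 2 / eps ^+ 2 / n%:R) / (g * n%:R) =
    (row_rate * K ^+ 4 / (e ^+ 2 * eps ^+ 2 * g) / n%:R) * (m%:R / n%:R).
  by field; rewrite !gt_eqF.
have -> : row_rate * K ^+ 5 / (e ^+ 2 * eps ^+ 2 * g) / n%:R =
    (row_rate * K ^+ 4 / (e ^+ 2 * eps ^+ 2 * g) / n%:R) * K.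
  by field; rewrite !gt_eqF.
apply: ler_wpM2l; last by rewrite ler_pdivrMr.
apply: divr_ge0; last exact: ltW.
apply: divr_ge0; last by rewrite !mulr_ge0 ?sqr_ge0 // ltW.
by apply: mulr_ge0; [exact: mulr_ge0|rewrite exprn_ge0 // ltW].
Qed.

(** Sherman-Morrison gives the diagonal of [X R X^T] through forms of a row and
    of a resolvent that is independent of it. *)
Lemma diagonal_good_row e eps t w i : 0 < e -> 0 < eps -> i \notin bad_rows e eps w ->
  t <= \tr (res (gram (zero_row (x w) i)) e) / (K * n%:R) - eps -> 0 <= t ->
  1 - (1 + t)^-1 <= (x w *m res (S w) e *m (x w)^T) i i.
Proof.
move=> e0 eps0; rewrite inE -ltNge => good tle t0.
have [[Ht _] HH] := sqrtmxP (rm_Sigma_psd model).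
have [_ ->] := leave_one_out (x w) i e0; set l := (_ *m _ *m _) 0 0.
suff tl : t <= l by rewrite lerB // lef_pV2 ?posrE ?ltr_pwDl // ?lerD2l // (le_trans t0).
apply: le_trans tle _.
have -> : l = dot (zrow i w) (row_form i e w *m zrow i w) / n%:R.
  rewrite /l /design linearZ /= row_mul trmxZ -!scalemxAl -scalemxAr scalerA -expr2 sqn.
  rewrite mxE mulrC; congr (_ / _); rewrite trmx_mul Ht /dot /zrow trmxK /row_form.
  by rewrite !mulmxA.
have := @trace_weight_res _ _ _ (zero_row (x w) i) _ _ _ e0 (covariance_form_ge n0
  (rm_Sigma_psd model) (rm_Sigma_unit model) (rm_Sigma_bound model)).
have -> : \tr (Sigma *m res (gram (zero_row (x w) i)) e) = \tr (row_form i e w).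
  by rewrite /row_form [RHS]mxtrace_mulC mulmxA HH.
set q := dot _ _ in good *; set r := \tr (row_form _ _ _) in good *; set s := \tr (res _ _).
move=> sr; rewrite ler_pdivlMr //.
have -> : (s / (K * n%:R) - eps) * n%:R = K^-1 * s - eps * n%:R.
  by field; rewrite !gt_eqF.
move: good; rewrite ltr_norml => /andP[h _]; lra.
Qed.

Definition low_eps L : R := K^-1 / (2 * (K ^+ 2 + 1 + L)).
Definition trace_low L : R := low_eps L / (2 * K * (1 + low_eps L)).
Definition trace_low_rate L : R :=
  8 * c4 * K ^+ 3 + row_rate * K ^+ 5 / (K ^- 2 * low_eps L ^+ 2 * (2 * K)^-1).

Lemma low_eps_gt0 L : 0 < L -> 0 < low_eps L.
Proof.
by move=> L0; rewrite /low_eps divr_gt0 ?invr_gt0 // mulr_gt0 // !addr_gt0 // exprn_gt0.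
Qed.

Lemma trace_low_gt0 L : 0 < L -> 0 < trace_low L.
Proof.
move=> L0; have e0 := low_eps_gt0 L0.
by rewrite /trace_low divr_gt0 // !mulr_gt0 // addr_gt0.
Qed.

Hypothesis mK' : n%:R <= K * m%:R :> R.

(** The trace of [S (S + z)^-1] is the sum over the rows of [1 - 1 / (1 + t)], with
    [t] at least of the order of the normalized trace of the leave-one-out
    resolvent, which is bounded below since [\tr S] is [O(n)]. *)
Lemma trace_resolvent_low z L : K^-1 <= z -> z <= L ->
  negl P [set w | ~ trace_low L * n%:R <= \tr (S w *m res (S w) z)]
    (trace_low_rate L / n%:R).
Proof.
move=> zK zL; have z0 : 0 < z by apply: lt_le_trans zK; rewrite invr_gt0.
have L0 : 0 < L by exact: lt_le_trans zL.
have eps0 := low_eps_gt0 L0; set eps := low_eps L in eps0.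
have g0 : 0 < (2 * K)^-1 by rewrite invr_gt0 mulr_gt0.
have h := neglU trace_design (few_bad_rows z0 eps0 g0).
apply: negl_le (negl_sub _ h).
  rewrite /trace_low_rate [leRHS]mulrDl; apply: lerD => //; rewrite ler_wpM2r ?invr_ge0 ?(ltW nR) //.
  apply: ler_wpM2l; first by apply: mulr_ge0; [exact: mulr_ge0|rewrite exprn_ge0 // ltW].
  have p1 : 0 < z ^+ 2 * eps ^+ 2 / (2 * K).
    by apply: mulr_gt0 => //; apply: mulr_gt0; exact: exprn_gt0.
  have p2 : 0 < K ^- 2 * eps ^+ 2 / (2 * K).
    by apply: mulr_gt0 => //; apply: mulr_gt0; [rewrite invr_gt0|]; exact: exprn_gt0.
  rewrite lef_pV2 //.
  apply: ler_wpM2r; first exact: ltW.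
  apply: ler_wpM2r; first exact: sqr_ge0.
  by rewrite -exprVn ler_pXn2r ?nnegrE ?invr_ge0 ?(ltW K0) ?(ltW z0).
move=> w /= hw; apply: contrapT => /not_orP[/contrapT ST few]; apply: hw.
move/negP: few; rewrite -ltNge => few; rewrite trace_gram_res.
set bad := bad_rows z eps w in few.
have diag i : i \notin bad -> eps / (1 + eps) <= (x w *m res (S w) z *m (x w)^T) i i.
  move=> ib; have -> : eps / (1 + eps) = 1 - (1 + eps)^-1.
    by field; rewrite gt_eqF // addr_gt0.
  apply: (diagonal_good_row z0 eps0 ib _ (ltW eps0)).
  have T0 : 0 < K ^+ 2 + 1 by rewrite addr_gt0 // exprn_gt0.
  have := trace_res_ge z0 T0 (le_trans (trace_zero_row (x w) i) ST).
  set s := \tr _ => hs; rewrite lerBrDr ler_pdivlMr ?mulr_gt0 //.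
  have Tz := addr_gt0 T0 z0.
  apply: le_trans hs; rewrite ler_pdivlMr // /eps /low_eps.
  have -> : (K^-1 / (2 * (K ^+ 2 + 1 + L)) + K^-1 / (2 * (K ^+ 2 + 1 + L))) * (K * n%:R) * (K ^+ 2 + 1 + z)
    = n%:R * ((K ^+ 2 + 1 + z) / (K ^+ 2 + 1 + L)).
    by field; rewrite !gt_eqF // !addr_gt0 // exprn_gt0.
  have TL := addr_gt0 T0 L0.
  by rewrite ler_piMr ?(ltW nR) // ler_pdivrMr // mul1r lerD2l.
apply: (@le_trans _ _ (\sum_(i | i \notin bad) (eps / (1 + eps)))); last first.
  rewrite [leRHS](bigID [pred i | i \in bad]) /= -[leLHS]add0r; apply: lerD; last exact: ler_sum.
  apply: sumr_ge0 => i _; have [t0 ->] := leave_one_out (x w) i z0.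
  by rewrite subr_ge0 invf_le1 ?lerDl // ltr_pwDl.
rewrite sumr_const -[leRHS]mulr_natl.
have card : #|(fun i : 'I_m => i \notin bad)|%:R = m%:R - #|bad|%:R :> R.
  rewrite -[in m%:R](card_ord m) -(cardC bad) natrD addrAC subrr add0r.
  by congr _%:R; apply: eq_card => i; rewrite !inE.
rewrite card /trace_low -/eps.
have -> : eps / (2 * K * (1 + eps)) * n%:R = n%:R / (2 * K) * (eps / (1 + eps)).
  by field; rewrite !gt_eqF // addr_gt0.
apply: ler_wpM2r; first by rewrite divr_ge0 ?addr_ge0 // ltW.
rewrite ler_pdivrMr ?mulr_gt0 //; rewrite mulrC ltr_pdivlMr ?mulr_gt0 // in few.
move: mK'; nra.
Qed.

Definition range_const gam : R := 2 * K ^+ 2 / gam + 1.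
Definition range_rate gam : R := row_rate * K ^+ 7 * 4 / gam ^+ 2.

(** Far from the interpolation threshold few eigenvalues on the row space are
    below [b]. *)
Lemma range_trace_high b gam : 0 < b -> 0 < gam -> gam * n%:R <= n%:R - m%:R ->
  negl P [set w | ~ b * \tr (rangeproj (x w) *m res (S w) b) <= range_const gam * b * n%:R]
    (range_rate gam / b / n%:R).
Proof.
move=> b0 gam0 gn; pose eps := gam / (2 * K * b).
have eps0 : 0 < eps by rewrite divr_gt0 // !mulr_gt0.
apply: negl_le (negl_sub _ (few_bad_rows b0 eps0 b0)).
  rewrite le_eqVlt; apply/orP; left; apply/eqP.
  by rewrite /range_rate /eps; field; rewrite !gt_eqF.
move=> w /= hw; rewrite leNgt; apply: contra_notN hw => few.
apply: le_trans (res_range_trace (x w) b0) _; rewrite trace_gram_res.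
set bad := bad_rows b eps w in few.
rewrite -[m in m%:R]card_ord -sumr_const -sumrB.
have diag i : i \notin bad -> 1 - (x w *m res (S w) b *m (x w)^T) i i <= b * (2 * K / gam).
  move=> ib; have := @diagonal_good_row b eps eps w i b0 eps0 ib _ (ltW eps0).
  have hs : eps <= \tr (res (gram (zero_row (x w) i)) b) / (K * n%:R) - eps.
    have psd := gram_psd (zero_row (x w) i).
    have := trace_gram_res_le (zero_row (x w) i) b0.
    rewrite (mul_resE psd b0) raddfB /= mxtrace1 mxtraceZ; set s := \tr _ => hs.
    rewrite lerBrDr ler_pdivlMr ?mulr_gt0 // /eps.
    have -> : (gam / (2 * K * b) + gam / (2 * K * b)) * (K * n%:R) = gam * n%:R / b.
      by field; rewrite !gt_eqF.
    by rewrite ler_pdivrMr // [s * b]mulrC; lra.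
  move=> /(_ hs) h; apply: (@le_trans _ _ (1 + eps)^-1); first lra.
  have -> : b * (2 * K / gam) = eps^-1 by rewrite /eps; field; rewrite !gt_eqF.
  by rewrite lef_pV2 ?posrE ?addr_gt0 // lerDr.
rewrite (bigID [pred i | i \in bad]) /= addrC.
have -> : range_const gam * b * n%:R = K * n%:R * (b * (2 * K / gam)) + b * n%:R.
  by rewrite /range_const; field; rewrite gt_eqF.
apply: lerD.
  apply: (@le_trans _ _ (\sum_(i < m | i \notin bad) (b * (2 * K / gam)))); first exact: ler_sum.
  rewrite sumr_const -[leLHS]mulr_natl; apply: ler_wpM2r.
    by rewrite !mulr_ge0 ?invr_ge0 // ltW.
  apply: le_trans mK; rewrite ler_nat -[leqRHS](card_ord m); exact: max_card.
apply: (@le_trans _ _ (\sum_(i < m | i \in bad) 1)).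
  apply: ler_sum => i _; have [t0 ->] := leave_one_out (x w) i b0.
  by rewrite opprB addrC subrK invf_le1 ?lerDl // ltr_pwDl.
by rewrite sumr_const ltW.
Qed.

End model.

(** * Typical signals *)

Section typical_signals.
Context {R : realType}.
Local Notation V n := (n.-tuple (measurableTypeR R)).

Lemma formZ n k (M : 'M[R]_n) u : form (k *: M) u = k * form M u.
Proof. by rewrite /form -scalemxAl dotZr. Qed.

Lemma measure_exists_le d (T : measurableType d) (mu : {measure set T -> \bar R})
    (I : finType) (E : I -> set T) (c : \bar R) :
  (forall i, measurable (E i)) -> (forall i, (mu (E i) <= c)%E) -> (0 <= c)%E ->
  measurable [set t | exists i, E i t] /\ (mu [set t | exists i, E i t] <= #|I|%:R%:E * c)%E.
Proof.
move=> mE Ec c0.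
have h (s : seq I) : measurable [set t | exists2 i, i \in s & E i t] /\
    (mu [set t | exists2 i, i \in s & E i t] <= (size s)%:R%:E * c)%E.
  elim: s => [|i s [IH1 IH2]].
    have -> : [set t | exists2 i, i \in [::] & E i t] = set0 by apply/seteqP; split => t // -[].
    by rewrite measure0 mul0e.
  have -> : [set t | exists2 j, j \in i :: s & E j t] = E i `|` [set t | exists2 j, j \in s & E j t].
    apply/seteqP; split => t /=.
      by move=> [j]; rewrite inE => /orP[/eqP-> ?|js Ej]; [left|right; exists j].
    by move=> [Ei|[j js Ej]]; [exists i; rewrite ?mem_head|exists j; rewrite // inE js orbT].
  split; first exact: measurableU.
  apply: le_trans (measureU2 _ _ _) _ => //.
  have -> : (size (i :: s))%:R%:E = (1%:E + (size s)%:R%:E :> \bar R)%E by rewrite -EFinD /= -nat1r.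
  by rewrite ge0_muleDl ?lee_fin //; apply: leeD; [rewrite mul1e; exact: Ec|exact: IH2].
have -> : [set t | exists i, E i t] = [set t | exists2 i, i \in index_enum I & E i t].
  apply/seteqP; split => t /=; last by move=> [i _ Ei]; exists i.
  by move=> [i Ei]; exists i => //; exact: mem_index_enum.
by have := h (index_enum I); rewrite cardT enumT.
Qed.

Lemma ball_finite' n : tmeas n (@ballT R n 1) \is a fin_num.
Proof. by rewrite ge0_fin_numE //; exact: ball_finite. Qed.

Context {d} {T : measurableType d} (P : probability T R).

(** Fubini's theorem: as for each outcome only few signals are atypical, for most
    signals the outcomes for which they are atypical are improbable. *)
Lemma typical_signals (I : finType) n (F : I -> T -> 'M[R]_n) (be tau p : R) :
  (forall i, mxmeas (F i)) -> 0 < be -> (forall i w, bnd (F i w) be) ->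
  0 < tau <= 1 -> 32 * 256 ^+ 2 <= n%:R * tau ^+ 4 -> 0 < p ->
  exists N : set (V n), [/\ measurable N, N `<=` @ballT R n 1,
    (tmeas n N <= (4 * #|I|%:R * expR (- (n%:R * tau ^+ 2 / 64)) / p)%:E * tmeas n (@ballT R n 1))%E &
    forall t, @ballT R n 1 t -> ~ N t -> let mu := coords t in
      negl P [set w | exists i, ~ `|dot mu (F i w *m mu) - dot mu mu * (\tr (F i w) / n%:R)| <= be * tau] p].
Proof.
move=> mF be0 Fb tau01 ntau p0; have /andP[tau0 tau1] := tau01.
pose G i w : 'M[R]_n := (2 * be)^-1 *: (F i w + (F i w)^T).
have Gsym i w : (G i w)^T = G i w by rewrite /G trmxZ linearD /= trmxK addrC.
have Gb i w : bnd (G i w) 1.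
  have h := bnd_scale (2 * be)^-1 (bnd_add (Fb i w) (bnd_tr (ltW be0) (Fb i w))).
  apply: bnd_le h _; rewrite gtr0_norm ?invr_gt0 ?mulr_gt0 //.
  by rewrite mulrC ler_pdivrMr ?mulr_gt0 // mul1r; lra.
have formG i w u : form (G i w) u = be^-1 * form (F i w) u.
  rewrite /form /G -scalemxAl dotZr mulmxDl dotDr -[dot u ((F i w)^T *m u)]dot_mull dotC.
  by field; rewrite gt_eqF.
have trG i w : \tr (G i w) = be^-1 * \tr (F i w).
  by rewrite /G mxtraceZ mxtraceD mxtrace_tr; field; rewrite gt_eqF.
have mG i : mxmeas (G i) by apply: mxmeasZ; apply: mxmeasD => //; exact: mxmeas_tr.
clearbody G.
pose h i (z : V n * T) := form (G i z.2) (coords z.1) - norm2 z.1 * (\tr (G i z.2) / n%:R).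
have mc : measurable_fun setT (fun z : V n * T => norm2 z.1).
  exact: (measurableT_comp (@measurable_norm2 R n)).
have mh i : measurable_fun setT (h i).
  apply: measurable_funB.
    under eq_fun do rewrite formE.
    apply: measurable_sum => j; apply: measurable_sum => k; apply: measurable_funM.
      by apply: (measurableT_comp (mG i j k)); exact: measurable_snd.
    by apply: measurable_funM; apply: (measurableT_comp (measurable_coord _)); exact: measurable_fst.
  apply: measurable_funM => //; apply: measurable_funM; last exact: measurable_cst.
  by apply: (measurableT_comp (measurable_trace (mG i))); exact: measurable_snd.
pose A : set (V n * T) := [set z | norm2 z.1 <= 1] `&` [set z | exists i, tau <= `|h i z|].
have mA : measurable A.
  apply: measurableI; first by apply: measurable_set_le => //; exact: measurable_cst.
  have -> : [set z | exists i, tau <= `|h i z|] = \bigcup_(i in [set: I]) [set z | tau <= `|h i z|].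
    by apply/seteqP; split => z; [move=> [i hi]; exists i|move=> [i _ hi]; exists i].
  apply: fin_bigcup_measurable => // i _; apply: measurable_set_le; first exact: measurable_cst.
  exact: measurableT_comp.
set b := tmeas n (@ballT R n 1).
pose c := ((2 * expR (- (n%:R * tau ^+ 2 / 64)))%:E * b)%E.
have c0 : (0 <= c)%E by apply: mule_ge0; [rewrite lee_fin mulr_ge0 // expR_ge0|exact: measure_ge0].
have ysec w : (tmeas n (ysection A w) <= (4 * #|I|%:R * expR (- (n%:R * tau ^+ 2 / 64)))%:E * b)%E.
  pose E (i : I * bool) : set (V n) := [set t | (norm2 t <= 1 /\
    tau <= form ((-1) ^+ i.2 *: G i.1 w) (coords t) - norm2 t * (\tr ((-1) ^+ i.2 *: G i.1 w) / n%:R))%R].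
  have Eb i : (tmeas n (E i) <= c)%E.
    apply: ball_quadratic_form => //; first by rewrite trmxZ Gsym.
    by have := bnd_scale ((-1) ^+ i.2) (Gb i.1 w); rewrite normrX normrN1 expr1n mul1r.
  have mE i : measurable (E i).
    apply: measurableI; first by apply: measurable_set_le; [exact: measurable_norm2|exact: measurable_cst].
    apply: measurable_set_le; first exact: measurable_cst.
    apply: measurable_funB; first exact: measurable_form.
    by apply: measurable_funM; [exact: measurable_norm2|exact: measurable_cst].
  have [mU leU] := measure_exists_le mE Eb c0.
  apply: (@le_trans _ _ (tmeas n [set t | exists i, E i t])).
    apply: le_measure; rewrite ?inE //; first exact: measurable_ysection.
    move=> t; rewrite /ysection /= inE => -[/= t1 [i hi]].
    have hs s : (-1) ^+ s * h i (t, w) = form ((-1) ^+ s *: G i w) (coords t) -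
        norm2 t * (\tr ((-1) ^+ s *: G i w) / n%:R).
      by rewrite /h /= mxtraceZ formZ; ring.
    have [hp|hn] := leP 0 (h i (t, w)).
      by exists (i, false); split => //=; rewrite -hs expr0 mul1r -(ger0_norm hp).
    by exists (i, true); split => //=; rewrite -hs expr1 mulN1r -(ltr0_norm hn).
  apply: le_trans leU _; rewrite card_prod card_bool natrM /c muleA -EFinM.
  apply: lee_wpmul2r; first exact: measure_ge0.
  by rewrite lee_fin le_eqVlt; apply/orP; left; apply/eqP; ring.
have fub := indic_fubini_tonelli (tmeas n) P mA.
rewrite indic_fubini_tonelli_FE // indic_fubini_tonelli_GE // in fub.
have mx : measurable_fun setT (P \o xsection A) by exact: measurable_fun_xsection.
pose N := [set t | (p%:E <= P (xsection A t))%E].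
have mN : measurable N.
  rewrite -[N]setTI; apply: emeasurable_fun_c_infty => //.
exists N; split => //.
- move=> t; rewrite /N /ballT /= expr1n => Nt; rewrite leNgt; apply/negP => t1.
  move: Nt; rewrite (_ : xsection A t = set0) ?measure0 ?lee_fin ?leNgt ?p0 //.
  apply/seteqP; split => w //; rewrite /xsection /= inE => -[/= ]; by rewrite leNgt t1.
- have Nint : (p%:E * tmeas n N <= \int[tmeas n]_t P (xsection A t))%E.
    rewrite -[X in tmeas n X]setIT -integral_indic // -ge0_integralZl_EFin //; last 2 first.
    + exact/measurable_EFinP/measurable_indic.
    + exact: ltW.
    apply: ge0_le_integral => //.
    + by move=> t _; rewrite -EFinM lee_fin mulr_ge0 ?(ltW p0).
    + by apply: measurable_funeM; exact/measurable_EFinP/measurable_indic.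
    move=> t _; rewrite indicE; have [|_] := boolP (t \in N).
      by rewrite inE mule1.
    by rewrite mule0.
  have up : (\int[tmeas n]_t P (xsection A t) <= (4 * #|I|%:R * expR (- (n%:R * tau ^+ 2 / 64)))%:E * b)%E.
    rewrite -[X in (X <= _)%E]/(\int[tmeas n]_t (P \o xsection A) t)%E fub.
    apply: (@le_trans _ _ (\int[P]_w ((4 * #|I|%:R * expR (- (n%:R * tau ^+ 2 / 64)))%:E * b))%E).
      apply: ge0_le_integral => //; first exact: measurable_fun_ysection.
      by move=> w _; exact: ysec.
    rewrite integral_cst // [X in (_ * X)%E](_ : _ = 1%E) ?mule1 //.
    exact: probability_setT.
  have := le_trans Nint up; rewrite /b -(fineK (ball_finite' n)) -!EFinM.
  rewrite -lee_pdivlMl // -EFinM => /le_trans; apply; rewrite lee_fin.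
  by rewrite le_eqVlt; apply/orP; left; apply/eqP; ring.
move=> t t1 Nt mu; exists (xsection A t); split.
- exact: measurable_xsection.
- by move/negP: Nt; rewrite -ltNge => /ltW.
move=> w /= [i /negP]; rewrite -ltNge => hi; rewrite /xsection /= inE; split => /=.
  by move: t1; rewrite /ballT /= expr1n.
exists i; rewrite /h /= formG trG.
have -> : be^-1 * form (F i w) (coords t) - norm2 t * (be^-1 * \tr (F i w) / n%:R) =
   be^-1 * (dot mu (F i w *m mu) - dot mu mu * (\tr (F i w) / n%:R)) by rewrite /form /norm2; ring.
by rewrite normrM gtr0_norm ?invr_gt0 // ler_pdivlMl // ltW.
Qed.

Definition tuple_of n (v : 'cV[R]_n) : V n := [tuple v i 0 | i < n].

Lemma coordsK n : cancel (@coords R n) (@tuple_of n).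
Proof. by move=> t; apply: eq_from_tnth => i; rewrite tnth_mktuple mxE. Qed.

Lemma ballTE n r : 0 <= r -> @ballT R n r = @col_of_tuple R n @^-1` eball n r.
Proof.
move=> r0; apply/seteqP; split => t; rewrite /ballT /eball /= /norm2 -enorm_sqr.
  by rewrite ler_pXn2r ?nnegrE ?enorm_ge0.
by move=> h; rewrite ler_pXn2r ?nnegrE ?enorm_ge0.
Qed.

(** Removing a set that is exponentially small relative to the ball. *)
Lemma typical_set n (N : set (V n)) (D : set 'cV[R]_n) (e : R) : measurable N ->
  (tmeas n N <= e%:E * tmeas n (@ballT R n 1))%E ->
  (0 < tmeas n (@ballT R n 1))%E ->
  borel_cV D -> D `<=` eball n 1 ->
  (tmeas n (@col_of_tuple R n @^-1` D) <= 2^-1%:E * tmeas n (@ballT R n 1))%E ->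
  let U := [set mu | (eball n 1 `\` D) mu /\ ~ N (tuple_of mu)] in
  [/\ borel_cV U, U `<=` eball n 1 `\` D &
      1 - 2 * e <= vol U / vol (eball n 1 `\` D)].
Proof.
move=> mN Ne b0 mD D1 D2 U.
have bE : @col_of_tuple R n @^-1` eball n 1 = @ballT R n 1 by rewrite ballTE.
have mb := @measurable_ballT R n 1.
set D' := @col_of_tuple R n @^-1` D in D2; rewrite /borel_cV -/D' in mD.
have shE : @col_of_tuple R n @^-1` (eball n 1 `\` D) = @ballT R n 1 `\` D'.
  by rewrite -bE.
have mS : measurable (@ballT R n 1 `\` D') by exact: measurableD.
have UE : @col_of_tuple R n @^-1` U = (@ballT R n 1 `\` D') `\` N.
  rewrite -shE; apply/seteqP; split => t [h1 h2]; split => //.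
    by rewrite -[t]coordsK.
  by rewrite -[col_of_tuple t]/(coords t) coordsK.
have mU : measurable (@col_of_tuple R n @^-1` U) by rewrite UE; exact: measurableD.
split => //; first by move=> v [].
rewrite /vol UE shE -!tmeasE //; last by exact: measurableD.
set b := tmeas n (@ballT R n 1) in Ne b0 D2 *.
have bf : b \is a fin_num := ball_finite' n.
have finS (E : set (V n)) : measurable E -> E `<=` @ballT R n 1 -> tmeas n E \is a fin_num.
  move=> mE Eb; rewrite ge0_fin_numE //; apply: le_lt_trans (ball_finite n).
  by apply: le_measure; rewrite ?inE.
have D'b : D' `<=` @ballT R n 1 by rewrite -bE => t; exact: D1.
have Df := finS _ mD D'b.
have SE : tmeas n (@ballT R n 1 `\` D') = (b - tmeas n D')%E.
  rewrite measureD //; last by rewrite -ge0_fin_numE.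
  by congr (_ - tmeas n _)%E; apply/setIidPr.
have Sb : @ballT R n 1 `\` D' `<=` @ballT R n 1 by move=> t [].
have Sf := finS _ mS Sb.
have mSN : measurable ((@ballT R n 1 `\` D') `&` N) by exact: measurableI.
have SNf : tmeas n ((@ballT R n 1 `\` D') `&` N) \is a fin_num.
  by apply: finS => // t [[]].
have -> : tmeas n ((@ballT R n 1 `\` D') `\` N) =
    (tmeas n (@ballT R n 1 `\` D') - tmeas n ((@ballT R n 1 `\` D') `&` N))%E.
  by rewrite measureD // -ge0_fin_numE.
have SNe : (tmeas n ((@ballT R n 1 `\` D') `&` N) <= e%:E * b)%E.
  by apply: le_trans Ne; apply: le_measure; rewrite ?inE.
rewrite fineB //; rewrite SE in Sf *.
have mge : (0 <= tmeas n ((@ballT R n 1 `\` D') `&` N))%E by exact: measure_ge0.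
move: mge SNe D2 b0 Sf SNf Df; rewrite -(fineK bf).
case: (tmeas n ((@ballT R n 1 `\` D') `&` N)) => // q; case: (tmeas n D') => // r.
rewrite -!EFinM !lee_fin lte_fin -EFinB /=.
set v := fine b => q0 qe rv v0 _ _ _.
have vr : 0 < v - r by lra.
rewrite ler_pdivlMr //.
have e0 : 0 <= e by rewrite -(pmulr_lge0 _ v0) (le_trans q0).
have : 0 <= e * (v - 2 * r) by rewrite mulr_ge0 //; lra.
lra.
Qed.

End typical_signals.

(** * The gap for typical signals *)

Section noisy.
Context {R : realType} (B K : R) (m n : nat) (Sigma : 'M[R]_n) (sigma : R).
Context {d : measure_display} {T : measurableType d} (P : probability T R).
Context (Z : 'I_m -> 'I_n -> {RV P >-> R}) (xi0 : 'I_m -> {RV P >-> R}).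
Hypothesis B0 : 0 < B.
Hypothesis model : ridge_model B K Sigma sigma Z xi0.
Hypotheses (mK : m%:R <= K * n%:R :> R) (mK' : n%:R <= K * m%:R :> R).
Hypotheses (sK : sigma ^+ 2 <= K) (sK' : K^-1 <= sigma ^+ 2).

Local Notation x w := (design Sigma (random_matrix Z w)).
Local Notation S w := (gram (x w)).
Local Notation a w := (scaled_noise n sigma xi0 w).
Local Notation Zmeas F := (@mxmeas R _ (g_sigma_algebraType (Zall Z)) _ _ F).

Let n0 := rm_n_gt0 model.
Let nR : 0 < (n%:R : R). Proof. by rewrite ltr0n. Qed.
Let K1 : 1 <= K. Proof. exact: covariance_ge1 (rm_Sigma_unit model) (rm_Sigma_bound model). Qed.
Let K0 : 0 < K. Proof. exact: lt_le_trans K1. Qed.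
Let SK := covariance_bnd (rm_Sigma_bound model).
Let St := (rm_Sigma_psd model).1.
Let Sk := covariance_form_ge n0 (rm_Sigma_psd model) (rm_Sigma_unit model) (rm_Sigma_bound model).

Lemma Zmeas_mxmeas p q (F : T -> 'M[R]_(p, q)) : Zmeas F -> mxmeas F.
Proof.
apply: mxmeas_sub; apply: Zsys_measurable.
Qed.

Lemma Zmeas_sandwich z (E : T -> 'M[R]_n) : 0 < z -> Zmeas E ->
  Zmeas (fun w => sandwich (x w) z (E w)).
Proof.
move=> z0 mE; apply: mxmeasM; first apply: mxmeasM => //.
  by apply: mxmeas_res => //; exact: mxmeas_design.
by apply: mxmeas_res => //; exact: mxmeas_design.
Qed.

Definition sandwich_rate (be ep : R) : R :=
  noise_rate B K * (K ^+ 2 * be) ^+ 2 / ep ^+ 2 +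
  2 * (noise_rate B K * (K ^+ 2 * be) ^+ 4 * 4 / ep ^+ 4).

Definition noise_typical z (E : 'M[R]_n) mu ep w : Prop :=
  [/\ `|dot (a w) (x w *m sandwich (x w) z E *m (x w)^T *m a w) -
        sigma ^+ 2 * (\tr (sandwich (x w) z E *m S w) / n%:R)| <= ep,
      `|dot (a w) (x w *m sandwich (x w) z E *m S w *m mu)| <= ep &
      `|dot (a w) (x w *m (sandwich (x w) z E)^T *m mu)| <= ep].

(** The three forms are frozen with respect to the noise: the first has mean
    [sigma ^ 2] times a trace, the two others are linear in the noise. *)
Lemma sandwich_events z (E : T -> 'M[R]_n) mu (be ep : R) : K^-1 <= z -> 0 <= be ->
  (forall w, bnd (E w) be) -> Zmeas E -> 0 < ep -> enorm mu <= 1 ->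
  2 * K * (K ^+ 2 * be) ^+ 2 / ep ^+ 2 <= n%:R ->
  negl P [set w | ~ noise_typical z (E w) mu ep w] (sandwich_rate be ep / n%:R).
Proof.
move=> zK be0 Eb mE ep0 mu1 nbig.
have z0 : 0 < z by apply: lt_le_trans zK; rewrite invr_gt0.
have mN := Zmeas_sandwich z0 mE.
have mx := mxmeas_design Sigma (Z := Z).
have mS : Zmeas (fun w => S w) by exact: mxmeas_gram.
have sb0 : 0 <= K ^+ 2 * be by rewrite mulr_ge0 ?sqr_ge0.
have h1 := noise_quad B0 model mK sK sb0 ep0 (mxmeasM (mxmeasM mx mN) (mxmeas_tr mx))
  (fun w => sandwich_noise_bnd (x w) K1 zK be0 (Eb w)).
have h2 := noise_cross B0 model mK sK sb0 ep0 nbig mu1 (mxmeasM (mxmeasM mx mN) mS)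
  (fun w => sandwich_cross_bnd (x w) K1 zK be0 (Eb w)).
have h3 := noise_cross B0 model mK sK sb0 ep0 nbig mu1 (mxmeasM mx (mxmeas_tr mN))
  (fun w => sandwich_cross_tr_bnd (x w) K1 zK be0 (Eb w)).
apply: negl_le (negl_sub _ (neglU h1 (neglU h2 h3))).
  rewrite /sandwich_rate; set X := _ / ep ^+ 2; set Y := _ / ep ^+ 4.
  by rewrite le_eqVlt; apply/orP; left; apply/eqP; ring.
move=> w /= nt; apply: contrapT => /not_orP[g1 /not_orP[/contrapT g2 /contrapT g3]].
apply: nt; split => //; move/negP: g1; rewrite -ltNge sandwich_trace.
exact: ltW.
Qed.

Context (k : risk_kind) (Bs : T -> 'M[R]_n) (L lo beta phi xb rr : R).
Hypotheses (KL : K <= L) (sBs : forall w, smoothing (x w) (Bs w) lo beta) (mBs : Zmeas Bs).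
Hypotheses (beta1 : 1 <= beta) (phi0 : 0 <= phi) (xb0 : 0 <= xb).
Hypothesis xbB : forall w, bnd (x w *m (1%:M - Bs w)) xb.
Hypothesis range_event :
  negl P [set w | ~ fro (rangeproj (x w) *m (1%:M - Bs w)) <= phi * n%:R] (rr / n%:R).
Context (ep rho tau p : R) (Ni Nj : nat).
Hypotheses (ep0 : 0 < ep) (rho0 : 0 < rho) (tau01 : 0 < tau <= 1) (p0 : 0 < p).

Let be : R := 4 * K ^+ 2 * beta.
Definition zeta (i : nat) : R := K^-1 + i%:R * rho.
Definition eta_grid (j : nat) : R := Num.max lo rho + j%:R * rho.

Hypothesis zeta_grid : forall e, K^-1 <= e <= L ->
  exists2 i, (i < Ni)%N & zeta i <= e <= zeta i + rho.
Hypothesis eta_gridP : forall e, 0 < e -> lo <= e -> e <= L ->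
  exists2 j, (j < Nj)%N & `|e - eta_grid j| <= rho.
Hypotheses (nbig : 2 * K * (K ^+ 2 * be) ^+ 2 / ep ^+ 2 <= n%:R)
  (ntau : 32 * 256 ^+ 2 <= n%:R * tau ^+ 4) (tau_ep : K ^+ 2 * be * tau <= ep).

Let be0 : 0 < be.
Proof. by rewrite /be !mulr_gt0 ?exprn_gt0 // (lt_le_trans _ beta1). Qed.

Let zetaK i : K^-1 <= zeta i.
Proof. by rewrite /zeta lerDl mulr_ge0 // ltW. Qed.

Let eta0 j : 0 < eta_grid j.
Proof.
rewrite /eta_grid ltr_pwDl ?mulr_ge0 ?(ltW rho0) //.
by rewrite lt_max rho0 orbT.
Qed.

Let etalo j : lo <= eta_grid j.
Proof.
have : 0 <= j%:R * rho by rewrite mulr_ge0 // ltW.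
have : lo <= Num.max lo rho by rewrite le_max lexx.
rewrite /eta_grid; lra.
Qed.

(** The middle factors of the cross term along the second grid, of the gain and of
    the penalty, indexed together so as to be treated by a single union bound. *)
Definition cores (i j : nat) : T -> 'M[R]_n :=
  if (j < Nj)%N then fun w => filtered (x w) Sigma (Bs w) k (eta_grid j)
  else if j == Nj then fun w => gain_core (x w) K k (zeta i)
  else fun w => penalty_core (x w) Sigma (Bs w) k.

Let cores_bnd i j w : bnd (cores i j w) be.
Proof.
have K2 : K <= K ^+ 2 by rewrite expr2 ler_peMl // ltW.
have KK : 0 <= K ^+ 2 by exact: sqr_ge0.
have b2 : K ^+ 2 <= K ^+ 2 * beta by rewrite ler_peMr.
have b3 : K * beta <= K ^+ 2 * beta by rewrite ler_wpM2r // (le_trans _ beta1).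
rewrite /cores /be; case: ifP => _; last case: ifP => _.
- apply: bnd_le (filtered_bnd K1 SK (sBs w) beta1 k (eta0 j) (etalo j)) _.
  by rewrite -mulrA; lra.
- apply: bnd_le (gain_core_bnd _ K1 k (zetaK i)) _.
  by rewrite -mulrA; lra.
- apply: bnd_le (penalty_core_bnd K1 SK (sBs w) k) _.
  by rewrite -mulrA; lra.
Qed.

Let mx := mxmeas_design Sigma (Z := Z).

Let cores_meas i j : Zmeas (cores i j).
Proof.
have mS : Zmeas (fun w => S w) by exact: mxmeas_gram.
have mM : Zmeas (fun w => risk_weight (x w) k Sigma).
  by case: k => //=; exact: mxmeas_cst.
have z0 : 0 < zeta i by apply: lt_le_trans (zetaK i); rewrite invr_gt0.
have mR e : 0 < e -> Zmeas (fun w => res (S w) e) by move=> e0; exact: mxmeas_res.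
rewrite /cores; case: ifP => _; last case: ifP => _.
- by apply: mxmeasM => //; apply: mxmeasM => //; exact: mR.
- rewrite /gain_core; case: (k); do ?apply: mxmeasZ; do ?apply: mxmeasM => //; exact: mR.
- have mh : Zmeas (fun w => penalty_half (x w) Sigma (Bs w) k).
    rewrite /penalty_half; case: (k) mM => /= mM; last exact: mxmeas_cst.
    + apply: mxmeasM => //; apply: mxmeasM; first exact: mxmeas_rangeproj.
      by apply: mxmeasB => //; exact: mxmeas_cst.
    + apply: mxmeasM => //; apply: mxmeasM; first exact: mxmeas_rangeproj.
      by apply: mxmeasB => //; exact: mxmeas_cst.
  by apply: mxmeasM => //; exact: mxmeas_tr.
Qed.

(** The forms in the signal: the penalty needs that of the sandwich, the cross
    term that of its product with [S]. The two indices after those of the grid are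
    the cores of the gain and of the penalty. *)
Definition signal_core (ij : 'I_Ni * 'I_Nj.+2) : T -> 'M[R]_n :=
  let N w := sandwich (x w) (zeta ij.1) (cores ij.1 ij.2 w) in
  if ij.2 == Nj.+1 :> nat then N else fun w => N w *m S w.

Definition noisy_rate : R :=
  Ni%:R * (Nj.+2%:R * sandwich_rate be ep + trace_low_rate B K L) +
  (noise_rate B K + (8 * c4 B * K ^+ 3 + rr)).

(** The constants of the bounds on gain, penalty and cross term, with tolerance
    [ep] for each form and mesh [rho] for the grids. *)
Definition gain_const : R :=
  K^-1 * (trace_low K L ^+ 2 / (K ^+ 2 + 1)) ^+ 2 / (K ^+ 2 + 1).
Definition gain_floor : R := K^-1 * gain_const - 3 * ep.
Definition penalty_ceil : R :=
  4 * K * (K + L ^+ 2) * (K ^+ 4 * phi) + 4 * K * (1 + L ^+ 2) * ep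
    + 2 * xb ^+ 2 * (1 + K * (K + 1)) ^+ 2.
Definition cross_ceil : R := 2 * (1 + L) * ep + rho * (K ^+ 2 * be).
Definition gap dl : R :=
  dl ^+ 2 * gain_floor / (2 * (2 + L * K) ^+ 2) - penalty_ceil
    - 2 * L * (cross_ceil + K * (rho * beta ^+ 2) * (1 + K * (K + 1)) ^+ 2).

Lemma gain_const_ge0 : 0 <= gain_const.
Proof.
have T0 : 0 <= K ^+ 2 + 1 by rewrite addr_ge0 ?sqr_ge0.
apply: divr_ge0 => //; apply: mulr_ge0; last exact: sqr_ge0.
by rewrite invr_ge0 ltW.
Qed.

Hypothesis floor0 : 0 <= gain_floor.

(** Let [z] be the point of the first grid just below [sigma ^ 2 / |mu| ^ 2]. On
    the intersection of the events of the finitely many forms, the risk at [e]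
    exceeds the risk at [z] by the gain, up to the penalty and the cross term; the
    latter nearly vanishes because of the choice of [z]. *)
Lemma noisy_core (dl : R) : 0 <= dl ->
  exists N : set (n.-tuple (measurableTypeR R)), [/\ measurable N, N `<=` @ballT R n 1,
    (tmeas n N <= (4 * (Ni * Nj.+2)%:R * expR (- (n%:R * tau ^+ 2 / 64)) / p)%:E
       * tmeas n (@ballT R n 1))%E &
    forall t, @ballT R n 1 t -> ~ N t -> let mu := coords t in
      0 < dot mu mu -> K^-1 <= sigma ^+ 2 / dot mu mu <= L ->
      negl P [set w | ~ exists2 z, K^-1 <= z <= L &
          forall e, 0 < e -> lo <= e -> e <= L -> dl + rho <= `|e - sigma ^+ 2 / dot mu mu| ->
          gap dl <= form (risk_weight (x w) k Sigma) (ridge_err (x w) mu (a w) e) -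
                 form (risk_weight (x w) k Sigma) (ridge_err (x w) mu (a w) z)]
        (noisy_rate / n%:R + p)].
Proof.
move=> dl0.
have gen (A C u v : R) : - ep <= u - A -> - ep <= v -> C <= A -> C - 3 * ep <= u + 2 * v by lra.
have sb0 : 0 < K ^+ 2 * be by rewrite mulr_gt0 // exprn_gt0.
have z0 i : 0 < zeta i by apply: lt_le_trans (zetaK i); rewrite invr_gt0.
have Fb ij w : bnd (signal_core ij w) (K ^+ 2 * be).
  rewrite /signal_core; case: ifP => _.
    have := sandwich_bnd (x w) K1 (zetaK ij.1) (ltW be0) (cores_bnd ij.1 ij.2 w). by [].
  have := sandwich_gram_bnd (x w) K1 (zetaK ij.1) (ltW be0) (cores_bnd ij.1 ij.2 w). by [].
have mF ij : mxmeas (signal_core ij).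
  apply: Zmeas_mxmeas; rewrite /signal_core; case: ifP => _.
    exact: Zmeas_sandwich.
  by apply: mxmeasM; [exact: Zmeas_sandwich|exact: mxmeas_gram].
have [N [mN Nball Nsmall Ntyp]] := typical_signals P mF sb0 Fb tau01 ntau p0.
exists N; split => //.
  by move: Nsmall; rewrite card_prod !card_ord.
move=> t t1 Nt mu mu0 /andP[sK1 sL].
have mu1 : enorm mu <= 1.
  by move: t1; rewrite /ballT /= /norm2 -/mu -enorm_sqr ler_pXn2r ?nnegrE ?enorm_ge0.
have noise_ev i : negl P [set w | exists2 j, (j < Nj.+2)%N &
      ~ noise_typical (zeta i) (cores i j w) mu ep w] (Nj.+2%:R * (sandwich_rate be ep / n%:R)).
  apply: negl_bigU => j _.
  exact: sandwich_events (zetaK i) (ltW be0) (cores_bnd i j) (cores_meas i j) ep0 mu1 nbig.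
have trace_ev i : negl P [set w | zeta i <= L /\
    ~ trace_low K L * n%:R <= \tr (S w *m res (S w) (zeta i))] (trace_low_rate B K L / n%:R).
  have [zL|Lz] := leP (zeta i) L.
    by apply: negl_sub (trace_resolvent_low B0 model mK mK' (zetaK i) zL) => w [].
  apply: negl_sub (trace_resolvent_low B0 model mK mK' (lexx _) (le_trans (le_trans _ K1) KL)) => [w []|].
    by [].
  by rewrite invf_le1.
have all_ev := neglU (negl_bigU (fun i (_ : (i < Ni)%N) => neglU (noise_ev i) (trace_ev i)))
  (neglU (noise_norm B0 model mK sK) (neglU (trace_design B0 model mK) range_event)).
apply: negl_le (negl_sub _ (neglU all_ev (Ntyp t t1 Nt))).
  rewrite -/mu lerD2r /noisy_rate.
  set X := sandwich_rate be ep; set Y := trace_low_rate _ _ _; set U := noise_rate _ _.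
  by rewrite le_eqVlt; apply/orP; left; apply/eqP; ring.
move=> w /= bad; apply: contrapT.
move=> /not_orP[/not_orP[ev1 /not_orP[/contrapT aA /not_orP[/contrapT trS /contrapT rangeE]]] evmu].
apply: bad; set s2 := sigma ^+ 2 in sK1 sL *.
have [i iN /andP[zi zi']] : exists2 i, (i < Ni)%N & zeta i <= s2 / dot mu mu <= zeta i + rho.
  by apply: zeta_grid; rewrite sK1 sL.
set z := zeta i in zi zi'; have zL : z <= L by exact: le_trans zi sL.
have zK : K^-1 <= z := zetaK i.
have noiseT j : (j < Nj.+2)%N -> noise_typical z (cores i j w) mu ep w.
  move=> jN; apply: contrapT => h; apply: ev1; exists i => //; left; exists j => //.
have traceL : trace_low K L * n%:R <= \tr (S w *m res (S w) z).
  by apply: contrapT => h; apply: ev1; exists i => //; right.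
have signalT j (jN : (j < Nj.+2)%N) :
    `|dot mu (signal_core (Ordinal iN, Ordinal jN) w *m mu) -
      dot mu mu * (\tr (signal_core (Ordinal iN, Ordinal jN) w) / n%:R)| <= ep.
  apply: contrapT => h; apply: evmu; exists (Ordinal iN, Ordinal jN) => h'; apply: h.
  exact: le_trans h' tau_ep.
have s2z : `|s2 - z * dot mu mu| <= rho.
  have dmu1 : dot mu mu <= 1 by rewrite -enorm_sqr expr_le1 ?enorm_ge0.
  have -> : s2 - z * dot mu mu = (s2 / dot mu mu - z) * dot mu mu.
    by rewrite mulrBl divfK // gt_eqF.
  rewrite normrM ger0_norm ?subr_ge0 // (ger0_norm (ltW mu0)).
  apply: (@le_trans _ _ (rho * 1)); last by rewrite mulr1.
  by apply: ler_pM => //; rewrite ?subr_ge0 ?(ltW mu0) // lerBlDl.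
have s20 : 0 <= s2 by exact: sqr_ge0.
exists z; first by rewrite zK zL.
move=> e e0 loe eL far.
have [j jN ej] := eta_gridP e0 loe eL.
have jN2 : (j < Nj.+2)%N by apply: leq_trans jN _; rewrite leqW.
have cE : cores i j w = filtered (x w) Sigma (Bs w) k (eta_grid j) by rewrite /cores jN.
have [q1 q2 q3] := noiseT j jN2.
have q4 := signalT j jN2.
rewrite /signal_core /= ltn_eqF ?(ltn_trans jN) // in q4.
have cross := cross_term_small K1 zK (ltW be0) (cores_bnd i j w) n0 zL q1 q2 q3 q4 s2z.
rewrite cE in cross.
have T1 : 1 <= K ^+ 2 + 1 by rewrite lerDr sqr_ge0.
have L0 : 0 < L by exact: lt_le_trans KL.
have gtr := gain_trace K1 k (z0 i) (trace_low_gt0 model L0) T1 n0 traceL trS.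
have [g1 g2 _] := noiseT Nj (leqnSn _).
have cN : cores i Nj w = gain_core (x w) K k z by rewrite /cores ltnn eqxx.
rewrite cN in g1 g2.
have KV0 : 0 < K^-1 by rewrite invr_gt0.
have gl := gain_lower (x w) k mu (a w) KV0 (z0 i).
rewrite !(gain_weight_sandwich (x w)) in gl.
have gain_ok : gain_floor <= gain (x w) k K^-1 (res (S w) z *m (res (S w) z *m (S w *m mu + (x w)^T *m a w))).
  have D1 (N' : 'M[R]_n) : dot ((x w)^T *m a w) (N' *m ((x w)^T *m a w)) =
      dot (a w) (x w *m N' *m (x w)^T *m a w) by rewrite dot_mull trmxK !mulmxA.
  have D2 (N' : 'M[R]_n) : dot ((x w)^T *m a w) (N' *m (S w *m mu)) =
      dot (a w) (x w *m N' *m S w *m mu) by rewrite dot_mull trmxK !mulmxA.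
  apply: le_trans gl; rewrite D1 D2.
  move: g1 g2; set d1 := dot _ _; set d2 := dot _ _; set tt := \tr _ / _ in gtr *.
  move=> g1 g2; have h1 : K^-1 * gain_const <= s2 * tt by apply: ler_pM => //; rewrite ?(ltW KV0) //; exact: gain_const_ge0.
  rewrite /gain_floor; move: g1 g2 h1; rewrite -/s2 !ler_norml => /andP[+ _] /andP[+ _].
  exact: gen.
have [p1 _ _] := noiseT Nj.+1 (ltnSn _).
have p2 := signalT Nj.+1 (ltnSn _).
rewrite /signal_core /= eqxx in p2.
have cP : cores i Nj.+1 w = penalty_core (x w) Sigma (Bs w) k.
  by rewrite /cores ltnNge leqnSn /= gtn_eqF.
rewrite cP in p1 p2.
have s2b : 0 <= s2 <= K by rewrite s20.
have pen := penalty_small K1 SK zK zL n0 mu1 aA s2b phi0 xb0 (ltW ep0) rangeE (xbB w) p1 p2.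
have dlz : dl <= `|e - z|.
  rewrite -(lerD2r rho); apply: le_trans far _.
  apply: le_trans (ler_distD z _ _) _; rewrite lerD2l distrC ger0_norm ?subr_ge0 //.
  by rewrite lerBlDl.
have := risk_gap K1 St SK Sk (sBs w) beta1 zK zL e0 loe eL (eta0 j) (etalo j) ej dlz dl0 mu1 aA floor0 gain_ok pen cross.
exact.
Qed.

End noisy.

(** * Measurability of infima along the ridge path *)

Section infima.
Context {R : realType}.

Lemma dense_sequence (A : set R) : A !=set0 -> exists D : nat -> R,
  (forall k, A (D k)) /\ forall e r, A e -> 0 < r -> exists k, `|D k - e| < r.
Proof.
move=> [a Aa].
pose Q (p : rat * nat) := A `&` [set e | `|ratr p.1 - e| < p.2.+1%:R^-1].
pose D k := if unpickle k is Some p then xget a (Q p) else a.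
exists D; split.
  by move=> k; rewrite /D; case: unpickle => // p; case: xgetP => // e _ [].
move=> e r Ae r0; pose N := Num.trunc (2 / r).
have Nr : 2 * N.+1%:R^-1 < r.
  rewrite -ltr_pdivlMl // mulrC; rewrite invf_plt ?posrE ?divr_gt0 //.
  by rewrite invf_div; exact: truncnS_gt.
have N0 : 0 < N.+1%:R^-1 :> R by rewrite invr_gt0.
have lt_e : e < e + N.+1%:R^-1 by rewrite ltrDl.
have [q] := rat_in_itvoo lt_e; rewrite in_itv /= => /andP[eq qe].
exists (pickle (q, N)); rewrite /D pickleK.
have eQ : `|ratr q - e| < N.+1%:R^-1 by rewrite gtr0_norm ?subr_gt0 // ltrBlDl.
case: xgetP => [e' _ [_ /= h]|]; last by move=> /(_ e) []; split.
apply: le_lt_trans Nr; apply: le_trans (ler_distD (ratr q) _ _) _.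
by rewrite distrC mulr_natl mulr2n; apply: ltW; exact: ltrD.
Qed.

Context {d} {T : measurableType d} (A : set R) (f : R -> T -> R).
Hypothesis A0 : A !=set0.
Hypothesis mf : forall e, A e -> measurable_fun setT (f e).
Hypothesis lip : forall w, exists2 C, 0 <= C &
  forall e e', A e -> A e' -> `|f e w - f e' w| <= C * `|e - e'|.

(** Continuity in the parameter reduces the existential to a countable union. *)
Lemma dense_exists_lt : exists D : nat -> R, (forall k, A (D k)) /\
  forall w c, (exists2 e, A e & f e w < c) <-> exists k, f (D k) w < c.
Proof.
have [D [AD dD]] := dense_sequence A0; exists D; split => // w c; split; last first.
  by move=> [k h]; exists (D k).
move=> [e Ae fe]; have [C C0 hC] := lip w.
have r0 : 0 < (c - f e w) / (C + 1) by rewrite divr_gt0 ?subr_gt0 // ltr_wpDl.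
have [k hk] := dD e _ Ae r0; exists k.
have := hC _ _ (AD k) Ae.
have : C * `|D k - e| < c - f e w.
  apply: (@le_lt_trans _ _ ((C + 1) * `|D k - e|)); first by rewrite ler_wpM2r // lerDl.
  by rewrite mulrC -ltr_pdivlMr // ltr_wpDl.
have := ler_norm (f (D k) w - f e w); lra.
Qed.

Lemma measurable_exists_lt c : measurable [set w | exists2 e, A e & f e w < c].
Proof.
have [D [AD hD]] := dense_exists_lt.
have -> : [set w | exists2 e, A e & f e w < c] = \bigcup_k [set w | f (D k) w < c].
  by apply/seteqP; split => w /=; [move=> /hD[k h]; exists k|move=> [k _ h]; apply/hD; exists k].
apply: bigcupT_measurable => k; apply: measurable_set_lt; last exact: measurable_cst.
exact: mf.
Qed.

Lemma measurable_min_over : (forall e w, A e -> 0 <= f e w) ->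
  measurable_fun setT (fun w => min_over A (f^~ w)).
Proof.
move=> f0 mT; apply: (measurability _ (RGenInftyO.measurableE R)) => //.
move=> _ [_ [c ->] <-]; rewrite setTI.
have -> : (fun w => min_over A (f^~ w)) @^-1` `]-oo, c[ = [set w | exists2 e, A e & f e w < c].
  apply/seteqP; split => w; rewrite /= in_itv /=.
    move=> /inf_lt; case; first by case: A0 => e Ae; exists (f e w); exists e.
    by move=> _ [e Ae <-] h; exists e.
  move=> [e Ae h]; apply: le_lt_trans h; apply: ge_inf; last by exists e.
  by exists 0 => _ [e' Ae' <-]; exact: f0.
exact: measurable_exists_lt.
Qed.

End infima.

Lemma measurable_ereal_inf_lt (R : realType) d (T : measurableType d) (A : set R)
    (f : R -> T -> R) c :
  (forall e, A e -> measurable_fun setT (f e)) ->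
  (forall w, exists2 C, 0 <= C & forall e e', A e -> A e' -> `|f e w - f e' w| <= C * `|e - e'|) ->
  measurable [set w | (ereal_inf [set (f e w)%:E | e in A] < c%:E)%E].
Proof.
move=> mf lip.
have -> : [set w | (ereal_inf [set (f e w)%:E | e in A] < c%:E)%E] =
    [set w | exists2 e, A e & f e w < c].
  apply/seteqP; split => w /=.
    by move=> /ereal_inf_lt[_ [e Ae <-]]; rewrite lte_fin => h; exists e.
  move=> [e Ae h]; apply/ereal_inf_ltP; exists (f e w)%:E; last by rewrite lte_fin.
  by exists e.
have [A0|A0] := eqVneq A set0; last by apply: measurable_exists_lt => //; apply/set0P.
by rewrite (_ : [set w | _] = set0) // A0; apply/seteqP; split => w // -[].
Qed.

Section risk_measurable.
Context {R : realType} (B K : R) (m n : nat) (Sigma : 'M[R]_n) (sigma : R).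
Context {d : measure_display} {T : measurableType d} (P : probability T R).
Context (Z : 'I_m -> 'I_n -> {RV P >-> R}) (xi0 : 'I_m -> {RV P >-> R}).
Hypothesis model : ridge_model B K Sigma sigma Z xi0.

Let n0 := rm_n_gt0 model.
Local Notation risk k mu w := (ridge_risk k Sigma mu (random_matrix Z w) (noise sigma xi0 w)).

Lemma risk_path k mu w e : 0 <= e ->
  risk k mu w e = form (risk_weight (design Sigma (random_matrix Z w)) k Sigma)
    (ridge_path (design Sigma (random_matrix Z w)) mu (scaled_noise n sigma xi0 w) e).
Proof. exact: ridge_risk_path n0 (rm_Sigma_psd model) _ _ _ _. Qed.

Lemma risk_lipschitz k mu A w : 0 <= A -> exists2 C, 0 <= C &
  forall e e', 0 <= e <= A -> 0 <= e' <= A ->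
    `|risk k mu w e - risk k mu w e'| <= C * `|e - e'|.
Proof.
move=> A0; have [C C0 h] := form_ridge_path_lipschitz (design Sigma (random_matrix Z w))
  (risk_weight (design Sigma (random_matrix Z w)) k Sigma) mu (scaled_noise n sigma xi0 w) A0.
exists C => // e e' he he'; have /andP[e0 _] := he; have /andP[e'0 _] := he'.
by rewrite !risk_path //; exact: h.
Qed.

Lemma risk_ge0 k mu w e : 0 <= risk k mu w e.
Proof.
rewrite /ridge_risk; case: k; rewrite ?sqr_ge0 //.
by rewrite mulr_ge0 ?sqr_ge0 // invr_ge0.
Qed.

Lemma measurable_risk k mu e : 0 <= e -> measurable_fun setT (fun w => risk k mu w e).
Proof.
have pos t : 0 < t -> measurable_fun setT (fun w => risk k mu w t).
  move=> t0; under eq_fun do rewrite risk_path ?(ltW t0) // /ridge_path (gt_eqF t0).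
  have mx : mxmeas (fun w => design Sigma (random_matrix Z w)).
    by apply: mxmeas_sub (mxmeas_design Sigma (Z := Z)); exact: Zsys_measurable.
  have ma : mxmeas (fun w => scaled_noise n sigma xi0 w) by exact: mxmeas_noise.
  have mM : mxmeas (fun w => risk_weight (design Sigma (random_matrix Z w)) k Sigma).
    by case: k; [exact: mxmeas_cst|exact: mxmeas_cst|exact: mxmeas_gram].
  have me : mxmeas (fun w => ridge_err (design Sigma (random_matrix Z w)) mu (scaled_noise n sigma xi0 w) t).
    apply: mxmeasB; last exact: mxmeas_cst.
    apply: mxmeasM; first exact: mxmeas_res.
    apply: mxmeasD; apply: mxmeasM.
    - exact: mxmeas_gram.
    - exact: mxmeas_cst.
    - exact: mxmeas_tr.
    - exact: ma.
  by apply: measurable_dot => //; exact: mxmeasM.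
move=> e0; have [->|en] := eqVneq e 0; last by apply: pos; rewrite lt_neqAle eq_sym en.
apply: (@measurable_fun_cvg _ _ _ _ (fun j w => risk k mu w (j.+1%:R^-1))).
  by move=> j; apply: pos; rewrite invr_gt0.
move=> w _; have [C C0 hC] := @risk_lipschitz k mu 1 w ler01.
apply/cvgrPdist_le => eps eps0.
have c1 : 0 < eps / (C + 1) by rewrite divr_gt0 // ltr_wpDl.
near=> j; apply: le_trans (hC _ _ _ _) _.
- by rewrite lexx ler01.
- by rewrite invr_ge0 ler0n /= invf_le1 // ler1n.
rewrite sub0r normrN ger0_norm ?invr_ge0 //.
apply: (@le_trans _ _ ((C + 1) * j.+1%:R^-1)); first by rewrite ler_wpM2r ?invr_ge0 // lerDl.
rewrite mulrC -ler_pdivlMr ?ltr_wpDl //.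
near: j; have := near_infty_natSinv_lt (PosNum c1).
by apply: filterS => j /ltW.
Unshelve. all: by end_near.
Qed.

Lemma measurable_distance_infimum k mu lo L (A : set R) c : 0 <= lo <= L ->
  A `<=` `[lo, L]%classic ->
  measurable [set w | (ereal_inf [set (`|risk k mu w e - min_over `[lo, L] (risk k mu w)|%R)%:E
    | e in A] < c%:E)%E].
Proof.
move=> /andP[lo0 loL] AL; have L0 := le_trans lo0 loL.
have in0 e : `[lo, L]%classic e -> 0 <= e <= L.
  by rewrite /= in_itv /= => /andP[loe ->]; rewrite (le_trans lo0).
have mr e : `[lo, L]%classic e -> measurable_fun setT (fun w => risk k mu w e).
  by move=> /in0/andP[e0 _]; exact: measurable_risk.
apply: (@measurable_ereal_inf_lt _ _ _ A
  (fun e w => `|risk k mu w e - min_over `[lo, L] (risk k mu w)|)) => [e /AL Ae|w].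
  apply: measurableT_comp => //; apply: measurable_funB; first exact: mr.
  apply: (@measurable_min_over _ _ _ _ (fun e w => risk k mu w e)) => //.
  - by exists lo; rewrite /= in_itv /= lexx.
  - move=> w; have [C C0 hC] := risk_lipschitz k mu w L0.
    by exists C => // e1 e2 /in0 h1 /in0 h2; exact: hC.
  - by move=> e1 w _; exact: risk_ge0.
have [C C0 hC] := risk_lipschitz k mu w L0.
exists C => // e1 e2 /AL/in0 h1 /AL/in0 h2; apply: le_trans (hC _ _ h1 h2).
by apply: le_trans (ler_dist_dist _ _) _; rewrite opprB addrA subrK.
Qed.

(** The value at [0] enters by continuity from the right. *)
Lemma path_gap k mu w (lo L eta delta dl z g : R) : 0 <= lo -> dl < delta -> 0 < z -> lo <= z <= L ->
  (forall e, 0 < e -> lo <= e -> e <= L -> dl <= `|e - eta| ->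
     g <= form (risk_weight (design Sigma (random_matrix Z w)) k Sigma)
            (ridge_err (design Sigma (random_matrix Z w)) mu (scaled_noise n sigma xi0 w) e) -
          form (risk_weight (design Sigma (random_matrix Z w)) k Sigma)
            (ridge_err (design Sigma (random_matrix Z w)) mu (scaled_noise n sigma xi0 w) z)) ->
  (g%:E <= ereal_inf [set (`|risk k mu w e - min_over `[lo, L] (risk k mu w)|%R)%:E
    | e in `[lo, L]%classic `&` [set e | (delta <= `|e - eta|)%R]])%E.
Proof.
have contra (rt r0 rz u v : R) : 0 < g - (r0 - rz) -> g <= rt - rz -> rt - r0 <= u -> u <= v ->
    v <= (g - (r0 - rz)) / 2 -> False by lra.
move=> lo0 dld z0 zlo hg; have L0 : 0 < L by case/andP: zlo => _; exact: lt_le_trans.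
have pos e : 0 < e -> lo <= e -> e <= L -> dl <= `|e - eta| -> g <= risk k mu w e - risk k mu w z.
  move=> e0 loe eL far; rewrite (risk_path _ _ _ (ltW e0)) (risk_path _ _ _ (ltW z0)) /ridge_path (gt_eqF e0) (gt_eqF z0).
  by have := hg e e0 loe eL far.
apply: le_ereal_inf_tmp => _ [e [+ far] <-]; rewrite /= in_itv /= => /andP[loe eL].
rewrite lee_fin; apply: (@le_trans _ _ (risk k mu w e - risk k mu w z)); last first.
  apply: le_trans (ler_norm _); rewrite lerD2l lerN2; apply: ge_inf; last by exists z; rewrite //= in_itv.
  by exists 0 => _ [e' _ <-]; exact: risk_ge0.
have [e0|e0] := ltP 0 e; first by apply: pos => //; apply: le_trans far; exact: ltW.
have {e0}eE : e = 0 by apply/eqP; rewrite eq_le e0 (le_trans lo0).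
have tri (x y u : R) : `|0 - eta| <= x + u -> x <= delta - dl -> dl <= u.
  by move: far; rewrite /= eE => far /(le_trans far) h1 h2; lra.
rewrite eE in loe *; have {}lo0 : lo = 0 by apply/eqP; rewrite eq_le lo0 loe.
have [C C0 hC] := risk_lipschitz k mu w (ltW L0).
rewrite leNgt; apply/negP => lt.
pose s := g - (risk k mu w 0 - risk k mu w z); have s0 : 0 < s by rewrite subr_gt0.
have C1 : 0 < C + 1 by rewrite ltr_wpDl.
pose t := Num.min (Num.min (delta - dl) L) (s / 2 / (C + 1)).
have t0 : 0 < t by rewrite /t !lt_min subr_gt0 dld L0 !divr_gt0.
have td : t <= delta - dl by rewrite /t !ge_min lexx.
have tL : t <= L by rewrite /t !ge_min lexx orbT.
have ts : t * (C + 1) <= s / 2 by rewrite -ler_pdivlMr // /t ge_min lexx orbT.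
have t0' := ltW t0.
have far' : dl <= `|t - eta|.
  have := ler_distD t 0 eta; rewrite [`|0 - t|]distrC subr0 (ger0_norm t0').
  by move/tri; apply.
have t1 : g <= risk k mu w t - risk k mu w z by apply: pos => //; rewrite lo0.
have t2 : `|risk k mu w t - risk k mu w 0| <= C * t.
  by have := hC t 0; rewrite t0' tL lexx (ltW L0) subr0 (ger0_norm t0') => /(_ isT isT).
have t3 : C * t <= t * (C + 1) by rewrite mulrDr mulr1 mulrC lerDl.
exact: contra s0 t1 (ler_norm _) t2 (le_trans t3 ts).
Qed.

End risk_measurable.

(** * From typical signals to the volume estimate *)

Section signal_sets.
Context {R : realType} (n : nat) {d : measure_display} {T : measurableType d}.
Context (P : probability T R) (bad : 'cV[R]_n -> set T) (D : set 'cV[R]_n).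

(** Where the volume bound is void no signal has to be retained. *)
Lemma no_signals (v q : R) : 1 <= v ->
  exists U : set 'cV[R]_n, [/\ borel_cV U, U `<=` eball n 1 `\` D,
    1 - v <= vol U / vol (eball n 1 `\` D) &
    (ereal_sup [set P (bad mu) | mu in U] <= q%:E)%E].
Proof.
move=> v1; exists set0; split => //.
- by rewrite /borel_cV preimage_set0; exact: measurable0.
- have -> : vol (set0 : set 'cV[R]_n) = 0.
    by rewrite /vol preimage_set0 -tmeasE // measure0.
  by rewrite mul0r subr_le0.
- by rewrite image_set0 ereal_sup0 leNye.
Qed.

(** [D] is the excluded centre of the ball, which has at most half of its volume,
    so that dividing by the volume of the remainder only doubles [e]. *)
Lemma most_signals (N : set (n.-tuple (measurableTypeR R))) (e v q q' : R) :
  measurable N -> (tmeas n N <= e%:E * tmeas n (@ballT R n 1))%E ->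
  32 * 256 ^+ 2 <= n%:R :> R -> borel_cV D -> D `<=` eball n 1 ->
  (tmeas n (@col_of_tuple R n @^-1` D) <= 2^-1%:E * tmeas n (@ballT R n 1))%E ->
  (forall mu, measurable (bad mu)) ->
  (forall t, @ballT R n 1 t -> ~ N t -> ~ D (coords t) -> negl P (bad (coords t)) q) ->
  2 * e <= v -> q <= q' ->
  exists U : set 'cV[R]_n, [/\ borel_cV U, U `<=` eball n 1 `\` D,
    1 - v <= vol U / vol (eball n 1 `\` D) &
    (ereal_sup [set P (bad mu) | mu in U] <= q'%:E)%E].
Proof.
move=> mN Ne n0 mD D1 D2 mbad hbad ev qq.
have b0 : (0 < tmeas n (@ballT R n 1))%E.
  have a4 : ((0 : R) < 4^-1) && ((4^-1 : R) <= 4^-1) by rewrite invr_gt0 ltr0n lexx.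
  have na : 32 <= n%:R * 4^-1 ^+ 2 :> R by move: n0; rewrite !expr2; lra.
  have N0 : 0 < n%:R :> R by move: n0; rewrite expr2; lra.
  apply: lt_le_trans (ball_volume_ge a4 na); rewrite lte_fin !mulr_gt0 ?expR_gt0 ?invr_gt0 //.
  by rewrite exprn_gt0 // sqrtr_gt0 divr_gt0 // mulr_gt0 // pi_gt0.
have [mU U1 U2] := typical_set mN Ne b0 mD D1 D2.
set U := [set mu | _] in mU U1 U2; exists U; split => //.
  by apply: le_trans U2; rewrite lerD2l lerN2.
apply: ge_ereal_sup => _ [mu [[mu1 muD] muN] <-].
have tE : coords (tuple_of mu) = mu.
  by apply/matrixP => i j; rewrite ord1 /coords !mxE tnth_mktuple.
apply: (@le_trans _ _ q%:E); last by rewrite lee_fin.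
apply: negl_measurable => //; rewrite -tE; apply: hbad => //; last by rewrite tE.
by rewrite (ballTE n ler01) /preimage /= -[col_of_tuple _]/(coords _) tE.
Qed.

End signal_sets.

(** * The noisy case *)

Section noisy_constants.
Context {R : realType}.

Lemma grid_approx (lo hi rho e : R) : 0 < rho -> lo <= e <= hi ->
  exists2 i, (i < (Num.trunc ((hi - lo) / rho)).+1)%N & lo + i%:R * rho <= e <= lo + i%:R * rho + rho.
Proof.
move=> rho0 /andP[loe ehi]; pose y := (e - lo) / rho.
have y0 : 0 <= y by rewrite divr_ge0 ?subr_ge0 // ltW.
exists (Num.trunc y).
  by rewrite ltnS; apply: le_truncn; rewrite ler_pM2r ?invr_gt0 // lerD2r.
have /andP[h1 h2] := truncn_itv y0.
have ye : y * rho = e - lo by rewrite divfK // gt_eqF.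
apply/andP; split.
  by rewrite -lerBrDl -ye ler_pM2r.
rewrite -addrA -lerBlDl -ye -[X in _ <= _ + X]mul1r -mulrDl ler_pM2r //.
by rewrite -[1](mulr1n 1) -mulrnDr addn1 ltW.
Qed.

Lemma eta_grid_approx (lo L rho e : R) : 0 < rho -> 0 <= lo -> 0 < e -> lo <= e -> e <= L ->
  exists2 j, (j < (Num.trunc (L / rho)).+1)%N & `|e - eta_grid lo rho j| <= rho.
Proof.
move=> rho0 lo0 e0 loe eL; rewrite /eta_grid; set lo1 := Num.max lo rho.
have lo10 : 0 <= lo1 by rewrite le_max lo0.
have [e1|e1] := leP lo1 e.
  have [|i iN /andP[h1 h2]] := @grid_approx lo1 L rho e rho0; first by rewrite e1.
  exists i; last by rewrite ger0_norm ?subr_ge0 // lerBlDl.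
  apply: leq_trans iN _; rewrite ltnS; apply: le_truncn.
  by rewrite ler_pM2r ?invr_gt0 // gerBl.
exists 0%N => //; rewrite mul0r addr0; move: e1; rewrite /lo1.
case: (leP lo rho) => h e1; last by move: (le_lt_trans loe e1); rewrite ltxx.
by rewrite ler0_norm ?subr_le0 ?ltW //; lra.
Qed.

Lemma gain_const_gt0 (K L : R) : 0 < K -> 0 < L -> 0 < gain_const K L.
Proof.
move=> K0 L0.
have T0 : 0 < K ^+ 2 + 1 by rewrite ltr_wpDl ?sqr_ge0.
have t0 : 0 < trace_low K L.
  have e0 : 0 < low_eps K L.
    by rewrite /low_eps divr_gt0 ?invr_gt0 // mulr_gt0 // addr_gt0.
  by rewrite /trace_low divr_gt0 // !mulr_gt0 // addr_gt0.
by rewrite /gain_const divr_gt0 // mulr_gt0 ?invr_gt0 // exprn_gt0 // divr_gt0 // exprn_gt0.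
Qed.

(** The part of the gap that does not vanish with the mesh sizes. *)
Definition gap_main (K L dl : R) : R :=
  dl ^+ 2 * (K^-1 * gain_const K L) / (2 * (2 + L * K) ^+ 2).

Lemma gap_main_gt0 (K L dl : R) : 0 < K -> 0 < L -> 0 < dl -> 0 < gap_main K L dl.
Proof.
move=> K0 L0 dl0; have g0 := gain_const_gt0 K0 L0.
by rewrite /gap_main !(mulr_gt0, divr_gt0, exprn_gt0, invr_gt0, addr_gt0).
Qed.

(** Once the filter makes the first part of the penalty small, the tolerance and
    the mesh enter the gap linearly, with coefficients [E1] and [E2]. *)
Lemma gap_large (K L beta phi xb dl : R) : 1 <= K -> 0 < L -> 0 < dl -> 1 <= beta ->
  4 * K * (K + L ^+ 2) * (K ^+ 4 * phi) + 2 * xb ^+ 2 * (1 + K * (K + 1)) ^+ 2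
    <= gap_main K L dl / 2 ->
  exists ep rho, [/\ 0 < ep, 0 < rho <= dl, 0 <= gain_floor K L ep &
    gap_main K L dl / 4 <= gap K L beta phi xb ep rho dl].
Proof.
move=> K1 L0 dl0 be1 pen.
have K0 : 0 < K by apply: lt_le_trans K1.
have g0 := gain_const_gt0 K0 L0; have G0 := gap_main_gt0 K0 L0 dl0.
set G := gap_main K L dl in pen G0 *.
pose q := 2 * (2 + L * K) ^+ 2.
have q0 : 0 < q by rewrite mulr_gt0 // exprn_gt0 // addr_gt0 // mulr_gt0.
pose E1 := 3 * (dl ^+ 2 / q) + 4 * K * (1 + L ^+ 2) + 2 * L * (2 * (1 + L)).
pose E2 := 2 * L * (K ^+ 2 * (4 * K ^+ 2 * beta) + K * beta ^+ 2 * (1 + K * (K + 1)) ^+ 2).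
have E10 : 0 < E1.
  by rewrite /E1 !(addr_gt0, mulr_gt0, divr_gt0, exprn_gt0, invr_gt0).
have b0 : 0 < beta by apply: lt_le_trans be1.
have E20 : 0 < E2.
  by rewrite /E2 !(addr_gt0, mulr_gt0, divr_gt0, exprn_gt0, invr_gt0).
have G8 : 0 < G / 8 by rewrite divr_gt0.
pose ep := Num.min (G / 8 / E1) (K^-1 * gain_const K L / 3).
pose rho := Num.min (G / 8 / E2) dl.
have ep1 : ep * E1 <= G / 8 by rewrite -ler_pdivlMr // /ep ge_min lexx.
have rho1 : rho * E2 <= G / 8 by rewrite -ler_pdivlMr // /rho ge_min lexx.
exists ep, rho; split.
- by rewrite /ep lt_min divr_gt0 // divr_gt0 // mulr_gt0 ?invr_gt0.
- by rewrite /rho lt_min dl0 divr_gt0 // ge_min lexx orbT.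
- rewrite /gain_floor; have : ep <= K^-1 * gain_const K L / 3 by rewrite /ep ge_min lexx orbT.
  lra.
have -> : gap K L beta phi xb ep rho dl = G -
   (4 * K * (K + L ^+ 2) * (K ^+ 4 * phi) + 2 * xb ^+ 2 * (1 + K * (K + 1)) ^+ 2)
   - ep * E1 - rho * E2.
  rewrite /gap /gain_floor /penalty_ceil /cross_ceil /G /gap_main -/q /E1 /E2.
  by move: (K^-1 * gain_const K L) (q^-1) => g qi; ring.
lra.
Qed.

End noisy_constants.

Section rates.
Context {R : realType} (vartheta : R).
Hypothesis th01 : 0 < vartheta <= 1.

(** The exponential bound on the atypical signals absorbs the factor [p^-1] of
    the Markov inequality behind [typical_signals]. *)
Lemma exp_absorb (n : nat) (M a C : R) : (0 < n)%N -> 0 <= M -> 0 < a ->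
  a^-1 <= C -> M / a <= C ->
  M * expR (- (2 * n%:R * a)) / n%:R `^ (- (1 / 7)) <= C * expR (- (n%:R `^ vartheta) / C).
Proof.
move=> n0 M0 a0 aC MC; have n1 : 1 <= n%:R :> R by rewrite ler1n.
have C0 : 0 < C by apply: lt_le_trans aC; rewrite invr_gt0.
have N0 : 0 < n%:R :> R by rewrite ltr0n.
have th1 : n%:R `^ vartheta <= n%:R :> R.
  by rewrite -[leRHS]powRr1 ?(ltW N0) // ler_powR //; case/andP: th01.
have -> : - (2 * n%:R * a) = - (n%:R * a) + - (n%:R * a) by ring.
rewrite expRD powRN invrK.
have h1 : expR (- (n%:R * a)) <= expR (- (n%:R `^ vartheta) / C).
  rewrite ler_expR mulNr lerN2; apply: ler_pM => //; rewrite ?powR_ge0 ?invr_ge0 ?(ltW C0) //.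
  by rewrite invf_ple ?posrE.
have h2 : n%:R `^ (1 / 7) <= a^-1 * expR (n%:R * a) :> R.
  apply: (@le_trans _ _ (n%:R)).
    by rewrite -[leRHS]powRr1 ?(ltW N0) // ler_powR //; lra.
  rewrite mulrC ler_pdivlMr //; have := expR_ge1Dx (n%:R * a); lra.
have h3 : expR (- (n%:R * a)) * n%:R `^ (1 / 7) <= a^-1.
  by rewrite expRN mulrC ler_pdivrMr ?expR_gt0.
have -> : M * (expR (- (n%:R * a)) * expR (- (n%:R * a))) * n%:R `^ (1 / 7) =
  (M * (expR (- (n%:R * a)) * n%:R `^ (1 / 7))) * expR (- (n%:R * a)) by ring.
apply: ler_pM => //; rewrite ?expR_ge0 ?mulr_ge0 ?expR_ge0 ?powR_ge0 //.
by apply: le_trans MC; rewrite ler_wpM2l.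
Qed.

Lemma inv_le_rate (n : nat) : (0 < n)%N -> n%:R^-1 <= n%:R `^ (- (1 / 7)) :> R.
Proof.
move=> n0; rewrite -powR_inv1 ?ler0n // ler_powR ?ler1n //; lra.
Qed.

Lemma few_samples (n : nat) (n0 C : R) : (0 < n)%N -> n%:R <= n0 -> 2 * n0 <= C -> 2 <= C ->
  1 <= C * expR (- (n%:R `^ vartheta) / C).
Proof.
move=> n1 nn0 nC C2; have C0 : 0 < C by lra.
have N1 : 1 <= n%:R :> R by rewrite ler1n.
have th1 : n%:R `^ vartheta <= n%:R :> R.
  by rewrite -[leRHS]powRr1 ?ler0n // ler_powR //; case/andP: th01.
have h : - (n%:R `^ vartheta) / C >= - 2^-1.
  rewrite mulNr lerN2 ler_pdivrMr //; lra.
have := expR_ge1Dx (- (n%:R `^ vartheta) / C) => h'.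
have h2 : 2^-1 <= expR (- (n%:R `^ vartheta) / C) by lra.
apply: (@le_trans _ _ (2 * 2^-1)); first by rewrite divff.
by apply: ler_pM => //; rewrite invr_ge0.
Qed.

End rates.

Section noisy_mode.
Context {R : realType} (B K delta L vartheta lo beta phi xb rr : R).
Hypotheses (B0 : 0 < B) (K1 : 1 <= K) (delta01 : 0 < delta <= 1 / 2).
Hypotheses (KL : K / delta ^+ 2 <= L) (th01 : 0 < vartheta <= 1).
Hypotheses (lo0 : 0 <= lo) (loK : lo <= K^-1) (beta1 : 1 <= beta) (phi0 : 0 <= phi) (xb0 : 0 <= xb).
Hypothesis pen : 4 * K * (K + L ^+ 2) * (K ^+ 4 * phi) + 2 * xb ^+ 2 * (1 + K * (K + 1)) ^+ 2
    <= gap_main K L (delta / 4) / 2.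

Let K0 : 0 < K. Proof. exact: lt_le_trans K1. Qed.
Let delta0 : 0 < delta. Proof. by case/andP: delta01. Qed.
Let KL' : K <= L.
Proof.
apply: le_trans KL; rewrite ler_pdivlMr ?exprn_gt0 // ler_piMr ?(ltW K0) //.
by rewrite expr_le1 ?(ltW delta0) //; case/andP: delta01 => _; lra.
Qed.
Let loL : lo <= L.
Proof. by apply: le_trans KL'; apply: le_trans loK _; apply: le_trans K1; rewrite invf_le1. Qed.
Let L0 : 0 < L. Proof. exact: lt_le_trans KL'. Qed.

(** The two regimes of [Xi] only differ by the filter [Bs]. Of the two error
    probabilities [rate / n] and [n ^ (- 1 / 7)], the second is the level of the
    Markov inequality that separates the typical signals. *)
Lemma noisy_mode : exists2 C0, 0 < C0 & forall C, C0 <= C ->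
  forall (m n : nat) (Sigma : 'M[R]_n) (sigma : R)
    (d : measure_display) (T : measurableType d) (P : probability T R)
    (Z : 'I_m -> 'I_n -> {RV P >-> R}) (xi0 : 'I_m -> {RV P >-> R}),
  ridge_model B K Sigma sigma Z xi0 ->
  m%:R <= K * n%:R -> n%:R <= K * m%:R -> K^-1 <= sigma ^+ 2 <= K ->
  forall (k : risk_kind) (Bs : T -> 'M[R]_n),
  let x w := design Sigma (random_matrix Z w) in
  let risk mu0 w eta := ridge_risk k Sigma mu0 (random_matrix Z w) (noise sigma xi0 w) eta in
  (forall w, smoothing (x w) (Bs w) lo beta) ->
  @mxmeas R _ (g_sigma_algebraType (Zall Z)) _ _ Bs ->
  (forall w, bnd (x w *m (1%:M - Bs w)) xb) ->
  negl P [set w | ~ fro (rangeproj (x w) *m (1%:M - Bs w)) <= phi * n%:R] (rr / n%:R) ->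
  exists U : set 'cV[R]_n,
    [/\ borel_cV U, U `<=` eball n 1 `\` eball n delta,
        1 - C * expR (- (n%:R `^ vartheta) / C) <= vol U / vol (eball n 1 `\` eball n delta) &
        (ereal_sup [set P [set w |
           ereal_inf [set (`| risk mu0 w eta' - min_over `[lo, L] (risk mu0 w) |%R)%:E
                     | eta' in `[lo, L]%classic `&`
                         [set e | (delta <= `| e - (SNR sigma mu0)^-1 |)%R]]
           < (1 / C)%R%:E] | mu0 in U] <= (C * n%:R `^ (- (1 / 7)))%R%:E)%E].
Proof.
have gen (C x1 x2 x3 x4 x5 : R) : 0 <= x1 -> 0 <= x2 -> 0 <= x3 -> 0 <= x4 -> 0 <= x5 ->
    0 < 2 * x1 + 2 + (x2 + 1) + x3 + x4 + x5 /\
    (2 * x1 + 2 + (x2 + 1) + x3 + x4 + x5 <= C ->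
    [/\ 2 <= C, 2 * x1 <= C, x2 + 1 <= C, x5 <= C & (x3 <= C) /\ (x4 <= C)]).
  by move=> *; split; [lra|move=> *; split; [lra|lra|lra|lra|split; lra]].
have [c c0 cE] : exists2 c, 0 <= c & c = 32 * 256 ^+ 2 :> R.
  exists (32 * 256 ^+ 2); last exact: erefl.
  by rewrite expr2; lra.
have dl0 : 0 < delta / 4 by rewrite divr_gt0.
have [ep [rho [ep0 /andP[rho0 rhod] fl0 gapL]]] := gap_large K1 L0 dl0 beta1 pen.
have dlr : delta / 4 + rho < delta by move: rhod delta0; lra.
have G0 := gap_main_gt0 K0 L0 dl0; set G := gap_main _ _ _ in gapL G0.
pose be := 4 * K ^+ 2 * beta.
have b0 : 0 < beta by apply: lt_le_trans beta1.
have be0 : 0 < K ^+ 2 * be by rewrite /be !mulr_gt0 ?exprn_gt0.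
pose tau := Num.min 1 (ep / (K ^+ 2 * be)).
have tau01 : 0 < tau <= 1 by rewrite /tau lt_min ltr01 divr_gt0 //= ge_min lexx.
have tau_ep : K ^+ 2 * be * tau <= ep by rewrite mulrC -ler_pdivlMr // /tau ge_min lexx orbT.
have /andP[tau0 tau1] := tau01.
pose Ni := (Num.trunc ((L - K^-1) / rho)).+1; pose Nj := (Num.trunc (L / rho)).+1.
(* Above this dimension the hypotheses [nbig] and [ntau] of [noisy_core] hold;
   below it the constant makes the volume bound void. *)
pose n0 := 2 * K * (K ^+ 2 * be) ^+ 2 / ep ^+ 2 + c / tau ^+ 4.
pose rate := noisy_rate B K L beta rr ep Ni Nj.
pose M : R := 8 * (Ni * Nj.+2)%:R; pose a := tau ^+ 2 / 128.
have a0 : 0 < a by rewrite divr_gt0 ?exprn_gt0.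
have M0 : 0 <= M by rewrite mulr_ge0.
have [n01 n02] : 0 <= 2 * K * (K ^+ 2 * be) ^+ 2 / ep ^+ 2 /\ 0 <= c / tau ^+ 4.
  split; last by apply: divr_ge0 => //; rewrite exprn_ge0 // ltW.
  by apply: divr_ge0; rewrite ?sqr_ge0 // mulr_ge0 ?sqr_ge0 // mulr_ge0 // ltW.
have n00 : 0 <= n0 by exact: addr_ge0.
have a0' : 0 <= a^-1 by rewrite invr_ge0 ltW.
have Ma0 : 0 <= M / a by rewrite divr_ge0 // ltW.
have GV0 : 0 <= (G / 4)^-1 by rewrite invr_ge0 divr_ge0 // ltW.
exists (2 * n0 + 2 + (`|rate| + 1) + a^-1 + M / a + (G / 4)^-1).
  exact: (gen 0 _ _ _ _ _ n00 (normr_ge0 rate) a0' Ma0 GV0).1.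
move=> C /(gen _ _ _ _ _ _ n00 (normr_ge0 rate) a0' Ma0 GV0).2[C2 Cn Crate CG [Ca CMa]].
move=> m n Sigma sigma d T P Z xi0 model mK mK' /andP[sK' sK] k Bs x risk sBs mBs xbB rangeE.
have n1 := rm_n_gt0 model; have nR : 0 < n%:R :> R by rewrite ltr0n.
have [nn0|nn0] := leP (n%:R : R) n0.
  by apply: no_signals; exact: few_samples n1 nn0 Cn C2.
have nbig : 2 * K * (K ^+ 2 * be) ^+ 2 / ep ^+ 2 <= n%:R.
  by apply: ltW; apply: le_lt_trans nn0; rewrite /n0 lerDl.
have ntau : 32 * 256 ^+ 2 <= n%:R * tau ^+ 4.
  rewrite -cE -ler_pdivrMr ?exprn_gt0 //.
  by apply: ltW; apply: le_lt_trans nn0; rewrite /n0 lerDr.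
have nball : 32 * 256 ^+ 2 <= n%:R :> R.
  apply: le_trans ntau _; rewrite -[leRHS]mulr1 ler_wpM2l ?(ltW nR) //.
  by rewrite expr_le1 // ltW.
pose p : R := n%:R `^ (- (1 / 7)).
have p0 : 0 < p by exact: powR_gt0.
have [N [mN Nball Nsmall Ntyp]] := noisy_core B0 model mK mK' sK sK' k KL' sBs mBs
  beta1 phi0 xb0 xbB rangeE ep0 rho0 tau01 p0 (fun e he => grid_approx rho0 he)
  (fun e e0 le eL => eta_grid_approx rho0 lo0 e0 le eL) nbig ntau tau_ep fl0 (ltW dl0).
have delta2 : 0 <= delta <= 2^-1.
  by case/andP: delta01 => d1 d2; rewrite (ltW d1); move: d2; rewrite mul1r.
have C0 : 0 < C by apply: lt_le_trans C2.
apply: (most_signals mN Nsmall nball (q := rate / n%:R + p)).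
- have := measurable_ballT (n := n) delta.
  by rewrite (ballTE n (ltW delta0)).
- by move=> v /= h; apply: le_trans h _; case/andP: delta2 => _; move/le_trans; apply; rewrite invf_le1 // ler1n.
- by rewrite -(ballTE n (ltW delta0)); exact: small_ball.
- by move=> mu; apply: (measurable_distance_infimum model k mu) => [|e []//]; rewrite lo0 loL.
- move=> t t1 Nt; rewrite /eball /= => /negP; rewrite -ltNge => tD.
  set mu := coords t in tD *.
  have mu1 : dot mu mu <= 1 by move: t1; rewrite /ballT /= /norm2 -/mu expr1n.
  have mu0 : delta ^+ 2 < dot mu mu by rewrite -enorm_sqr ltr_pXn2r ?nnegrE ?enorm_ge0 // ltW.
  have dmu0 : 0 < dot mu mu by apply: lt_trans mu0; rewrite exprn_gt0.
  have s20 : 0 <= sigma ^+ 2 by exact: sqr_ge0.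
  have sn1 : K^-1 <= sigma ^+ 2 / dot mu mu.
    by rewrite ler_pdivlMr //; apply: le_trans sK'; rewrite ler_piMr // invr_ge0 ltW.
  have sn2 : sigma ^+ 2 / dot mu mu <= L.
    apply: le_trans KL; apply: ler_pM => //; rewrite ?invr_ge0 ?(ltW dmu0) //.
    by rewrite lef_pV2 ?posrE ?exprn_gt0 // ltW.
  have snr : (SNR sigma mu)^-1 = sigma ^+ 2 / dot mu mu by rewrite /SNR invf_div enorm_sqr.
  have sn12 : K^-1 <= sigma ^+ 2 / dot mu mu <= L by rewrite sn1 sn2.
  apply: negl_sub (Ntyp t t1 Nt dmu0 sn12) => w /= bad [z /andP[zK zL] gapz]; move: bad.
  apply/negP; rewrite -leNgt snr.
  apply: (path_gap model (dl := delta / 4 + rho) (z := z)) => //.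
  - by apply: lt_le_trans zK; rewrite invr_gt0.
  - by rewrite zL (le_trans loK).
  - move=> e e0 loe eL /(gapz e e0 loe eL); apply: le_trans; apply: le_trans gapL.
    by rewrite mul1r invf_ple ?posrE // divr_gt0.
- have := exp_absorb th01 n1 M0 a0 Ca CMa; apply: le_trans.
  rewrite /M /a -/p le_eqVlt; apply/orP; left; apply/eqP.
  have -> : - (2 * n%:R * (tau ^+ 2 / 128)) = - (n%:R * tau ^+ 2 / 64) by field.
  by rewrite -/Ni -/Nj; ring.
- have nV : n%:R^-1 <= p := inv_le_rate n1.
  rewrite -/p; apply: (@le_trans _ _ (`|rate| * p + p)).
    rewrite lerD2r; apply: (@le_trans _ _ (`|rate| / n%:R)); last by rewrite ler_wpM2l.
    by rewrite ler_wpM2r ?ler_norm // invr_ge0 ltW.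
  by rewrite -{2}[p]mul1r -mulrDl ler_wpM2r // ltW.
Qed.

End noisy_mode.

Section noisy_case.
Context {R : realType} (B K delta L vartheta : R).
Hypotheses (B0 : 0 < B) (K0 : 0 < K) (delta01 : 0 < delta <= 1 / 2).
Hypotheses (KL : K / delta ^+ 2 <= L) (th01 : 0 < vartheta <= 1).

Lemma aspect_bounds (m n : nat) (a b : R) : (0 < m)%N -> (0 < n)%N -> 0 < a ->
  a <= (aspect_ratio m n)^-1 <= b -> m%:R <= a^-1 * n%:R /\ n%:R <= b * m%:R :> R.
Proof.
move=> m0 n0 a0; have mR : 0 < m%:R :> R by rewrite ltr0n.
rewrite /aspect_ratio invf_div => /andP[h1 h2]; split; last by rewrite -ler_pdivrMr.
by rewrite mulrC ler_pdivlMr // mulrC -ler_pdivlMr.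
Qed.

Lemma undersampling (m n : nat) (l : R) : (0 < m)%N -> 0 < l ->
  1 + 1 / l <= (aspect_ratio m n)^-1 -> l^-1 / (1 + l^-1) * n%:R <= n%:R - m%:R :> R.
Proof.
move=> m0 l0; have lV : 0 < l^-1 by rewrite invr_gt0.
rewrite /aspect_ratio invf_div div1r ler_pdivlMr ?ltr0n // mulrC.
move: (l^-1) lV => a a0; have a1 : 0 < 1 + a by rewrite addr_gt0.
rewrite -ler_pdivlMr //; rewrite lerBrDl -lerBrDr => /le_trans; apply.
rewrite le_eqVlt; apply/orP; left; apply/eqP; field.
by rewrite gt_eqF.
Qed.

(** Close to the interpolation threshold the regularization is at least [1 / L] and
    no filter is needed. Away from it the filter is a spectral cut-off at a
    level [b], which has to be so small that its penalty is a fraction of the gain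
    while the bound [1 / b] of the filtered resolvents remains a constant. *)
Lemma noisy_case : exists2 C : R, 0 < C &
    forall (m n : nat) (Sigma : 'M[R]_n) (sigma : R)
      (d : measure_display) (T : measurableType d) (P : probability T R)
      (Z : 'I_m -> 'I_n -> {RV P >-> R}) (xi0 : 'I_m -> {RV P >-> R}),
    ridge_model B K Sigma sigma Z xi0 ->
    1 / K <= (aspect_ratio m n)^-1 <= K ->
    1 / K <= sigma ^+ 2 <= K ->
    forall k : risk_kind,
    let risk mu0 w eta :=
      ridge_risk k Sigma mu0 (random_matrix Z w) (noise sigma xi0 w) eta in
    exists U : set 'cV[R]_n,
      [/\ borel_cV U,
          U `<=` eball n 1 `\` eball n delta,
          1 - C * expR (- (n%:R `^ vartheta) / C) <=
            vol U / vol (eball n 1 `\` eball n delta) &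
          (ereal_sup [set P [set w |
             ereal_inf [set (`| risk mu0 w eta' -
                                min_over (Xi m n L) (risk mu0 w) |%R)%:E
                       | eta' in Xi m n L `&`
                           [set e | (delta <= `| e - (SNR sigma mu0)^-1 |)%R]]
             < (1 / C)%R%:E] | mu0 in U]
           <= (C * n%:R `^ (- (1 / 7)))%R%:E)%E].
Proof.
have [K1|K1] := leP 1 K; last first.
  exists 1 => // m n Sigma sigma d T P Z xi0 model; exfalso.
  have := covariance_ge1 (rm_n_gt0 model) (rm_Sigma_unit model) (rm_Sigma_bound model).
  by rewrite leNgt K1.
have /andP[delta0 delta2] := delta01.
have KL' : K <= L.
  apply: le_trans KL; rewrite ler_pdivlMr ?exprn_gt0 // ler_piMr ?(ltW K0) //.
  by rewrite expr_le1 ?(ltW delta0) //; lra.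
have L1 : 1 <= L by exact: le_trans KL'.
have L0 : 0 < L by exact: lt_le_trans KL'.
have LV : L^-1 <= K^-1 by rewrite lef_pV2.
have LV0 : 0 < L^-1 by rewrite invr_gt0.
have dl0 : 0 < delta / 4 by rewrite divr_gt0.
have G0 := gap_main_gt0 K0 L0 dl0.
have pen1 : 4 * K * (K + L ^+ 2) * (K ^+ 4 * 0) + 2 * (0 : R) ^+ 2 * (1 + K * (K + 1)) ^+ 2
    <= gap_main K L (delta / 4) / 2.
  by rewrite expr0n /= !(mulr0, mul0r) addr0 divr_ge0 // ltW.
have [C1 C10 mode1] := noisy_mode 0 B0 K1 delta01 KL th01 (ltW LV0) LV L1 (lexx _) (lexx _) pen1.
(* The proportion of null directions of the design. *)
pose gam := L^-1 / (1 + L^-1).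
have gam0 : 0 < gam by rewrite divr_gt0 // addr_gt0.
have rc0 : 0 < range_const K gam.
  by rewrite /range_const ltr_wpDl // divr_ge0 ?(ltW gam0) // mulr_ge0 ?sqr_ge0.
(* The part of the penalty that comes from the cut-off is [b * W]. *)
pose W := 4 * K * (K + L ^+ 2) * (K ^+ 4 * (4 * range_const K gam)) + 8 * (1 + K * (K + 1)) ^+ 2.
have W0 : 0 < W.
  rewrite /W; apply: addr_gt0; last by rewrite mulr_gt0 // exprn_gt0 // addr_gt0 // mulr_gt0 // addr_gt0.
  by apply: mulr_gt0; [rewrite !mulr_gt0 ?addr_gt0 ?exprn_gt0|rewrite !mulr_gt0 ?exprn_gt0].
pose b := Num.min 1 (gap_main K L (delta / 4) / 2 / W).
have b0 : 0 < b by rewrite /b lt_min ltr01 divr_gt0 // divr_gt0.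
have b1 : b <= 1 by rewrite /b ge_min lexx.
have bW : b * W <= gap_main K L (delta / 4) / 2 by rewrite -ler_pdivlMr // /b ge_min lexx orbT.
have pen2 : 4 * K * (K + L ^+ 2) * (K ^+ 4 * (4 * (range_const K gam * b))) +
    2 * (2 * Num.sqrt b) ^+ 2 * (1 + K * (K + 1)) ^+ 2 <= gap_main K L (delta / 4) / 2.
  apply: le_trans bW; rewrite exprMn sqr_sqrtr ?(ltW b0) // /W.
  by rewrite le_eqVlt; apply/orP; left; apply/eqP; ring.
have bV : 1 <= b^-1 by rewrite invf_ge1.
have phi0 : 0 <= 4 * (range_const K gam * b) by rewrite !mulr_ge0 ?(ltW rc0) ?(ltW b0).
have xb0 : 0 <= 2 * Num.sqrt b by rewrite mulr_ge0 ?sqrtr_ge0.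
have KV0 : 0 <= K^-1 by rewrite invr_ge0 ltW.
have [C2 C20 mode2] := noisy_mode (range_rate B K gam / b) B0 K1 delta01 KL th01 (lexx _) KV0 bV phi0 xb0 pen2.
exists (C1 + C2); first exact: addr_gt0.
move=> m n Sigma sigma d T P Z xi0 model asp sK k risk.
have m0 := rm_m_gt0 model; have n0 := rm_n_gt0 model.
have mR : 0 < m%:R :> R by rewrite ltr0n.
have KV : 0 < 1 / K by rewrite divr_gt0.
have [mK mK'] := aspect_bounds m0 n0 KV asp.
rewrite div1r invrK in mK; rewrite div1r in sK.
have [small|big] := ltP ((aspect_ratio m n)^-1) (1 + 1 / L).
  have -> : Xi m n L = `[L^-1, L]%classic by rewrite /Xi small.
  apply: (mode1 (C1 + C2) _ m n Sigma sigma d T P Z xi0 model mK mK' sK k (fun=> 1%:M)).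
  - by rewrite lerDl ltW.
  - by move=> w; exact: smoothing_id.
  - exact: mxmeas_cst.
  - by move=> w; rewrite subrr mulmx0 => v; rewrite mul0mx enorm0 mul0r.
  - rewrite [0 / _]mul0r; apply: negl_sub; last exact: (negl0 P (lexx 0)).
    move=> w /=; rewrite subrr mulmx0 mul0r; apply.
    have b00 : bnd (0 : 'M[R]_n) 0 by move=> v; rewrite mul0mx enorm0 mul0r.
    by have := fro_bnd (lexx _) b00; rewrite expr0n mul0r.
have -> : Xi m n L = `[0, L]%classic by rewrite /Xi ltNge big.
apply: (mode2 (C1 + C2) _ m n Sigma sigma d T P Z xi0 model mK mK' sK k
  (fun w => cutoff (design Sigma (random_matrix Z w)) b)).
- by rewrite lerDr ltW.
- by move=> w; exact: smoothing_cutoff.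
- by apply: mxmeas_cutoff => //; exact: mxmeas_design.
- by move=> w; exact: gram_cutoffC_bnd.
have gn : gam * n%:R <= n%:R - m%:R := undersampling m0 L0 big.
apply: negl_sub (range_trace_high B0 model mK b0 gam0 gn) => w /= bad h; apply: bad.
apply: le_trans (cutoffC_fro _ b0) _.
by rewrite -!mulrA ler_pM2l // mulrA; move: h; rewrite -mulrA.
Qed.

End noisy_case.

(** * The noiseless case *)

Section noiseless.
Context {R : realType} {m n : nat} (x : 'M[R]_(m, n)) (Sigma : 'M[R]_n) (K b : R).
Hypotheses (K1 : 1 <= K) (b0 : 0 < b) (SK : bnd Sigma K) (St : Sigma^T = Sigma).
Hypothesis Sk : forall v, K^-1 * enorm v ^+ 2 <= form Sigma v.

Local Notation S := (gram x).
Local Notation Q := (rangeproj x).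
Local Notation Q' := (1%:M - rangeproj x).
Let psd := gram_psd x.
Let K0 : 0 < K. Proof. exact: lt_le_trans K1. Qed.

Let Qt : Q^T = Q. Proof. exact: rangeproj_tr. Qed.
Let QQ : Q *m Q = Q. Proof. exact: rangeproj_idem. Qed.
Let Qt' : Q'^T = Q'. Proof. by rewrite linearB /= trmx1 Qt. Qed.
Let QQ' : Q *m Q' = 0. Proof. by rewrite mulmxBr mulmx1 QQ subrr. Qed.
Let Qb : bnd Q 1. Proof. exact: rangeproj_bnd. Qed.
Let Qb' : bnd Q' 1.
Proof.
by apply: idem_bnd => //; rewrite {1}mulmxBl mul1mx QQ' subr0.
Qed.

(** Without noise the error is minus the projection of the signal on the null
    space of the design, plus a term in the range which vanishes at [0]. *)
Lemma noiseless_path mu e : 0 < e -> ridge_path x mu 0 e =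
  - (Q' *m mu) - (e *: res S e) *m (Q *m mu).
Proof.
move=> e0; rewrite /ridge_path (gt_eqF e0) ridge_errE // mulmx0 sub0r mulmxN -scalemxAr.
rewrite [e *: (res S e *m mu)]scalemxAl.
have {1}-> : mu = Q' *m mu + Q *m mu by rewrite mulmxBl mul1mx subrK.
rewrite [in LHS]mulmxDr opprD; congr (- _ - _).
by rewrite mulmxA -scalemxAl res_kernel.
Qed.

Lemma noiseless_path0 mu : ridge_path x mu 0 0 = - (Q' *m mu).
Proof.
rewrite /ridge_path eqxx mulmx0 addr0 mulmxA -rangeprojC.
by rewrite mulmxBl mul1mx opprB.
Qed.

Lemma shrink_bnd e : 0 < e -> bnd (e *: res S e) 1.
Proof.
move=> e0; have := bnd_scale e (res_bnd psd e0).
by rewrite gtr0_norm // divff // gt_eqF.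
Qed.

(** Test matrix of the interaction between the two parts of the error; its trace
    vanishes because they live in orthogonal subspaces. *)
Definition null_cross e : 'M[R]_n := Q' *m Sigma *m (cutoff x b *m (e *: res S e)) *m Q.

Lemma null_cross_bnd e : 0 < e -> bnd (null_cross e) K.
Proof.
move=> e0; have h := bnd_mul ler01 (cutoff_bnd x b0) (shrink_bnd e0).
rewrite -[K]mulr1 -[X in X * 1]mulr1 -[X in X * 1 * 1]mul1r -[X in _ * X * 1]mulr1.
have KK : 0 <= K by exact: ltW.
apply: bnd_mul Qb; first by rewrite !mul1r !mulr1.
apply: bnd_mul h; first by rewrite mul1r.
by apply: bnd_mul.
Qed.

Lemma null_cross_trace e : \tr (null_cross e) = 0.
Proof.
by rewrite /null_cross mxtrace_mulC !mulmxA QQ' !mul0mx mxtrace0.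
Qed.

Lemma null_cross_lip e e' : 0 < e -> 0 < e' ->
  bnd (null_cross e - null_cross e') (K * (`|e - e'| / b)).
Proof.
move=> e0 e'0; rewrite /null_cross -mulmxBl -mulmxBr -mulmxBr.
have -> : e *: res S e - e' *: res S e' = (e - e') *: (res S e *m (S *m res S e')).
  rewrite !(scale_resE psd) // opprB addrC addrA subrK -mulmxBr (res_diff psd) // -scalemxAr.
  by rewrite (res_resC psd) // !mulmxA (res_comm psd).
have KK : 0 <= K by exact: ltW.
have h : bnd (cutoff x b *m ((e - e') *: (res S e *m (S *m res S e')))) (`|e - e'| / b).
  have bV : 0 <= b^-1 by rewrite invr_ge0 ltW.
  have -> : cutoff x b *m ((e - e') *: (res S e *m (S *m res S e'))) =
      (e - e') *: (cutoff x b *m res S e *m (S *m res S e')).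
    by rewrite -scalemxAr; congr (_ *: _); exact: mulmxA.
  have := bnd_scale (e - e') (bnd_mul bV (cutoff_res_bnd x b0 e0) (mul_res_bnd psd e'0)).
  by rewrite mulr1.
rewrite -[K * _]mulr1; apply: bnd_mul Qb.
  by rewrite mulr_ge0 ?divr_ge0 // ltW.
by apply: bnd_mul h => //; rewrite -[K]mul1r; exact: bnd_mul.
Qed.

(** [null_penalty] is the matrix of the price of the cut-off in
    [form_lower_coercive]; its trace is controlled by the few small eigenvalues of
    the design on its row space. *)
Definition null_half : 'M[R]_n := Q *m (1%:M - cutoff x b) *m (Sigma *m Q').
Definition null_penalty : 'M[R]_n := null_half^T *m null_half.

Lemma null_penalty_bnd : bnd null_penalty (4 * K ^+ 2).
Proof.
have KK : 0 <= K by exact: ltW.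
have h : bnd null_half (2 * K).
  have h1 := bnd_mul ler01 Qb (cutoffC_bnd x b0).
  have h2 := bnd_mul KK SK Qb'.
  by have := bnd_mul _ h1 h2; rewrite mul1r mulr1; apply.
have K20 : 0 <= 2 * K by rewrite mulr_ge0.
have -> : 4 * K ^+ 2 = (2 * K) * (2 * K) by ring.
by apply: bnd_mul => //; exact: bnd_tr.
Qed.

Lemma null_penalty_trace phi : fro (Q *m (1%:M - cutoff x b)) <= phi * n%:R ->
  \tr null_penalty <= K ^+ 2 * phi * n%:R.
Proof.
move=> h; rewrite -fro_trace /null_half -mulrA.
have KK : 0 <= K by exact: ltW.
apply: le_trans (fro_mulr _ KK _) _; first by rewrite -[K]mulr1; exact: bnd_mul.
by rewrite ler_wpM2l ?sqr_ge0.
Qed.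

Lemma null_penaltyE mu :
  enorm (Q *m ((1%:M - cutoff x b) *m (Sigma *m - (Q' *m mu)))) ^+ 2 = dot mu (null_penalty *m mu).
Proof.
rewrite !mulmxN enormN enorm_sqr /null_penalty -mulmxA -dot_mull.
by rewrite /null_half !mulmxA.
Qed.

Lemma null_cross_dot mu e :
  dot (Sigma *m - (Q' *m mu)) (cutoff x b *m - ((e *: res S e) *m (Q *m mu))) =
  dot mu (null_cross e *m mu).
Proof.
have gen (A C D E : 'M[R]_n) : A^T = A ->
    dot (Sigma *m (A *m mu)) (C *m (D *m (E *m mu))) = dot mu (A *m Sigma *m (C *m D) *m E *m mu).
  by move=> At; rewrite -!mulmxA [RHS]dot_mulr At [RHS]dot_mulr St.
by rewrite !mulmxN dotNl dotNr opprK; exact: gen.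
Qed.

(** Only the prediction risk can decrease below its value at [0]: for the two
    other risks the two parts of the error are orthogonal. *)
Lemma noiseless_gap k mu e e' phi ep rho : (0 < n)%N -> 0 < e -> 0 < e' -> `|e - e'| <= rho ->
  enorm mu <= 1 -> 0 <= ep -> 0 <= phi -> 0 <= rho ->
  fro (Q *m (1%:M - cutoff x b)) <= phi * n%:R ->
  `|dot mu (null_penalty *m mu) - dot mu mu * (\tr null_penalty / n%:R)| <= ep ->
  `|dot mu (null_cross e' *m mu) - dot mu mu * (\tr (null_cross e') / n%:R)| <= ep ->
  form (risk_weight x k Sigma) (ridge_path x mu 0 0) <=
    form (risk_weight x k Sigma) (ridge_path x mu 0 e) +
    (2 * K * (K ^+ 2 * phi + ep) + 2 * (ep + K * (rho / b))).
Proof.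
move=> n0 e0 e'0 ee' mu1 ep0 phi0 rho0 hphi hpen hcross.
have KK : 0 <= K by exact: ltW.
have nR : 0 < n%:R :> R by rewrite ltr0n.
have rb0 : 0 <= K * (rho / b) by rewrite mulr_ge0 // divr_ge0 // ltW.
have rest0 : 0 <= 2 * K * (K ^+ 2 * phi + ep) + 2 * (ep + K * (rho / b)).
  apply: addr_ge0; last by rewrite mulr_ge0 // addr_ge0.
  by rewrite mulr_ge0 ?mulr_ge0 // addr_ge0 // mulr_ge0 ?sqr_ge0.
rewrite noiseless_path0 noiseless_path //; set E := - (Q' *m mu).
set D := (e *: res S e) *m (Q *m mu).
have QD : Q *m - D = - D.
  rewrite mulmxN /D; congr (- _).
  by rewrite -scalemxAl -scalemxAr mulmxA -res_rangeprojC // -mulmxA (mulmxA Q) QQ.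
have orth : dot E (- D) = 0.
  by rewrite -QD dot_mulr Qt /E mulmxN mulmxA QQ' mul0mx oppr0 dotC dot0r.
case: k => /=.
- have KV0 : 0 < K^-1 by rewrite invr_gt0.
  have := form_lower_coercive E St KV0 Sk (cutoff_tr x b0) Qt QD.
  rewrite invrK /E null_penaltyE null_cross_dot -/E.
  set pen := dot mu _ in hpen *; set cr := dot mu _.
  have mu2 : dot mu mu <= 1 by rewrite -enorm_sqr expr_le1 ?enorm_ge0.
  have mu0 := dot_ge0 mu.
  have penle : pen <= K ^+ 2 * phi + ep.
    have tr : \tr null_penalty / n%:R <= K ^+ 2 * phi.
      by rewrite ler_pdivrMr //; exact: null_penalty_trace.
    have t0 : 0 <= \tr null_penalty / n%:R by rewrite divr_ge0 ?(ltW nR) // -fro_trace fro_ge0.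
    have t1 : dot mu mu * (\tr null_penalty / n%:R) <= K ^+ 2 * phi.
      by apply: le_trans tr; rewrite ler_piMl.
    by move: hpen => /ler_normlP[_]; move: t1; set a := _ * (_ / _); lra.
  have crle : - (ep + K * (rho / b)) <= cr.
    have : `|dot mu ((null_cross e - null_cross e') *m mu)| <= K * (rho / b).
      apply: le_trans (bnd_dot _ _ (null_cross_lip e0 e'0)) _.
      have h1 : K * (`|e - e'| / b) <= K * (rho / b).
        by rewrite ler_wpM2l // ler_wpM2r // invr_ge0 ltW.
      apply: le_trans h1; apply: ler_piMr; first by rewrite mulr_ge0 // divr_ge0 // ltW.
      by rewrite -expr2 enorm_sqr.
    rewrite mulmxBl dotBr -/cr; move: hcross; rewrite null_cross_trace mul0r mulr0 subr0.
    set c2 := dot mu _ => /ler_normlP[h1 _] /ler_normlP[h2 _]; lra.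
  have D0 : 0 <= K^-1 * enorm (- D) ^+ 2 / 2 by rewrite divr_ge0 // mulr_ge0 ?sqr_ge0 // ltW.
  have : 2 * K * pen <= 2 * K * (K ^+ 2 * phi + ep) by rewrite ler_wpM2l // mulr_ge0.
  set d := K^-1 * _ / 2 in D0 *; set f0 := form Sigma E; set f1 := form _ _; lra.
- rewrite /form !mul1mx -/E dotDl !dotDr orth [dot (- D) E]dotC orth.
  have := dot_ge0 (- D); lra.
- have SE : gram x *m E = 0.
    by rewrite /E mulmxN mulmxA mulmxBr mulmx1 gram_rangeproj subrr mul0mx oppr0.
  rewrite {1}/form SE dot0r; apply: addr_ge0 => //.
  by rewrite gram_form sqr_ge0.
Qed.

End noiseless.

Section noiseless_rates.
Context {R : realType} (vartheta : R) (n : nat).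
Hypotheses (th0 : 0 < vartheta < 1 / 50) (n0 : (0 < n)%N).

Local Notation N := (n%:R : R).
Local Notation s := (N `^ (- vartheta)).

Let th1 : 0 < vartheta. Proof. by case/andP: th0. Qed.
Let th2 : vartheta < 1 / 50. Proof. by case/andP: th0. Qed.
Let N0 : 0 < N. Proof. by rewrite ltr0n. Qed.
Let N1 : 1 <= N. Proof. by rewrite ler1n. Qed.
Let pow a b : a <= b -> N `^ a <= N `^ b. Proof. exact: ler_powR. Qed.
Let powD a b : N `^ a * N `^ b = N `^ (a + b).
Proof. by rewrite powRD //; apply/implyP => _; rewrite gt_eqF. Qed.
Let pow1 : N `^ 1 = N. Proof. by rewrite powRr1 // ltW. Qed.

Lemma slow_gt0 : 0 < s. Proof. exact: powR_gt0. Qed.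

Lemma slow_le1 : s <= 1.
Proof. by rewrite -[leRHS](powRr0 N); apply: pow; rewrite oppr_le0 ltW. Qed.

(** The exponents left by [vartheta < 1 / 50]: [slow_rate] for the probability of
    the event on the spectrum, [slow_count] for the size of the grid over the level
    of the Markov inequality, and [slow_mesh] for the concentration on the ball. *)
Lemma slow_rate : s^-1 * N^-1 <= N `^ (- (1 / 7)).
Proof.
rewrite -[N^-1]powR_inv1 ?(ltW N0) // powRN invrK powD; apply: pow; move: th1 th2; lra.
Qed.

Lemma slow_count : s ^- 2 / N `^ (- (1 / 7)) <= N.
Proof.
rewrite -exprVn powRN invrK powRN invrK expr2 !powD -[leRHS]pow1; apply: pow; move: th1 th2; lra.
Qed.

Lemma slow_mesh : Num.sqrt N <= N * s ^+ 4.
Proof.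
rewrite -powR12_sqrt ?(ltW N0) // !exprS expr0 mulr1 -{2}pow1 !powD; apply: pow; move: th1 th2; lra.
Qed.

Lemma exp_absorb_sqrt (M a C : R) : 0 <= M -> 0 < a -> a^-1 <= C -> M / a ^+ 2 <= C ->
  M * N * expR (- (4 * a * Num.sqrt N)) <= C * expR (- (N `^ vartheta) / C).
Proof.
move=> M0 a0 aC MC; have C0 : 0 < C by apply: lt_le_trans aC; rewrite invr_gt0.
set y := Num.sqrt N; have y0 : 0 <= y by exact: sqrtr_ge0.
have yth : N `^ vartheta <= y by rewrite /y -powR12_sqrt ?(ltW N0) //; apply: pow; move: th1 th2; lra.
have h1 : y <= a^-1 * expR (a * y).
  rewrite mulrC ler_pdivlMr //; have := expR_ge1Dx (a * y); lra.
have h2 : N <= (a^-1 * expR (a * y)) ^+ 2.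
  rewrite -[leLHS]sqr_sqrtr ?(ltW N0) // ler_pXn2r ?nnegrE //.
  by rewrite mulr_ge0 ?expR_ge0 // invr_ge0 ltW.
have -> : - (4 * a * y) = - (a * y) + - (a * y) + (- (a * y) + - (a * y)) by ring.
rewrite !expRD !expRN; set e := expR (a * y) in h1 h2 *.
have e0 : 0 < e by exact: expR_gt0.
have e1 : 1 <= e by rewrite /e -expR0 ler_expR mulr_ge0 // ltW.
have h3 : N * (e^-1 * e^-1) <= a ^- 2.
  have -> : a ^- 2 = (a^-1 * e) ^+ 2 * (e^-1 * e^-1) by rewrite -exprVn; field; rewrite !gt_eqF.
  by rewrite ler_wpM2r // mulr_ge0 // invr_ge0 ltW.
have h4 : e^-1 <= expR (- (N `^ vartheta) / C).
  rewrite /e -expRN ler_expR mulNr lerN2 mulrC; apply: ler_pM => //.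
  - by rewrite invr_ge0 ltW.
  - by rewrite invf_ple ?posrE.
have -> : M * N * (e^-1 * e^-1 * (e^-1 * e^-1)) = M * (N * (e^-1 * e^-1)) * (e^-1 * e^-1) by ring.
apply: ler_pM => //.
- by rewrite !mulr_ge0 // ?invr_ge0 ltW.
- by rewrite mulr_ge0 // invr_ge0 ltW.
- by apply: le_trans MC; rewrite ler_wpM2l.
- by apply: le_trans h4; apply: ler_piMl; [rewrite invr_ge0 ltW|rewrite invf_le1].
Qed.

End noiseless_rates.

(** The level of the cut-off, the tolerance and the mesh all decrease like powers
    of [s = n ^ (- vartheta)], slowly enough for the concentration bounds, and
    together they cost less than [s / 2] in [noiseless_gap]. *)
Lemma noiseless_case (R : realType) (B K vartheta : R) : 0 < B -> 0 < K ->
  0 < vartheta < 1 / 50 -> exists2 C : R, 0 < C &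
    forall (m n : nat) (Sigma : 'M[R]_n) (sigma : R)
      (d : measure_display) (T : measurableType d) (P : probability T R)
      (Z : 'I_m -> 'I_n -> {RV P >-> R}) (xi0 : 'I_m -> {RV P >-> R}),
    ridge_model B K Sigma sigma Z xi0 ->
    1 + 1 / K <= (aspect_ratio m n)^-1 <= K ->
    sigma ^+ 2 = 0 ->
    forall k : risk_kind,
    let risk mu0 w eta :=
      ridge_risk k Sigma mu0 (random_matrix Z w) (noise sigma xi0 w) eta in
    exists U : set 'cV[R]_n,
      [/\ borel_cV U,
          U `<=` eball n 1,
          1 - C * expR (- (n%:R `^ vartheta) / C) <=
            vol U / vol (eball n 1) &
          (ereal_sup [set P [set w |
             (min_over `[0, K] (risk mu0 w) + n%:R `^ (- vartheta)
              <= risk mu0 w 0)%R] | mu0 in U]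
           <= (C * n%:R `^ (- (1 / 7)))%R%:E)%E].
Proof.
move=> B0 K0 th0.
have gen (C x1 x2 x3 x4 : R) : 0 <= x1 -> 0 <= x2 -> 0 <= x3 -> 0 <= x4 ->
    0 < 2 * x1 + 2 + (x2 + 1) + x3 + x4 /\
    (2 * x1 + 2 + (x2 + 1) + x3 + x4 <= C ->
    [/\ 2 <= C, 2 * x1 <= C, x2 + 1 <= C, x3 <= C & x4 <= C]).
  by move=> *; split; [lra|move=> *; split; lra].
have gen2 (r v s : R) : r - s / 2 <= v -> v + s <= r -> 0 < s -> False by lra.
have gen3 (s u : R) : 0 < s -> u <= 1 -> s / 6 + (1 + u) * (s / 12) + s / 6 <= s / 2 by nra.
have [c c0 cE] : exists2 c, 0 <= c & c = 32 * 256 ^+ 2 :> R.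
  exists (32 * 256 ^+ 2); last exact: erefl.
  by rewrite expr2; lra.
have th01 : 0 < vartheta <= 1 by case/andP: th0 => -> /=; lra.
have [K1|K1] := leP 1 K; last first.
  exists 1 => // m n Sigma sigma d T P Z xi0 model; exfalso.
  have := covariance_ge1 (rm_n_gt0 model) (rm_Sigma_unit model) (rm_Sigma_bound model).
  by rewrite leNgt K1.
pose gam := K^-1 / (1 + K^-1).
have gam0 : 0 < gam by rewrite divr_gt0 ?addr_gt0 ?invr_gt0.
have rc0 : 0 < range_const K gam.
  by rewrite /range_const ltr_wpDl // divr_ge0 ?(ltW gam0) // mulr_ge0 ?sqr_ge0.
set rc := range_const K gam in rc0.
have K3 : 0 < K ^+ 3 by exact: exprn_gt0.
(* With these constants the three contributions to the loss in [noiseless_gap]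
   are at most [s / 6] each. *)
pose cb := (48 * K ^+ 3 * rc)^-1; pose ct := (96 * K ^+ 3)^-1; pose cr := (12 * K)^-1.
have cb0 : 0 < cb by rewrite invr_gt0 !mulr_gt0.
have ct0 : 0 < ct by rewrite invr_gt0 !mulr_gt0.
have cr0 : 0 < cr by rewrite invr_gt0 !mulr_gt0.
have ct1 : ct <= 1.
  have K31 : 1 <= K ^+ 3 by rewrite exprn_ege1.
  by rewrite invf_le1 ?mulr_gt0 //; lra.
pose rr := `|range_rate B K gam| / cb.
have rr0 : 0 <= rr by rewrite divr_ge0 // ltW.
pose a := (ct / 16) ^+ 2; have a0 : 0 < a by rewrite exprn_gt0 // divr_gt0.
pose M : R := 8 * (K / (cb * cr) + 2).
have M0 : 0 <= M.
  by rewrite mulr_ge0 // addr_ge0 // divr_ge0 ?(ltW K0) // mulr_ge0 // ltW.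
pose n0 := (c / ct ^+ 4) ^+ 2.
have n00 : 0 <= n0 by exact: sqr_ge0.
have Ma0 : 0 <= M / a ^+ 2 by rewrite divr_ge0 ?sqr_ge0.
have a0' : 0 <= a^-1 by rewrite invr_ge0 ltW.
exists (2 * n0 + 2 + (rr + 1) + a^-1 + M / a ^+ 2).
  exact: (gen 0 _ _ _ _ n00 rr0 a0' Ma0).1.
set C := _ + M / a ^+ 2.
have [C2 Cn Crate Ca CM] := (gen C _ _ _ _ n00 rr0 a0' Ma0).2 (lexx C).
clearbody C => m n Sigma sigma d T P Z xi0 model /andP[asp1 asp2] sigma0 k risk.
have m1 := rm_m_gt0 model; have n1 := rm_n_gt0 model.
have nR : 0 < n%:R :> R by rewrite ltr0n.
rewrite -[eball n 1]setD0.
have [nn0|nn0] := leP (n%:R : R) n0.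
  by apply: no_signals; exact: few_samples n1 nn0 Cn C2.
pose s : R := n%:R `^ (- vartheta).
have s0 : 0 < s := slow_gt0 vartheta n1.
have s1 : s <= 1 := slow_le1 th0 n1.
pose b := cb * s; pose tau := ct * s; pose rho := b * (cr * s).
have b0 : 0 < b by rewrite mulr_gt0.
have tau01 : 0 < tau <= 1 by rewrite mulr_gt0 //= mulr_ile1 // ltW.
have rho0 : 0 < rho by rewrite !mulr_gt0.
have mesh := slow_mesh th0 n1.
have ntau : 32 * 256 ^+ 2 <= n%:R * tau ^+ 4.
  rewrite -cE /tau exprMn mulrCA; apply: le_trans (ler_wpM2l _ mesh); last by rewrite exprn_ge0 // ltW.
  rewrite mulrC -ler_pdivrMr ?exprn_gt0 // -[leLHS]ger0_norm; last by rewrite divr_ge0 // exprn_ge0 // ltW.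
  by rewrite -sqrtr_sqr ler_wsqrtr // ltW.
have nball : 32 * 256 ^+ 2 <= n%:R :> R.
  apply: le_trans ntau _; rewrite -[leRHS]mulr1 ler_wpM2l ?(ltW nR) //.
  by case/andP: tau01 => t0 t1; rewrite expr_le1 // ltW.
have gn : gam * n%:R <= n%:R - m%:R := undersampling m1 K0 asp1.
have mn : m%:R <= K * n%:R :> R.
  apply: (@le_trans _ _ n%:R); last by rewrite ler_peMl // ltW.
  by rewrite -subr_ge0; apply: le_trans gn; rewrite mulr_ge0 // ltW.
pose x w := design Sigma (random_matrix Z w).
have SK := covariance_bnd (rm_Sigma_bound model).
have St := (rm_Sigma_psd model).1.
have Sk := covariance_form_ge n1 (rm_Sigma_psd model) (rm_Sigma_unit model) (rm_Sigma_bound model).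
pose Nj := (Num.trunc (K / rho)).+1.
pose F (j : 'I_Nj.+1) : T -> 'M[R]_n :=
  if (j < Nj)%N then fun w => null_cross (x w) Sigma b (eta_grid 0 rho j)
  else fun w => null_penalty (x w) Sigma b.
have eta0 j : 0 < eta_grid 0 rho j.
  by rewrite /eta_grid max_r ?(ltW rho0) // ltr_wpDr // mulr_ge0 // ltW.
have mx : mxmeas x.
  by apply: mxmeas_sub (mxmeas_design Sigma (Z := Z)); exact: Zsys_measurable.
have mQ : mxmeas (fun w => rangeproj (x w)) by exact: mxmeas_rangeproj.
have mQ' : mxmeas (fun w => 1%:M - rangeproj (x w)) by apply: mxmeasB => //; exact: mxmeas_cst.
have mB : mxmeas (fun w => cutoff (x w) b) by exact: mxmeas_cutoff.
have mS : mxmeas (fun _ : T => Sigma) by exact: mxmeas_cst.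
have mF j : mxmeas (F j).
  rewrite /F; case: ifP => _.
    apply: mxmeasM => //; apply: mxmeasM; first exact: mxmeasM.
    by apply: mxmeasM => //; apply: mxmeasZ; exact: mxmeas_res.
  have mh : mxmeas (fun w => null_half (x w) Sigma b).
    apply: mxmeasM; last exact: mxmeasM.
    by apply: mxmeasM => //; apply: mxmeasB => //; exact: mxmeas_cst.
  by apply: mxmeasM => //; exact: mxmeas_tr.
have be0 : 0 < 4 * K ^+ 2 by rewrite mulr_gt0 // exprn_gt0.
have Fb j w : bnd (F j w) (4 * K ^+ 2).
  rewrite /F; case: ifP => _; last exact: null_penalty_bnd.
  apply: bnd_le (null_cross_bnd (x w) K1 b0 SK (eta0 j)) _.
  by rewrite expr2 mulrA ler_peMl ?(ltW K0) //; lra.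
pose p : R := n%:R `^ (- (1 / 7)).
have p0 : 0 < p by exact: powR_gt0.
have [N [mN Nball Nsmall Ntyp]] := typical_signals P mF be0 Fb tau01 ntau p0.
rewrite card_ord in Nsmall.
apply: (most_signals mN Nsmall nball (q := rr * p + p)).
- by rewrite /borel_cV preimage_set0; exact: measurable0.
- by move=> v [].
- by rewrite preimage_set0 measure0; apply: mule_ge0 => //; rewrite lee_fin invr_ge0.
- move=> mu; apply: measurable_set_le; last exact: (measurable_risk model).
  apply: measurable_funD; last exact: measurable_cst.
  apply: (@measurable_min_over _ _ _ _ (fun e w => risk mu w e)) => //.
  - by exists 0; rewrite /= in_itv /= lexx ltW.
  - by move=> e /=; rewrite in_itv /= => /andP[e0 _]; exact: (measurable_risk model).
  - move=> w; have [q q0 hq] := risk_lipschitz model k mu w (ltW K0).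
    by exists q => // e1 e2 /=; rewrite !in_itv /=; exact: hq.
  - by move=> e w _; exact: risk_ge0.
- move=> t t1 Nt _.
  have range_ev := range_trace_high B0 model mn b0 gam0 gn.
  apply: negl_le (negl_sub _ (neglU range_ev (Ntyp t t1 Nt))).
    rewrite lerD2r; apply: (@le_trans _ _ (rr * (s^-1 / n%:R))).
      rewrite /rr /b mulrA ler_wpM2r ?invr_ge0 ?(ltW nR) // -mulrA -invfM ler_wpM2r ?ler_norm //.
      by rewrite invr_ge0 ltW.
    by rewrite ler_wpM2l //; exact: slow_rate.
  move=> w /= bad; apply: contrapT => /not_orP[/contrapT trace_ev mu_ev].
  set mu := coords t in bad mu_ev.
  have mu1 : enorm mu <= 1.
    by move: t1; rewrite /ballT /= /norm2 -/mu -enorm_sqr ler_pXn2r ?nnegrE ?enorm_ge0.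
  have signal j : `|dot mu (F j w *m mu) - dot mu mu * (\tr (F j w) / n%:R)| <= 4 * K ^+ 2 * tau.
    by apply: contrapT => h; apply: mu_ev; exists j.
  have hphi : fro (rangeproj (x w) *m (1%:M - cutoff (x w) b)) <= 4 * (rc * b) * n%:R.
    apply: le_trans (cutoffC_fro _ b0) _.
    by rewrite -[leRHS]mulrA ler_pM2l.
  have noise0 : scaled_noise n sigma xi0 w = 0.
    have s00 : sigma = 0 by apply/eqP; rewrite -sqrf_eq0 sigma0.
    rewrite /scaled_noise (_ : noise _ _ _ = 0) ?scaler0 //.
    by apply/matrixP => i j; rewrite !mxE s00 mul0r.
  have low e : 0 <= e <= K -> risk mu w 0 <= risk mu w e + s / 2.
    move=> /andP[e0 eK]; rewrite /risk (risk_path model _ _ _ (lexx 0)) (risk_path model _ _ _ e0) noise0.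
    have [->|en] := eqVneq e 0; first by rewrite lerDl divr_ge0 // ltW.
    have {en}e0 : 0 < e by rewrite lt_neqAle eq_sym en.
    have [j jN ej] := eta_grid_approx rho0 (lexx 0) e0 (ltW e0) eK.
    have jN1 : (j < Nj.+1)%N by apply: leq_trans jN _.
    have h1 := signal (Ordinal jN1); rewrite /F /= jN in h1.
    have h2 := signal ord_max; rewrite /F /= ltnn in h2.
    have ep0 : 0 <= 4 * K ^+ 2 * tau by rewrite mulr_ge0 ?(ltW be0) //; case/andP: tau01 => /ltW.
    have phi0 : 0 <= 4 * (rc * b) by rewrite !mulr_ge0 // ltW.
    apply: le_trans (noiseless_gap K1 b0 SK St Sk k n1 e0 (eta0 j) ej mu1 ep0 phi0 (ltW rho0) hphi h2 h1) _.
    rewrite lerD2l.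
    have -> : 2 * K * (K ^+ 2 * (4 * (rc * b)) + 4 * K ^+ 2 * tau) +
        2 * (4 * K ^+ 2 * tau + K * (rho / b)) = s / 6 + (1 + K^-1) * (s / 12) + s / 6.
      rewrite /rho (mulrC b) mulfK ?gt_eqF // /b /tau /cb /ct /cr; field.
      by rewrite !gt_eqF.
    by apply: gen3 => //; rewrite invf_le1.
  have : risk mu w 0 - s / 2 <= min_over `[0, K] (risk mu w).
    apply: lb_le_inf; first by exists (risk mu w 0); exists 0; rewrite //= in_itv /= lexx ltW.
    move=> _ [e he <-]; move: he; rewrite /= in_itv /= => he.
    by rewrite lerBlDr; exact: low.
  move=> h; exact: gen2 h bad s0.
- have sV : 1 <= s ^- 2 by rewrite invf_ge1 ?exprn_gt0 // expr_le1 // ltW.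
  have count : Nj.+1%:R <= (K / (cb * cr) + 2) * s ^- 2.
    have Krho : K / rho = K / (cb * cr) * s ^- 2 by rewrite /rho /b; field; rewrite !gt_eqF.
    have tr : (Num.trunc (K / rho))%:R <= K / rho by rewrite truncn_le divr_ge0 // ltW.
    rewrite mulrDl -Krho /Nj -[_.+2]addn2 natrD; apply: lerD => //.
    by rewrite ler_peMr.
  have decay : expR (- (n%:R * tau ^+ 2 / 64)) <= expR (- (4 * a * Num.sqrt n%:R)).
    rewrite ler_expR lerN2 /tau /a.
    have -> : n%:R * (ct * s) ^+ 2 / 64 = ct ^+ 2 / 64 * (n%:R * s ^+ 2) by field.
    have -> : 4 * (ct / 16) ^+ 2 * Num.sqrt n%:R = ct ^+ 2 / 64 * Num.sqrt n%:R by field.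
    have ct64 : 0 <= ct ^+ 2 / 64 by rewrite divr_ge0 ?sqr_ge0.
    apply: ler_wpM2l ct64 _ _ _; apply: le_trans mesh _.
    by rewrite ler_wpM2l ?(ltW nR) // -/s ler_wiXn2l // ltW.
  apply: le_trans (exp_absorb_sqrt th0 n1 M0 a0 Ca CM).
  rewrite -/p; have -> : 2 * (4 * Nj.+1%:R * expR (- (n%:R * tau ^+ 2 / 64)) / p) =
    8 * (Nj.+1%:R / p) * expR (- (n%:R * tau ^+ 2 / 64)) by ring.
  apply: ler_pM => //; rewrite ?expR_ge0 ?mulr_ge0 ?invr_ge0 ?(ltW p0) //.
  rewrite /M -[leRHS]mulrA ler_pM2l //.
  apply: (@le_trans _ _ ((K / (cb * cr) + 2) * s ^- 2 / p)).
    by rewrite ler_wpM2r // invr_ge0 ltW.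
  rewrite -mulrA; apply: ler_wpM2l (slow_count th0 n1).
  by rewrite addr_ge0 // divr_ge0 ?(ltW K0) // mulr_ge0 // ltW.
- by rewrite -/p -{2}[p]mul1r -mulrDl ler_wpM2r // ltW.
Qed.

Theorem theorem11p5 (R : realType) (B : R) (hB : 0 < B) :
  exists2 vartheta0 : R, 0 < vartheta0 <= 1 / 50 &
  forall vartheta : R, 0 < vartheta < vartheta0 ->
  forall K : R, 0 < K ->
  (forall delta L : R, 0 < delta <= 1 / 2 -> K / delta ^+ 2 <= L ->
    exists2 C : R, 0 < C &
    forall (m n : nat) (Sigma : 'M[R]_n) (sigma : R)
      (d : measure_display) (T : measurableType d) (P : probability T R)
      (Z : 'I_m -> 'I_n -> {RV P >-> R}) (xi0 : 'I_m -> {RV P >-> R}),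
    ridge_model B K Sigma sigma Z xi0 ->
    1 / K <= (aspect_ratio m n)^-1 <= K ->
    1 / K <= sigma ^+ 2 <= K ->
    forall k : risk_kind,
    let risk mu0 w eta :=
      ridge_risk k Sigma mu0 (random_matrix Z w) (noise sigma xi0 w) eta in
    exists U : set 'cV[R]_n,
      [/\ borel_cV U,
          U `<=` eball n 1 `\` eball n delta,
          1 - C * expR (- (n%:R `^ vartheta) / C) <=
            vol U / vol (eball n 1 `\` eball n delta) &
          (ereal_sup [set P [set w |
             ereal_inf [set (`| risk mu0 w eta' -
                                min_over (Xi m n L) (risk mu0 w) |%R)%:E
                       | eta' in Xi m n L `&`
                           [set e | (delta <= `| e - (SNR sigma mu0)^-1 |)%R]]
             < (1 / C)%R%:E] | mu0 in U]
           <= (C * n%:R `^ (- (1 / 7)))%R%:E)%E])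
  /\
  (exists2 C : R, 0 < C &
    forall (m n : nat) (Sigma : 'M[R]_n) (sigma : R)
      (d : measure_display) (T : measurableType d) (P : probability T R)
      (Z : 'I_m -> 'I_n -> {RV P >-> R}) (xi0 : 'I_m -> {RV P >-> R}),
    ridge_model B K Sigma sigma Z xi0 ->
    1 + 1 / K <= (aspect_ratio m n)^-1 <= K ->
    sigma ^+ 2 = 0 ->
    forall k : risk_kind,
    let risk mu0 w eta :=
      ridge_risk k Sigma mu0 (random_matrix Z w) (noise sigma xi0 w) eta in
    exists U : set 'cV[R]_n,
      [/\ borel_cV U,
          U `<=` eball n 1,
          1 - C * expR (- (n%:R `^ vartheta) / C) <=
            vol U / vol (eball n 1) &
          (ereal_sup [set P [set w |
             (min_over `[0, K] (risk mu0 w) + n%:R `^ (- vartheta)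
              <= risk mu0 w 0)%R] | mu0 in U]
           <= (C * n%:R `^ (- (1 / 7)))%R%:E)%E]).
Proof.
exists (1 / 50); first by rewrite lexx andbT divr_gt0.
move=> vartheta th0 K K0; split; last exact: noiseless_case.
move=> delta L delta01 KL; apply: noisy_case => //.
by case/andP: th0 => -> /= th; lra.
Qed.
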